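(* Let $H:\mathbb{R}^4\to\mathbb{R}$ be $C^\infty$ with $H(0)=0$, $dH(0)=0$ and the origin a non-degenerate critical point; suppose the linearization $L$ of $\xi_H$ at the origin has eigenvalues $a,b,-a,-b$ ($a,b>0$) with eigenvectors $e_1,e_2,e_3,e_4$, that $a,b$ are linearly independent over $\mathbb{Q}$, and that each of $\{\pi_*e_1,\pi_*e_2\}$, $\{\pi_*e_3,\pi_*e_4\}$, $\{\pi_*e_1,\pi_*e_4\}$, $\{\pi_*e_2,\pi_*e_3\}$ is linearly independent. Let $z$ be a solution of $H(x,y,z_x,z_y)=0$ with $z(0,0)=z_x(0,0)=z_y(0,0)=0$ whose jet near the origin is either the stable or the unstable submanifold of $\xi_H$ at the origin. If $\tilde z$ is any $C^2$ solution with $\tilde z(0,0)=\tilde z_x(0,0)=\tilde z_y(0,0)=0$ whose jet is tangent to the jet of $z$ at the origin (equivalently $\tilde z_{xx},\tilde z_{xy},\tilde z_{yy}$ agree with $z_{xx},z_{xy},z_{yy}$ at $(0,0)$), then $\tilde z=z$ in a neighborhood of the origin.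
   Context: Coordinates $(x,y,p,q)$ on $\mathbb{R}^4$, $\pi(x,y,p,q)=(x,y)$. The characteristic vector field is $\xi_H=H_p\partial_x+H_q\partial_y-H_x\partial_p-H_y\partial_q$, with flow $\Phi_t$, and $L$ is its linearization at the origin. The stable (resp. unstable) submanifold at the origin is the set of points $P$ in a small neighborhood of the origin with $\Phi_t(P)\to0$ as $t\to+\infty$ (resp. $t\to-\infty$). The jet of $z$ is $\{(x,y,z_x,z_y)\}$. *)

(* Defs.v *)
From Stdlib Require Import Reals QArith Qreals List.
From Coquelicot Require Import Coquelicot.
Open Scope R_scope.

(** Points of R^4 with coordinates (x, y, p, q). *)
Record R4 := mk4 { c0 : R; c1 : R; c2 : R; c3 : R }.
Definition zero4 : R4 := mk4 0 0 0 0.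
Definition scale4 (l : R) (v : R4) : R4 :=
  mk4 (l * c0 v) (l * c1 v) (l * c2 v) (l * c3 v).
Definition in_ball4 (r : R) (P : R4) : Prop :=
  Rabs (c0 P) < r /\ Rabs (c1 P) < r /\ Rabs (c2 P) < r /\ Rabs (c3 P) < r.

Definition F4 := R -> R -> R -> R -> R.
Definition app4 (f : F4) (P : R4) : R := f (c0 P) (c1 P) (c2 P) (c3 P).

Definition pd4 (i : nat) (f : F4) : F4 := fun x y p q =>
  match i with
  | O => Derive (fun t => f t y p q) x
  | 1%nat => Derive (fun t => f x t p q) y
  | 2%nat => Derive (fun t => f x y t q) p
  | _ => Derive (fun t => f x y p t) q
  end.
Definition ex_pd4 (i : nat) (f : F4) (x y p q : R) : Prop :=
  match i with
  | O => ex_derive (fun t => f t y p q) x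
  | 1%nat => ex_derive (fun t => f x t p q) y
  | 2%nat => ex_derive (fun t => f x y t q) p
  | _ => ex_derive (fun t => f x y p t) q
  end.
Definition cont4 (f : F4) (x y p q : R) : Prop :=
  forall eps, 0 < eps -> exists delta, 0 < delta /\
    forall x' y' p' q', Rabs (x' - x) < delta -> Rabs (y' - y) < delta ->
      Rabs (p' - p) < delta -> Rabs (q' - q) < delta ->
      Rabs (f x' y' p' q' - f x y p q) < eps.
Fixpoint iter_pd4 (l : list nat) (f : F4) : F4 :=
  match l with nil => f | i :: l' => pd4 i (iter_pd4 l' f) end.
Definition smooth4 (f : F4) : Prop :=
  forall l : list nat,
    (forall x y p q, cont4 (iter_pd4 l f) x y p q) /\
    (forall i x y p q, ex_pd4 i (iter_pd4 l f) x y p q).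

Definition d0 (g : F4) (v : R4) : R :=
  pd4 0 g 0 0 0 0 * c0 v + pd4 1 g 0 0 0 0 * c1 v
  + pd4 2 g 0 0 0 0 * c2 v + pd4 3 g 0 0 0 0 * c3 v.
Definition hess0 (H : F4) (v : R4) : R4 :=
  mk4 (d0 (pd4 0 H) v) (d0 (pd4 1 H) v) (d0 (pd4 2 H) v) (d0 (pd4 3 H) v).
Definition nondegenerate0 (H : F4) : Prop :=
  forall v, hess0 H v = zero4 -> v = zero4.

Definition xiH (H : F4) (P : R4) : R4 :=
  mk4 (app4 (pd4 2 H) P) (app4 (pd4 3 H) P)
      (- app4 (pd4 0 H) P) (- app4 (pd4 1 H) P).
Definition linL (H : F4) (v : R4) : R4 :=
  mk4 (d0 (pd4 2 H) v) (d0 (pd4 3 H) v) (- d0 (pd4 0 H) v) (- d0 (pd4 1 H) v).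
Definition eigvec (H : F4) (lam : R) (e : R4) : Prop :=
  e <> zero4 /\ linL H e = scale4 lam e.

Definition pi_indep (u v : R4) : Prop :=
  forall al be : R, al * c0 u + be * c0 v = 0 -> al * c1 u + be * c1 v = 0 ->
    al = 0 /\ be = 0.
Definition Q_indep (a b : R) : Prop :=
  forall r s : Q, Q2R r * a + Q2R s * b = 0 -> Q2R r = 0 /\ Q2R s = 0.

Definition is_traj (H : F4) (phi : R -> R4) (T : R -> Prop) : Prop :=
  forall t, T t ->
    is_derive (fun s => c0 (phi s)) t (c0 (xiH H (phi t))) /\
    is_derive (fun s => c1 (phi s)) t (c1 (xiH H (phi t))) /\
    is_derive (fun s => c2 (phi s)) t (c2 (xiH H (phi t))) /\
    is_derive (fun s => c3 (phi s)) t (c3 (xiH H (phi t))).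
Definition flows_to_0_fwd (H : F4) (P : R4) : Prop :=
  exists phi : R -> R4, phi 0 = P /\ is_traj H phi (fun t => 0 <= t) /\
    is_lim (fun t => c0 (phi t)) p_infty 0 /\ is_lim (fun t => c1 (phi t)) p_infty 0 /\
    is_lim (fun t => c2 (phi t)) p_infty 0 /\ is_lim (fun t => c3 (phi t)) p_infty 0.
Definition flows_to_0_bwd (H : F4) (P : R4) : Prop :=
  exists phi : R -> R4, phi 0 = P /\ is_traj H phi (fun t => t <= 0) /\
    is_lim (fun t => c0 (phi t)) m_infty 0 /\ is_lim (fun t => c1 (phi t)) m_infty 0 /\
    is_lim (fun t => c2 (phi t)) m_infty 0 /\ is_lim (fun t => c3 (phi t)) m_infty 0.

Definition F2 := R -> R -> R.
Definition pd2 (i : nat) (f : F2) : F2 := fun x y =>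
  match i with O => Derive (fun t => f t y) x | _ => Derive (fun t => f x t) y end.
Definition ex_pd2 (i : nat) (f : F2) (x y : R) : Prop :=
  match i with O => ex_derive (fun t => f t y) x | _ => ex_derive (fun t => f x t) y end.
Definition cont2 (f : F2) (x y : R) : Prop :=
  forall eps, 0 < eps -> exists delta, 0 < delta /\
    forall x' y', Rabs (x' - x) < delta -> Rabs (y' - y) < delta ->
      Rabs (f x' y' - f x y) < eps.
Fixpoint iter_pd2 (l : list nat) (f : F2) : F2 :=
  match l with nil => f | i :: l' => pd2 i (iter_pd2 l' f) end.
Definition in_ball2 (r x y : R) : Prop := Rabs x < r /\ Rabs y < r.
Definition C2_on (r : R) (f : F2) : Prop :=
  forall x y, in_ball2 r x y ->
    forall l : list nat, (length l <= 2)%nat ->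
      cont2 (iter_pd2 l f) x y /\
      ((length l <= 1)%nat -> forall i, ex_pd2 i (iter_pd2 l f) x y).
Definition zx (z : F2) : F2 := pd2 0 z.
Definition zy (z : F2) : F2 := pd2 1 z.
Definition solves_on (H : F4) (r : R) (z : F2) : Prop :=
  forall x y, in_ball2 r x y -> H x y (zx z x y) (zy z x y) = 0.
Definition jet (z : F2) (r : R) (P : R4) : Prop :=
  exists x y, in_ball2 r x y /\ P = mk4 x y (zx z x y) (zy z x y).

(* Main.v *)
From Stdlib Require Import Reals QArith Qreals List Lra Lia Psatz Classical ClassicalEpsilon.
From Coquelicot Require Import Coquelicot.
Require Import Defs.
Open Scope R_scope.

(** The tangent plane at the origin of the jet of a solution is invariant under [L], hence
    spanned by two eigenvectors; let [A] be the projection of [L] restricted to this plane.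

    If the two eigenvalues have the same sign, no dynamics is needed: by the mean value theorem
    [u = zt - z] satisfies [B . grad u = 0] with [B (w) = A w + o(|w|)], and in linear
    coordinates [(xi, eta)] diagonalizing [A] the function [u - eps (xi^2 + eta^2)] can attain
    its maximum over a small box only at the origin. Letting [eps] tend to [0], and exchanging
    [z] and [zt], gives [u = 0].

    If the signs are opposite, the jet cannot be the stable or unstable submanifold. The flow on
    the jet is then a planar saddle, and a trajectory tending to [0] eventually lies on its
    one-dimensional stable curve; so all points of the jet near the origin lie on the two orbits
    making up this curve. A segment transversal to the flow is crossed by an orbit only
    countably often, yet every point of the segment would be such a crossing. *)

(** * Differentiability estimates *)

(** Two lacks of regularity shape the proof. The coefficients [B] come from the mean value theorem
    point by point and need not even be continuous, so [B] has no characteristics to follow; a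
    maximum principle asks only for its values. And [z] is merely C^2, so its jet is a C^1 surface
    carrying a C^1 planar field. Instead of constructing a stable curve for it, two trajectories
    tending to the origin are compared directly: their difference obeys the linear saddle equation
    up to a small relative error. This is why differentiability at the origin is used throughout in
    its strict form, with two moving points. Uniqueness of orbits is taken from the smooth flow on
    R^4. A sign [sg] reverses time, so that the stable and the unstable case share one argument. *)

Lemma between_near (c d a b t : R) :
  Rabs (a - c) < d -> Rabs (b - c) < d -> Rmin a b <= t <= Rmax a b -> Rabs (t - c) < d.
Proof.
  intros Ha Hb Ht. apply Rabs_def2 in Ha. apply Rabs_def2 in Hb.
  unfold Rmin, Rmax in Ht. destruct (Rle_dec a b); apply Rabs_def1; lra.
Qed.

Lemma increment_bound (f : R -> R) (a b l eps : R) :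
  (forall t, Rmin a b <= t <= Rmax a b -> ex_derive f t /\ Rabs (Derive f t - l) <= eps) ->
  Rabs (f b - f a - l * (b - a)) <= eps * Rabs (b - a).
Proof.
  intros H.
  destruct (MVT_gen f a b (Derive f)) as [c [Hc E]].
  - intros x Hx. apply Derive_correct. apply H. lra.
  - intros x Hx. apply continuity_pt_filterlim.
    apply (ex_derive_continuous f x). apply H. lra.
  - rewrite E. replace (Derive f c * (b - a) - l * (b - a)) with ((Derive f c - l) * (b - a)) by ring.
    rewrite Rabs_mult. apply Rmult_le_compat_r. apply Rabs_pos. now apply H.
Qed.

(** Changing one coordinate at a time reduces this to four one-variable increments, whose
    intermediate points stay near the base point. Continuity of the partials is needed at that point
    alone. *)
Lemma strict_diff4 (f : F4) (x0 y0 p0 q0 r : R) :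
  0 < r ->
  (forall i x y p q, Rabs (x - x0) < r -> Rabs (y - y0) < r ->
     Rabs (p - p0) < r -> Rabs (q - q0) < r -> ex_pd4 i f x y p q) ->
  (forall i, cont4 (pd4 i f) x0 y0 p0 q0) ->
  forall eps, 0 < eps -> exists d, 0 < d /\ forall x y p q x' y' p' q',
    Rabs (x - x0) < d -> Rabs (y - y0) < d -> Rabs (p - p0) < d -> Rabs (q - q0) < d ->
    Rabs (x' - x0) < d -> Rabs (y' - y0) < d -> Rabs (p' - p0) < d -> Rabs (q' - q0) < d ->
    Rabs (f x' y' p' q' - f x y p q
          - (pd4 0 f x0 y0 p0 q0 * (x' - x) + pd4 1 f x0 y0 p0 q0 * (y' - y)
             + pd4 2 f x0 y0 p0 q0 * (p' - p) + pd4 3 f x0 y0 p0 q0 * (q' - q)))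
    <= eps * (Rabs (x' - x) + Rabs (y' - y) + Rabs (p' - p) + Rabs (q' - q)).
Proof.
  intros Hr Hex Hc eps He.
  destruct (Hc 0%nat eps He) as [d0 [D0 C0]].
  destruct (Hc 1%nat eps He) as [d1 [D1 C1]].
  destruct (Hc 2%nat eps He) as [d2 [D2 C2]].
  destruct (Hc 3%nat eps He) as [d3 [D3 C3]].
  set (d := Rmin r (Rmin (Rmin d0 d1) (Rmin d2 d3))).
  assert (Hd : d <= r /\ d <= d0 /\ d <= d1 /\ d <= d2 /\ d <= d3).
  { unfold d, Rmin. repeat destruct Rle_dec; lra. }
  exists d. split. unfold d, Rmin; repeat destruct Rle_dec; lra.
  clearbody d.
  intros x y p q x' y' p' q' Hx Hy Hp Hq Hx' Hy' Hp' Hq'.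
  assert (I0 := increment_bound (fun t => f t y p q) x x' (pd4 0 f x0 y0 p0 q0) eps).
  assert (I1 := increment_bound (fun t => f x' t p q) y y' (pd4 1 f x0 y0 p0 q0) eps).
  assert (I2 := increment_bound (fun t => f x' y' t q) p p' (pd4 2 f x0 y0 p0 q0) eps).
  assert (I3 := increment_bound (fun t => f x' y' p' t) q q' (pd4 3 f x0 y0 p0 q0) eps).
  cbv beta in *.
  lapply I0; clear I0.
  2:{ intros t Ht. pose proof (between_near x0 d _ _ t Hx Hx' Ht). split.
      apply (Hex 0%nat); lra. left. apply (C0 t y p q); lra. }
  lapply I1; clear I1.
  2:{ intros t Ht. pose proof (between_near y0 d _ _ t Hy Hy' Ht). split.
      apply (Hex 1%nat); lra. left. apply (C1 x' t p q); lra. }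
  lapply I2; clear I2.
  2:{ intros t Ht. pose proof (between_near p0 d _ _ t Hp Hp' Ht). split.
      apply (Hex 2%nat); lra. left. apply (C2 x' y' t q); lra. }
  lapply I3; clear I3.
  2:{ intros t Ht. pose proof (between_near q0 d _ _ t Hq Hq' Ht). split.
      apply (Hex 3%nat); lra. left. apply (C3 x' y' p' t); lra. }
  intros I3 I2 I1 I0.
  apply Rabs_le_between in I0. apply Rabs_le_between in I1.
  apply Rabs_le_between in I2. apply Rabs_le_between in I3.
  apply Rabs_le_between. lra.
Qed.

Lemma strict_diff2 (f : F2) (x0 y0 r : R) :
  0 < r ->
  (forall i x y, Rabs (x - x0) < r -> Rabs (y - y0) < r -> ex_pd2 i f x y) ->
  (forall i, cont2 (pd2 i f) x0 y0) ->
  forall eps, 0 < eps -> exists d, 0 < d /\ forall x y x' y',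
    Rabs (x - x0) < d -> Rabs (y - y0) < d -> Rabs (x' - x0) < d -> Rabs (y' - y0) < d ->
    Rabs (f x' y' - f x y - (pd2 0 f x0 y0 * (x' - x) + pd2 1 f x0 y0 * (y' - y)))
    <= eps * (Rabs (x' - x) + Rabs (y' - y)).
Proof.
  intros Hr Hex Hc eps He.
  destruct (Hc 0%nat eps He) as [d0 [D0 C0]].
  destruct (Hc 1%nat eps He) as [d1 [D1 C1]].
  set (d := Rmin r (Rmin d0 d1)).
  assert (Hd : d <= r /\ d <= d0 /\ d <= d1).
  { unfold d, Rmin. repeat destruct Rle_dec; lra. }
  exists d. split. unfold d, Rmin; repeat destruct Rle_dec; lra.
  clearbody d.
  intros x y x' y' Hx Hy Hx' Hy'.
  assert (I0 := increment_bound (fun t => f t y) x x' (pd2 0 f x0 y0) eps).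
  assert (I1 := increment_bound (fun t => f x' t) y y' (pd2 1 f x0 y0) eps).
  cbv beta in *.
  lapply I0; clear I0.
  2:{ intros t Ht. pose proof (between_near x0 d _ _ t Hx Hx' Ht). split.
      apply (Hex 0%nat); lra. left. apply (C0 t y); lra. }
  lapply I1; clear I1.
  2:{ intros t Ht. pose proof (between_near y0 d _ _ t Hy Hy' Ht). split.
      apply (Hex 1%nat); lra. left. apply (C1 x' t); lra. }
  intros I1 I0.
  apply Rabs_le_between in I0. apply Rabs_le_between in I1.
  apply Rabs_le_between. lra.
Qed.

Lemma Rabs_sum4 (g0 g1 g2 g3 u0 u1 u2 u3 : R) :
  Rabs (g0 * u0 + g1 * u1 + g2 * u2 + g3 * u3) <=
  Rabs g0 * Rabs u0 + Rabs g1 * Rabs u1 + Rabs g2 * Rabs u2 + Rabs g3 * Rabs u3.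
Proof.
  rewrite <- !Rabs_mult.
  eapply Rle_trans. apply Rabs_triang. apply Rplus_le_compat_r.
  eapply Rle_trans. apply Rabs_triang. apply Rplus_le_compat_r. apply Rabs_triang.
Qed.

(** * Countability, and a maximum principle on a box *)

(** A point of [K] in the first third leaves none for the last third. *)
Lemma subinterval_avoiding (K : R -> Prop) (u v : R) :
  u < v ->
  (forall s s', u <= s <= v -> u <= s' <= v -> K s -> K s' -> s = s') ->
  exists u' v', u <= u' /\ u' < v' /\ v' <= v /\ forall s, u' <= s <= v' -> ~ K s.
Proof.
  intros Huv HK.
  destruct (classic (exists s, u <= s <= u + (v - u) / 3 /\ K s)) as [[s [Hs Ks]]|N].
  - exists (v - (v - u) / 3), v. repeat split; try lra.
    intros s' Hs' Ks'. assert (s = s') by (apply HK; auto; lra). lra.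
  - exists u, (u + (v - u) / 3). repeat split; try lra.
    intros s' Hs' Ks'. apply N. exists s'. auto.
Qed.

(** Cantor's nested intervals. A relation takes the place of an enumeration, so a point may carry
    several labels; stage [n] removes the points labelled [n] and [- n]. *)
Lemma interval_not_countable (K : R -> Z -> Prop) (a b : R) :
  a < b ->
  (forall s, a <= s <= b -> exists n, K s n) ->
  (forall s s' n, a <= s <= b -> a <= s' <= b -> K s n -> K s' n -> s = s') -> False.
Proof.
  intros Hab Hex Huniq.
  set (good := fun I : R * R => a <= fst I /\ fst I < snd I /\ snd I <= b).
  assert (Hstep : forall p : nat * (R * R), exists J : R * R, good (snd p) ->
    fst (snd p) <= fst J /\ fst J < snd J /\ snd J <= snd (snd p) /\
    forall s, fst J <= s <= snd J ->
      ~ K s (Z.of_nat (fst p)) /\ ~ K s (- Z.of_nat (fst p))%Z).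
  { intros [n [u v]]. simpl.
    (* Degenerate intervals get a dummy successor, so that choice yields a total function. *)
    destruct (classic (good (u, v))) as [G|G]; [|exists (0, 0); tauto].
    destruct G as [G1 [G2 G3]]; simpl in *.
    destruct (subinterval_avoiding (fun s => K s (Z.of_nat n)) u v) as [u1 [v1 [A1 [A2 [A3 A4]]]]]; auto.
    { intros. apply (Huniq s s' (Z.of_nat n)); auto; lra. }
    destruct (subinterval_avoiding (fun s => K s (- Z.of_nat n)%Z) u1 v1) as [u2 [v2 [B1 [B2 [B3 B4]]]]]; auto.
    { intros. apply (Huniq s s' (- Z.of_nat n)%Z); auto; lra. }
    exists (u2, v2). simpl. intros _. repeat split; try lra.
    apply A4; lra. apply B4; lra. }
  destruct (choice _ Hstep) as [F HF].
  set (I := nat_rect (fun _ => (R * R)%type) (a, b) (fun n J => F (n, J))).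
  assert (GI : forall n, good (I n)).
  { induction n as [|n IH]. unfold good; simpl; lra.
    simpl. pose proof (HF (n, I n) IH) as [P1 [P2 [P3 _]]]. simpl in *.
    unfold good in *. fold (I n) in *. lra. }
  assert (mono : forall n m, (n <= m)%nat -> fst (I n) <= fst (I m) /\ snd (I m) <= snd (I n)).
  { intros n m Hnm. induction Hnm as [|m Hnm IH]. lra.
    pose proof (HF (m, I m) (GI m)) as [P1 [P2 [P3 _]]]. simpl in *. fold (I m) in *. lra. }
  assert (cross : forall n m, fst (I n) <= snd (I m)).
  { intros n m. destruct (Nat.le_ge_cases n m) as [Hnm|Hnm].
    - pose proof (mono _ _ Hnm). pose proof (GI m). unfold good in *. lra.
    - pose proof (mono _ _ Hnm). pose proof (GI n). unfold good in *. lra. }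
  destruct (completeness (fun x => exists n, x = fst (I n))) as [s [ub lub]].
  { exists b. intros x [n ->]. pose proof (GI n). unfold good in *. lra. }
  { exists (fst (I 0%nat)). now exists 0%nat. }
  assert (Hs : forall n, fst (I n) <= s <= snd (I n)).
  { intros n. split. apply ub. now exists n. apply lub. intros x [m ->]. apply cross. }
  destruct (Hex s) as [k Hk]. { pose proof (Hs 0%nat). simpl in *. lra. }
  pose proof (HF (Z.abs_nat k, I (Z.abs_nat k)) (GI _)) as [_ [_ [_ Q]]].
  (* The labels [k] and [- k] are removed in passing from stage [|k|] to the next one, hence the
     successor. *)
  destruct (Q s (Hs (S (Z.abs_nat k)))) as [Q1 Q2]. simpl in Q1, Q2.
  destruct (Z.le_ge_cases 0 k) as [Hk0|Hk0].
  - apply Q1. now replace (Z.of_nat (Z.abs_nat k)) with k by lia.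
  - apply Q2. now replace (- Z.of_nat (Z.abs_nat k))%Z with k by lia.
Qed.

(** Continuous induction: the supremum of the times up to which [Q] holds cannot precede a failure.
    At [t = 0] the inner premise is vacuous, so the base case is contained in the step. *)
Lemma real_induction (Q : R -> Prop) (T : R) :
  (forall t, 0 <= t <= T -> (forall s, 0 <= s < t -> Q s) ->
     Q t /\ exists e, 0 < e /\ forall s, t < s < t + e -> s <= T -> Q s) ->
  forall t, 0 <= t <= T -> Q t.
Proof.
  intros H.
  set (E := fun t => 0 <= t <= T /\ forall s, 0 <= s <= t -> Q s).
  intros t Ht. apply NNPP. intros NQ.
  assert (E0 : E 0).
  { split. lra. intros s Hs. replace s with 0 by lra.
    apply H. lra. intros; lra. }
  destruct (completeness E) as [m [ub lub]].
  { exists t. intros s [Hs Qs]. apply Rnot_lt_le. intros L. apply NQ. apply Qs. lra. }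
  { now exists 0. }
  assert (Hm : 0 <= m <= t).
  { split. now apply ub. apply lub. intros s [Hs Qs]. apply Rnot_lt_le. intros L.
    apply NQ. apply Qs. lra. }
  assert (below : forall s, 0 <= s < m -> Q s).
  { intros s Hs. apply NNPP. intros N. assert (m <= s); [|lra]. apply lub.
    intros x [Hx Qx]. apply Rnot_lt_le. intros L. apply N. apply Qx. lra. }
  destruct (H m) as [Qm [e [He Qe]]]; auto. lra.
  assert (upto : forall s, 0 <= s <= m -> Q s).
  { intros s Hs. destruct (Req_dec s m) as [->|]; auto. apply below; lra. }
  destruct (Req_dec m t) as [->|Hne]. { apply NQ. apply upto. lra. }
  assert (Em : E (Rmin t (m + e / 2))).
  { assert (m < Rmin t (m + e / 2) <= t /\ Rmin t (m + e / 2) < m + e).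
    { unfold Rmin; destruct Rle_dec; lra. }
    split. lra. intros s Hs. destruct (Rle_dec s m). apply upto; lra. apply Qe; lra. }
  apply ub in Em. revert Em. unfold Rmin; destruct Rle_dec; lra.
Qed.

(** The one-variable extremum theorem is used twice: for each [x] in [y], then for the partial
    maximum, which is continuous in [x] by uniform continuity of [f]. *)
Lemma box_max (f : F2) (r : R) :
  0 <= r ->
  (forall x y, -r <= x <= r -> -r <= y <= r -> continuity_2d_pt f x y) ->
  exists x0 y0, -r <= x0 <= r /\ -r <= y0 <= r /\
    forall x y, -r <= x <= r -> -r <= y <= r -> f x y <= f x0 y0.
Proof.
  intros Hr Hc.
  assert (Hy : forall x, -r <= x <= r -> exists y0, -r <= y0 <= r /\
    forall y, -r <= y <= r -> f x y <= f x y0).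
  { intros x Hx. destruct (continuity_ab_maj (fun y => f x y) (-r) r) as [m [H1 H2]].
    lra. intros c Hcc. apply continuity_pt_locally. intros eps.
    destruct (Hc x c Hx Hcc eps) as [d Hd]. exists d. intros y Hy. apply Hd; auto.
    replace (x - x) with 0 by ring. rewrite Rabs_R0. apply d.
    exists m; auto. }
  assert (Hsel : forall x, exists y0, -r <= x <= r -> -r <= y0 <= r /\
    forall y, -r <= y <= r -> f x y <= f x y0).
  { intros x. destruct (classic (-r <= x <= r)) as [Hx|Hx].
    destruct (Hy x Hx) as [y0 H]. now exists y0. exists 0. tauto. }
  destruct (choice _ Hsel) as [Y HY].
  (* Clamping makes [x |-> max_y f x y] continuous at the ends of the interval. *)
  set (cl := fun x => Rmax (-r) (Rmin r x)).
  assert (Hcl : forall x, -r <= cl x <= r).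
  { intros x. unfold cl, Rmax, Rmin. repeat destruct Rle_dec; lra. }
  assert (Hcl1 : forall x, -r <= x <= r -> cl x = x).
  { intros x Hx. unfold cl, Rmax, Rmin. repeat destruct Rle_dec; lra. }
  assert (Hcl2 : forall x y, Rabs (cl x - cl y) <= Rabs (x - y)).
  { intros x y. unfold cl, Rmax, Rmin, Rabs. repeat destruct Rle_dec; repeat destruct Rcase_abs; lra. }
  destruct (continuity_ab_maj (fun x => f (cl x) (Y (cl x))) (-r) r) as [m [H1 H2]].
  - lra.
  - intros c Hcc. apply continuity_pt_locally. intros eps.
    destruct (uniform_continuity_2d f (-r) r (-r) r Hc eps) as [d Hd].
    exists d. intros x Hx.
    assert (Hx' : Rabs (cl x - cl c) < d) by (eapply Rle_lt_trans; [apply Hcl2 | exact Hx]).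
    pose proof (HY _ (Hcl x)) as [Yx Mx]. pose proof (HY _ (Hcl c)) as [Yc Mc].
    assert (Z : forall y, Rabs (y - y) < d).
    { intros y. replace (y - y) with 0 by ring. rewrite Rabs_R0. apply d. }
    (* Each partial maximum is at least the value at the maximizer of the other, and there the two
       values of [f] are close; this bounds the difference of the maxima from both sides. *)
    pose proof (Hd (cl c) (Y (cl c)) (cl x) (Y (cl c)) (Hcl c) Yc (Hcl x) Yc Hx' (Z _)) as A1.
    pose proof (Hd (cl c) (Y (cl x)) (cl x) (Y (cl x)) (Hcl c) Yx (Hcl x) Yx Hx' (Z _)) as A2.
    pose proof (Mx _ Yc). pose proof (Mc _ Yx).
    apply Rabs_def2 in A1. apply Rabs_def2 in A2. apply Rabs_def1; lra.
  - exists m, (Y m). pose proof (HY m H2) as [A1 A2]. repeat split; try tauto.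
    intros x y Hx Hyy. pose proof (H1 x Hx) as B. simpl in B. rewrite !Hcl1 in B by auto.
    pose proof (HY x Hx) as [_ B2]. specialize (B2 y Hyy). lra.
Qed.

(** At an interior maximum [l = 0]; at an endpoint [l] points outward or vanishes, while [B] points
    inward or vanishes. *)
Lemma max_derive_sign (g : R -> R) (r x0 l B : R) :
  0 < r -> -r <= x0 <= r -> is_derive g x0 l ->
  (forall x, -r <= x <= r -> g x <= g x0) ->
  (x0 = r -> B <= 0) -> (x0 = -r -> 0 <= B) -> l * B <= 0.
Proof.
  intros Hr Hx Hd Hm HB1 HB2.
  assert (up : x0 < r -> l <= 0).
  { intros Hlt. apply Rnot_lt_le. intros Hl.
    apply is_derive_Reals in Hd. destruct (Hd (l / 2)) as [d Hdd]. lra.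
    set (h := Rmin (d / 2) (r - x0)).
    assert (0 < h /\ h < d /\ h <= r - x0).
    { pose proof (cond_pos d). unfold h, Rmin. destruct Rle_dec; lra. }
    specialize (Hdd h). lapply Hdd; [|lra]. clear Hdd. intros Hdd. lapply Hdd; clear Hdd.
    2:{ rewrite Rabs_pos_eq; lra. }
    intros Hdd. apply Rabs_def2 in Hdd. pose proof (Hm (x0 + h)).
    assert ((g (x0 + h) - g x0) / h <= 0).
    { apply Rmult_le_reg_r with h. lra. unfold Rdiv. rewrite Rmult_assoc, Rinv_l; lra. }
    lra. }
  assert (down : - r < x0 -> 0 <= l).
  { intros Hlt. apply Rnot_lt_le. intros Hl.
    apply is_derive_Reals in Hd. destruct (Hd (- l / 2)) as [d Hdd]. lra.
    set (h := Rmin (d / 2) (x0 + r)).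
    assert (0 < h /\ h < d /\ h <= x0 + r).
    { pose proof (cond_pos d). unfold h, Rmin. destruct Rle_dec; lra. }
    specialize (Hdd (- h)). lapply Hdd; [|lra]. clear Hdd. intros Hdd. lapply Hdd; clear Hdd.
    2:{ rewrite Rabs_Ropp, Rabs_pos_eq; lra. }
    intros Hdd. apply Rabs_def2 in Hdd. pose proof (Hm (x0 + - h)).
    assert (0 <= (g (x0 + - h) - g x0) / - h).
    { replace ((g (x0 + - h) - g x0) / - h) with ((g x0 - g (x0 + - h)) / h) by (field; lra).
      apply Rmult_le_pos. lra. left. apply Rinv_0_lt_compat. lra. }
    lra. }
  destruct (Rle_lt_dec r x0) as [E|E].
  - assert (0 <= l) by (apply down; lra). assert (B <= 0) by (apply HB1; lra). nra.
  - destruct (Rle_lt_dec x0 (-r)) as [E'|E'].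
    + assert (l <= 0) by (apply up; lra). assert (0 <= B) by (apply HB2; lra). nra.
    + assert (l <= 0) by (apply up; lra). assert (0 <= l) by (apply down; lra). assert (l = 0) as -> by lra. lra.
Qed.

(* At a maximum of [U - eps (x^2 + y^2)] on the box, each product of a component of the
   gradient with the inward field [B] is nonpositive, whereas [B . grad U = 0] makes their
   sum positive away from the origin. *)
Lemma inward_field_max_principle (U : F2) (r l1 l2 k : R) :
  0 < r -> 2 * k < l1 -> 2 * k < l2 -> 0 <= k ->
  U 0 0 = 0 ->
  (forall x y, -r <= x <= r -> -r <= y <= r ->
     continuity_2d_pt U x y /\ exists U1 U2 B1 B2,
     is_derive (fun t => U t y) x U1 /\ is_derive (fun t => U x t) y U2 /\
     B1 * U1 + B2 * U2 = 0 /\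
     Rabs (B1 + l1 * x) <= k * (Rabs x + Rabs y) /\
     Rabs (B2 + l2 * y) <= k * (Rabs x + Rabs y)) ->
  forall x y, -r <= x <= r -> -r <= y <= r -> U x y <= 0.
Proof.
  intros Hr K1 K2 Hk U0 H x y Hx Hy.
  assert (main : forall eps, 0 < eps -> U x y <= eps * (x * x + y * y)).
  { intros eps He.
    destruct (box_max (fun x y => U x y - eps * (x * x + y * y)) r) as [a [b [Ha [Hb M]]]].
    - lra.
    - intros u v Hu Hv.
      apply (continuity_2d_pt_minus U (fun x y => eps * (x * x + y * y))). now apply H.
      apply (continuity_2d_pt_mult (fun _ _ => eps) (fun x y => x * x + y * y)).
      apply continuity_2d_pt_const.
      apply (continuity_2d_pt_plus (fun x y => x * x) (fun x y => y * y)).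
      apply (continuity_2d_pt_mult (fun x y => x) (fun x y => x)); apply continuity_2d_pt_id1.
      apply (continuity_2d_pt_mult (fun x y => y) (fun x y => y)); apply continuity_2d_pt_id2.
    - simpl in M.
      destruct (H a b Ha Hb) as [_ [U1 [U2 [B1 [B2 [D1 [D2 [E [S1 S2]]]]]]]]].
      assert (G1 : is_derive (fun t => U t b - eps * (t * t + b * b)) a (U1 - 2 * eps * a)).
      { apply (is_derive_minus (fun t => U t b) (fun t => eps * (t * t + b * b)) a U1 (2 * eps * a)). exact D1. auto_derive. auto. ring. }
      assert (G2 : is_derive (fun t => U a t - eps * (a * a + t * t)) b (U2 - 2 * eps * b)).
      { apply (is_derive_minus (fun t => U a t) (fun t => eps * (a * a + t * t)) b U2 (2 * eps * b)). exact D2. auto_derive. auto. ring. }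
      apply Rabs_le_between in S1. apply Rabs_le_between in S2.
      assert (Ma : Rabs a <= r) by (apply Rabs_le; lra).
      assert (Mb : Rabs b <= r) by (apply Rabs_le; lra).
      pose proof (Rabs_pos a) as Pa. pose proof (Rabs_pos b) as Pb.
      assert (Sa : Rabs a * Rabs a = a * a) by (rewrite <- Rabs_mult; apply Rabs_pos_eq; nra).
      assert (Sb : Rabs b * Rabs b = b * b) by (rewrite <- Rabs_mult; apply Rabs_pos_eq; nra).
      assert (W : k * (Rabs a + Rabs b) <= k * (2 * r)) by (apply Rmult_le_compat_l; lra).
      (* On the face [a = r] the error in [B1] is at most [2 k r < l1 r], so [B1] points into the
         box; the other faces are alike. *)
      assert (W1 : (U1 - 2 * eps * a) * B1 <= 0).
      { apply (max_derive_sign (fun t => U t b - eps * (t * t + b * b)) r a); auto.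
        - intros ->. nra.
        - intros ->. nra. }
      assert (W2 : (U2 - 2 * eps * b) * B2 <= 0).
      { apply (max_derive_sign (fun t => U a t - eps * (a * a + t * t)) r b); auto.
        - intros ->. nra.
        - intros ->. nra. }
      (* In the sum of [W1] and [W2] the gradient of [U] cancels by [E], and only the penalty term
         is left. *)
      assert (W3 : 0 <= a * B1 + b * B2).
      { assert (0 <= eps * (a * B1 + b * B2)) by nra.
        apply Rmult_le_reg_l with eps; lra. }
      assert (X1 : a * (B1 + l1 * a) <= Rabs a * (k * (Rabs a + Rabs b))).
      { eapply Rle_trans. apply Rle_abs. rewrite Rabs_mult.
        apply Rmult_le_compat_l; auto. apply Rabs_le; lra. }
      assert (X2 : b * (B2 + l2 * b) <= Rabs b * (k * (Rabs a + Rabs b))).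
      { eapply Rle_trans. apply Rle_abs. rewrite Rabs_mult.
        apply Rmult_le_compat_l; auto. apply Rabs_le; lra. }
      (* The errors contribute at most [k (|a| + |b|)^2 <= 2 k (a^2 + b^2)]. *)
      assert (X3 : (l1 - 2 * k) * (a * a) + (l2 - 2 * k) * (b * b) <= 0).
      { assert (0 <= k * ((Rabs a - Rabs b) * (Rabs a - Rabs b))).
        { apply Rmult_le_pos; auto. apply Rle_0_sqr. }
        assert (k * (Rabs a * Rabs a) = k * (a * a)) by now rewrite Sa.
        assert (k * (Rabs b * Rabs b) = k * (b * b)) by now rewrite Sb.
        lra. }
      assert (a = 0 /\ b = 0) as [-> ->].
      { assert (0 <= (l1 - 2 * k) * (a * a)) by (apply Rmult_le_pos; nra).
        assert (0 <= (l2 - 2 * k) * (b * b)) by (apply Rmult_le_pos; nra).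
        assert (zero : forall l c, 0 < l -> l * (c * c) <= 0 -> c = 0).
        { intros l c Hl Hc. apply Rsqr_0_uniq. apply Rle_antisym; [|apply Rle_0_sqr].
          unfold Rsqr. apply Rmult_le_reg_l with l; lra. }
        split; [apply (zero (l1 - 2 * k)) | apply (zero (l2 - 2 * k))]; lra. }
      specialize (M x y Hx Hy). rewrite U0 in M. lra. }
  apply Rnot_lt_le. intros Hpos.
  (* With this [eps] the bound [main] becomes [U x y <= U x y / 2]; the summand [1] keeps the
     denominator positive at the origin. *)
  specialize (main (U x y / (2 * (1 + x * x + y * y)))).
  assert (P : 0 < 1 + x * x + y * y) by nra.
  lapply main; clear main. 2:{ apply Rdiv_lt_0_compat; lra. }
  intros main.
  assert (U x y / (2 * (1 + x * x + y * y)) * (x * x + y * y) <= U x y / 2).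
  { replace (U x y / 2) with (U x y / (2 * (1 + x * x + y * y)) * (1 + x * x + y * y)) by (field; lra).
    apply Rmult_le_compat_l; [|lra]. left. apply Rdiv_lt_0_compat; lra. }
  lra.
Qed.

(** * Trajectories *)

Lemma nondecreasing_of_derive (f f' : R -> R) (T : R) :
  (forall t, T <= t -> is_derive f t (f' t) /\ 0 <= f' t) ->
  forall s t, T <= s <= t -> f s <= f t.
Proof.
  intros H s t Hst. destruct (Req_dec s t) as [->|Hne]; [lra|].
  destruct (MVT_cor2 f f' s t) as [c [E Hc]]. lra.
  intros c Hc. apply is_derive_Reals. apply H. lra.
  assert (0 <= f' c) by (apply H; lra). nra.
Qed.

Lemma is_lim_0_p_infty (f : R -> R) :
  is_lim f p_infty 0 <-> forall eps, 0 < eps -> exists M, forall t, M < t -> Rabs (f t) < eps.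
Proof.
  split.
  - intros H eps He. apply is_lim_spec in H. destruct (H (mkposreal eps He)) as [M HM].
    exists M. intros t Ht. specialize (HM t Ht). simpl in HM. now rewrite Rminus_0_r in HM.
  - intros H. apply is_lim_spec. intros eps. destruct (H eps (cond_pos eps)) as [M HM].
    exists M. intros t Ht. rewrite Rminus_0_r. auto.
Qed.

Lemma sq_abs (x : R) : Rabs x * Rabs x = x * x.
Proof. rewrite <- Rabs_mult. apply Rabs_pos_eq. apply Rle_0_sqr. Qed.

Lemma abs_le_of_sq_le (x y : R) : x * x <= y * y -> Rabs x <= Rabs y.
Proof. intros H. apply Rsqr_le_abs_0. exact H. Qed.

(* [X^2 - Y^2] is nondecreasing and tends to [0], so [X^2 <= Y^2] throughout. *)
Lemma saddle_decay (X Y X' Y' : R -> R) (T l m k : R) :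
  0 <= k -> 2 * k <= l -> 2 * k <= m ->
  (forall t, T <= t -> is_derive X t (X' t) /\ is_derive Y t (Y' t) /\
     Rabs (X' t - l * X t) <= k * (Rabs (X t) + Rabs (Y t)) /\
     Rabs (Y' t + m * Y t) <= k * (Rabs (X t) + Rabs (Y t))) ->
  is_lim X p_infty 0 -> is_lim Y p_infty 0 ->
  (forall t, T <= t -> Rabs (X t) <= Rabs (Y t)) /\
  (forall s t, T <= s <= t -> Rabs (Y t) <= Rabs (Y s)).
Proof.
  intros Hk Hl Hm H LX LY.
  assert (bnd : forall t, T <= t ->
     Rabs (X t * (X' t - l * X t)) <= Rabs (X t) * (k * (Rabs (X t) + Rabs (Y t))) /\
     Rabs (Y t * (Y' t + m * Y t)) <= Rabs (Y t) * (k * (Rabs (X t) + Rabs (Y t)))).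
  { intros t Ht. destruct (H t Ht) as [_ [_ [E1 E2]]]. rewrite !Rabs_mult.
    split; apply Rmult_le_compat_l; auto; apply Rabs_pos. }
  assert (D : forall s t, T <= s <= t -> X s * X s - Y s * Y s <= X t * X t - Y t * Y t).
  { apply (nondecreasing_of_derive (fun t => X t * X t - Y t * Y t)
      (fun t => 2 * (X t * X' t) - 2 * (Y t * Y' t))).
    intros t Ht. destruct (H t Ht) as [D1 [D2 _]]. destruct (bnd t Ht) as [E1 E2].
    split.
    - evar_last. apply (is_derive_minus (fun t => X t * X t) (fun t => Y t * Y t)).
      apply (is_derive_mult X X t _ _ D1 D1); intros; apply Rmult_comm.
      apply (is_derive_mult Y Y t _ _ D2 D2); intros; apply Rmult_comm.
      unfold minus, plus, opp, mult; simpl. ring.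
    - apply Rabs_le_between in E1. apply Rabs_le_between in E2.
      pose proof (sq_abs (X t)) as SX. pose proof (sq_abs (Y t)) as SY.
      assert (0 <= k * ((Rabs (X t) - Rabs (Y t)) * (Rabs (X t) - Rabs (Y t)))).
      { apply Rmult_le_pos; auto. apply Rle_0_sqr. }
      assert (k * (Rabs (X t) * Rabs (X t)) = k * (X t * X t)) by now rewrite SX.
      assert (k * (Rabs (Y t) * Rabs (Y t)) = k * (Y t * Y t)) by now rewrite SY.
      assert (0 <= (l - 2 * k) * (X t * X t)) by (apply Rmult_le_pos; [lra | apply Rle_0_sqr]).
      assert (0 <= (m - 2 * k) * (Y t * Y t)) by (apply Rmult_le_pos; [lra | apply Rle_0_sqr]).
      lra. }
  assert (cone : forall t, T <= t -> Rabs (X t) <= Rabs (Y t)).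
  { intros t Ht. apply abs_le_of_sq_le. apply Rnot_lt_le. intros N.
    (* Capping [e] at [1] makes [|X| < e] imply [X^2 < e]. *)
    set (e := Rmin 1 (X t * X t - Y t * Y t)).
    assert (He : 0 < e /\ e <= 1 /\ e <= X t * X t - Y t * Y t).
    { unfold e, Rmin. destruct Rle_dec; lra. }
    destruct (proj1 (is_lim_0_p_infty X) LX e) as [M HM]. lra.
    set (s := Rmax t (M + 1)).
    assert (t <= s /\ M < s) by (unfold s, Rmax; destruct Rle_dec; lra).
    specialize (HM s). lapply HM; [|lra]. intros HX.
    assert (X s * X s < e).
    { rewrite <- sq_abs. pose proof (Rabs_pos (X s)). nra. }
    pose proof (D t s). pose proof (Rle_0_sqr (Y s)). unfold Rsqr in *. lra. }
  split; auto.
  intros s t Hst. apply abs_le_of_sq_le.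
  (* Inside the cone [|X| <= |Y|] the error in [Y'] is at most [2 k |Y|], which the contraction rate
     [m] absorbs, so [Y^2] does not increase. *)
  enough (- (Y s * Y s) <= - (Y t * Y t)) by lra.
  revert s t Hst.
  apply (nondecreasing_of_derive (fun t => - (Y t * Y t)) (fun t => - (2 * (Y t * Y' t)))).
  intros t Ht. destruct (H t Ht) as [_ [D2 _]]. destruct (bnd t Ht) as [_ E2].
  pose proof (cone t Ht) as Ct. split.
  - evar_last. apply (is_derive_opp (fun t => Y t * Y t)).
    apply (is_derive_mult Y Y t _ _ D2 D2); intros; apply Rmult_comm.
    unfold minus, plus, opp, mult; simpl. ring.
  - apply Rabs_le_between in E2. pose proof (sq_abs (Y t)) as SY.
    assert (Rabs (Y t) * (k * (Rabs (X t) + Rabs (Y t))) <= 2 * k * (Y t * Y t)).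
    { rewrite <- SY. pose proof (Rabs_pos (Y t)).
      replace (2 * k * (Rabs (Y t) * Rabs (Y t))) with (Rabs (Y t) * (k * (2 * Rabs (Y t)))) by ring.
      apply Rmult_le_compat_l; auto. apply Rmult_le_compat_l; lra. }
    assert (0 <= (m - 2 * k) * (Y t * Y t)) by (apply Rmult_le_pos; [lra | apply Rle_0_sqr]).
    lra.
Qed.

(** Every index from 3 on means the last coordinate, the convention of [pd4]. *)
Definition coord (i : nat) (P : R4) : R :=
  match i with O => c0 P | 1%nat => c1 P | 2%nat => c2 P | _ => c3 P end.

Lemma coord_ind (Q : (R4 -> R) -> Prop) :
  Q c0 -> Q c1 -> Q c2 -> Q c3 -> forall i, Q (coord i).
Proof. intros; destruct i as [|[|[|i]]]; assumption. Qed.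

Lemma coord_ext (P Q : R4) : (forall i, coord i P = coord i Q) -> P = Q.
Proof.
  intros H. pose proof (H 0%nat). pose proof (H 1%nat). pose proof (H 2%nat). pose proof (H 3%nat).
  destruct P, Q; simpl in *; subst; reflexivity.
Qed.

Lemma in_ball4_coord (r : R) (P : R4) : in_ball4 r P <-> forall i, Rabs (coord i P) < r.
Proof.
  split.
  - intros [H0 [H1 [H2 H3]]]. now apply (coord_ind (fun c => Rabs (c P) < r)).
  - intros H. exact (conj (H 0%nat) (conj (H 1%nat) (conj (H 2%nat) (H 3%nat)))).
Qed.

Definition dist1 (P Q : R4) : R :=
  Rabs (c0 P - c0 Q) + Rabs (c1 P - c1 Q) + Rabs (c2 P - c2 Q) + Rabs (c3 P - c3 Q).

(** With [sg = -1] this is the flow run backwards, so that both invariant submanifolds are described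
    by limits at plus infinity. *)
Definition traj (sg : R) (H : F4) (phi : R -> R4) : Prop :=
  forall t, 0 <= t -> forall i,
    is_derive (fun u => coord i (phi u)) t (sg * coord i (xiH H (phi t))).

Lemma traj_shift (sg : R) (H : F4) (phi : R -> R4) (d : R) :
  traj sg H phi -> 0 <= d -> traj sg H (fun t => phi (t + d)).
Proof.
  intros Hp Hd t Ht i.
  evar_last. apply (is_derive_comp (fun u => coord i (phi u)) (fun t => t + d)).
  apply Hp. lra. apply (is_derive_plus (fun t => t) (fun _ => d)).
  apply is_derive_id. apply is_derive_const.
  unfold scal, plus, zero, one; simpl. unfold mult; simpl. ring.
Qed.

Lemma traj_continuous (sg : R) (H : F4) (phi : R -> R4) (t eps : R) :
  traj sg H phi -> 0 <= t -> 0 < eps ->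
  exists e, 0 < e /\ forall s, Rabs (s - t) < e ->
    forall i, Rabs (coord i (phi s) - coord i (phi t)) < eps.
Proof.
  intros Hp Ht He.
  assert (Hi : forall i, exists e, 0 < e /\ forall s, Rabs (s - t) < e ->
    Rabs (coord i (phi s) - coord i (phi t)) < eps).
  { intros i. assert (C : continuity_pt (fun u => coord i (phi u)) t).
    { apply continuity_pt_filterlim. apply (ex_derive_continuous (fun u => coord i (phi u)) t).
      eexists. now apply Hp. }
    apply continuity_pt_locally with (eps := mkposreal eps He) in C.
    destruct C as [d Hd]. exists d. split. apply cond_pos. intros s Hs. now apply Hd. }
  destruct (Hi 0%nat) as [d0 [D0 C0]]. destruct (Hi 1%nat) as [d1 [D1 C1]].
  destruct (Hi 2%nat) as [d2 [D2 C2]]. destruct (Hi 3%nat) as [d3 [D3 C3]].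
  set (d := Rmin (Rmin d0 d1) (Rmin d2 d3)).
  assert (Hd : 0 < d /\ d <= d0 /\ d <= d1 /\ d <= d2 /\ d <= d3).
  { unfold d, Rmin. repeat destruct Rle_dec; lra. }
  exists d. split. lra. intros s Hs.
  apply (coord_ind (fun c => Rabs (c (phi s) - c (phi t)) < eps)).
  apply C0; lra. apply C1; lra. apply C2; lra. apply C3; lra.
Qed.

Lemma smooth_strict_diff (H : F4) (i : nat) (x0 y0 p0 q0 : R) :
  smooth4 H ->
  forall eps, 0 < eps -> exists d, 0 < d /\ forall x y p q x' y' p' q',
    Rabs (x - x0) < d -> Rabs (y - y0) < d -> Rabs (p - p0) < d -> Rabs (q - q0) < d ->
    Rabs (x' - x0) < d -> Rabs (y' - y0) < d -> Rabs (p' - p0) < d -> Rabs (q' - q0) < d ->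
    let f := pd4 i H in
    Rabs (f x' y' p' q' - f x y p q
          - (pd4 0 f x0 y0 p0 q0 * (x' - x) + pd4 1 f x0 y0 p0 q0 * (y' - y)
             + pd4 2 f x0 y0 p0 q0 * (p' - p) + pd4 3 f x0 y0 p0 q0 * (q' - q)))
    <= eps * (Rabs (x' - x) + Rabs (y' - y) + Rabs (p' - p) + Rabs (q' - q)).
Proof.
  intros Hs. apply (strict_diff4 (pd4 i H) x0 y0 p0 q0 1).
  - lra.
  - intros j x y p q _ _ _ _. apply (Hs (i :: nil)).
  - intros j. apply (Hs (j :: i :: nil)).
Qed.

Lemma pd_lipschitz (H : F4) (i : nat) (P : R4) :
  smooth4 H ->
  exists K r, 0 <= K /\ 0 < r /\ forall Q Q',
    (forall j, Rabs (coord j Q - coord j P) < r) ->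
    (forall j, Rabs (coord j Q' - coord j P) < r) ->
    Rabs (app4 (pd4 i H) Q - app4 (pd4 i H) Q') <= K * dist1 Q Q'.
Proof.
  intros Hs.
  destruct (smooth_strict_diff H i (c0 P) (c1 P) (c2 P) (c3 P) Hs 1 Rlt_0_1) as [r [Hr L]].
  cbv zeta in L.
  set (f := pd4 i H) in *.
  set (g0 := pd4 0 f (c0 P) (c1 P) (c2 P) (c3 P)) in *.
  set (g1 := pd4 1 f (c0 P) (c1 P) (c2 P) (c3 P)) in *.
  set (g2 := pd4 2 f (c0 P) (c1 P) (c2 P) (c3 P)) in *.
  set (g3 := pd4 3 f (c0 P) (c1 P) (c2 P) (c3 P)) in *.
  exists (Rabs g0 + Rabs g1 + Rabs g2 + Rabs g3 + 1), r.
  pose proof (Rabs_pos g0). pose proof (Rabs_pos g1).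
  pose proof (Rabs_pos g2). pose proof (Rabs_pos g3).
  split; [lra|]. split; auto.
  intros Q Q' HQ HQ'.
  specialize (L _ _ _ _ _ _ _ _ (HQ' 0%nat) (HQ' 1%nat) (HQ' 2%nat) (HQ' 3%nat)
    (HQ 0%nat) (HQ 1%nat) (HQ 2%nat) (HQ 3%nat)).
  simpl in L. unfold app4, dist1 in *.
  set (u0 := c0 Q - c0 Q') in *. set (u1 := c1 Q - c1 Q') in *.
  set (u2 := c2 Q - c2 Q') in *. set (u3 := c3 Q - c3 Q') in *.
  pose proof (Rabs_sum4 g0 g1 g2 g3 u0 u1 u2 u3) as B.
  pose proof (Rabs_pos u0). pose proof (Rabs_pos u1).
  pose proof (Rabs_pos u2). pose proof (Rabs_pos u3).
  apply Rabs_le_between in L. apply Rabs_le_between in B. apply Rabs_le_between.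
  assert (cross : forall a b c d, 0 <= a -> 0 <= b -> 0 <= c -> 0 <= d -> 0 <= a * (b + c + d)).
  { intros. apply Rmult_le_pos; lra. }
  pose proof (cross (Rabs g0) (Rabs u1) (Rabs u2) (Rabs u3)).
  pose proof (cross (Rabs g1) (Rabs u0) (Rabs u2) (Rabs u3)).
  pose proof (cross (Rabs g2) (Rabs u0) (Rabs u1) (Rabs u3)).
  pose proof (cross (Rabs g3) (Rabs u0) (Rabs u1) (Rabs u2)).
  lra.
Qed.

Lemma xiH_lipschitz (H : F4) (P : R4) :
  smooth4 H ->
  exists K r, 0 <= K /\ 0 < r /\ forall Q Q',
    (forall j, Rabs (coord j Q - coord j P) < r) ->
    (forall j, Rabs (coord j Q' - coord j P) < r) ->
    forall i, Rabs (coord i (xiH H Q) - coord i (xiH H Q')) <= K * dist1 Q Q'.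
Proof.
  intros Hs.
  destruct (pd_lipschitz H 0 P Hs) as [K0 [r0 [A0 [B0 L0]]]].
  destruct (pd_lipschitz H 1 P Hs) as [K1 [r1 [A1 [B1 L1]]]].
  destruct (pd_lipschitz H 2 P Hs) as [K2 [r2 [A2 [B2 L2]]]].
  destruct (pd_lipschitz H 3 P Hs) as [K3 [r3 [A3 [B3 L3]]]].
  set (r := Rmin (Rmin r0 r1) (Rmin r2 r3)).
  assert (Hr : 0 < r /\ r <= r0 /\ r <= r1 /\ r <= r2 /\ r <= r3).
  { unfold r, Rmin. repeat destruct Rle_dec; lra. }
  exists (K0 + K1 + K2 + K3), r. split. lra. split. lra.
  intros Q Q' HQ HQ'.
  assert (near : forall s, r <= s -> (forall j, Rabs (coord j Q - coord j P) < s) /\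
    (forall j, Rabs (coord j Q' - coord j P) < s)).
  { intros s Hrs; split; intros j. specialize (HQ j); lra. specialize (HQ' j); lra. }
  assert (D : 0 <= dist1 Q Q').
  { unfold dist1. pose proof (Rabs_pos (c0 Q - c0 Q')). pose proof (Rabs_pos (c1 Q - c1 Q')).
    pose proof (Rabs_pos (c2 Q - c2 Q')). pose proof (Rabs_pos (c3 Q - c3 Q')). lra. }
  assert (up : forall K a b, K <= K0 + K1 + K2 + K3 -> Rabs (a - b) <= K * dist1 Q Q' ->
    Rabs (a - b) <= (K0 + K1 + K2 + K3) * dist1 Q Q').
  { intros. eapply Rle_trans. eassumption. apply Rmult_le_compat_r; auto. }
  assert (opp : forall a b, Rabs (- a - - b) = Rabs (a - b)).
  { intros. rewrite <- Rabs_Ropp. f_equal. ring. }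
  apply (coord_ind (fun c => Rabs (c (xiH H Q) - c (xiH H Q')) <= (K0 + K1 + K2 + K3) * dist1 Q Q'));
    simpl; rewrite ?opp.
  - apply (up K2). lra. apply L2; apply near; lra.
  - apply (up K3). lra. apply L3; apply near; lra.
  - apply (up K0). lra. apply L0; apply near; lra.
  - apply (up K1). lra. apply L1; apply near; lra.
Qed.

Lemma xiH_bounded (H : F4) :
  smooth4 H ->
  exists M r, 0 < M /\ 0 < r /\ forall P, in_ball4 r P -> forall i, Rabs (coord i (xiH H P)) <= M.
Proof.
  intros Hs. destruct (xiH_lipschitz H zero4 Hs) as [K [r [HK [Hr L]]]].
  set (S := Rabs (c0 (xiH H zero4)) + Rabs (c1 (xiH H zero4))
            + Rabs (c2 (xiH H zero4)) + Rabs (c3 (xiH H zero4))).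
  assert (HS : forall i, Rabs (coord i (xiH H zero4)) <= S).
  { pose proof (Rabs_pos (c0 (xiH H zero4))). pose proof (Rabs_pos (c1 (xiH H zero4))).
    pose proof (Rabs_pos (c2 (xiH H zero4))). pose proof (Rabs_pos (c3 (xiH H zero4))).
    apply (coord_ind (fun c => Rabs (c (xiH H zero4)) <= S)); unfold S; lra. }
  pose proof (HS 0%nat). pose proof (Rabs_pos (coord 0 (xiH H zero4))).
  exists (S + K * (4 * r) + 1), r. split.
  { assert (0 <= K * (4 * r)) by (apply Rmult_le_pos; lra). lra. }
  split; auto. intros P HP i.
  rewrite in_ball4_coord in HP.
  assert (zc : forall j, coord j zero4 = 0) by (intros [|[|[|j]]]; reflexivity).
  assert (L' := L P zero4). lapply L'; clear L'.
  2:{ intros j. rewrite zc, Rminus_0_r. auto. }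
  intros L'. lapply L'; clear L'.
  2:{ intros j. rewrite Rminus_diag, Rabs_R0. auto. }
  intros L'. specialize (L' i).
  assert (dist1 P zero4 <= 4 * r).
  { unfold dist1; simpl. rewrite !Rminus_0_r.
    pose proof (HP 0%nat). pose proof (HP 1%nat). pose proof (HP 2%nat). pose proof (HP 3%nat).
    simpl in *. lra. }
  assert (K * dist1 P zero4 <= K * (4 * r)) by (apply Rmult_le_compat_l; auto).
  specialize (HS i).
  pose proof (Rabs_triang (coord i (xiH H P) - coord i (xiH H zero4)) (coord i (xiH H zero4))) as Tr.
  replace (coord i (xiH H P) - coord i (xiH H zero4) + coord i (xiH H zero4))
    with (coord i (xiH H P)) in Tr by ring.
  lra.
Qed.

(** The speed bound [M] is known only inside the ball in which it is to keep the trajectory;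
    continuous induction breaks the circle. The strict inequality [M * T < r / 2] leaves the margin
    for continuing past each time. *)
Lemma traj_stays (sg : R) (H : F4) (phi : R -> R4) (M r T : R) :
  (sg = 1 \/ sg = -1) ->
  traj sg H phi -> 0 < r -> 0 < M ->
  (forall P, in_ball4 r P -> forall i, Rabs (coord i (xiH H P)) <= M) ->
  in_ball4 (r / 2) (phi 0) -> M * T < r / 2 ->
  forall t, 0 <= t <= T ->
    in_ball4 r (phi t) /\ forall i, Rabs (coord i (phi t) - coord i (phi 0)) <= M * t.
Proof.
  intros Hsg Hp Hr HM HB H0 HT. rewrite in_ball4_coord in H0.
  assert (incr : forall t, 0 <= t -> (forall s, 0 <= s < t -> in_ball4 r (phi s)) ->
    forall i, Rabs (coord i (phi t) - coord i (phi 0)) <= M * t).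
  { intros t Ht Hs i. destruct (Req_dec 0 t) as [<-|Hne].
    { rewrite Rminus_diag, Rabs_R0. lra. }
    destruct (MVT_cor2 (fun u => coord i (phi u)) (fun u => sg * coord i (xiH H (phi u))) 0 t)
      as [c [E Hc]]. lra.
    { intros c Hc. apply is_derive_Reals. apply Hp. lra. }
    rewrite E, Rabs_mult, Rminus_0_r, (Rabs_pos_eq t) by lra.
    apply Rmult_le_compat_r; auto. rewrite Rabs_mult.
    assert (Rabs sg = 1) as ->.
    { destruct Hsg as [->| ->]. apply Rabs_R1. rewrite Rabs_left; lra. }
    rewrite Rmult_1_l. apply HB. apply Hs. lra. }
  assert (all : forall t, 0 <= t <= T -> in_ball4 r (phi t)).
  { apply real_induction. intros t Ht Hs.
    assert (Mt : M * t <= M * T) by (apply Rmult_le_compat_l; lra).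
    assert (strict : forall i, Rabs (coord i (phi t)) < r / 2 + M * T).
    { intros i. pose proof (incr t (proj1 Ht) Hs i) as I1. pose proof (H0 i).
      pose proof (Rabs_triang (coord i (phi t) - coord i (phi 0)) (coord i (phi 0))) as Tr.
      replace (coord i (phi t) - coord i (phi 0) + coord i (phi 0))
        with (coord i (phi t)) in Tr by ring. lra. }
    split.
    - rewrite in_ball4_coord. intros i. specialize (strict i). lra.
    - destruct (traj_continuous sg H phi t (r / 2 - M * T) Hp (proj1 Ht)) as [e [He C]]. lra.
      exists e. split; auto. intros s Hst _. rewrite in_ball4_coord. intros i.
      specialize (C s). lapply C. 2:{ rewrite Rabs_pos_eq; lra. }
      intros C'. specialize (C' i). specialize (strict i).
      pose proof (Rabs_triang (coord i (phi s) - coord i (phi t)) (coord i (phi t))) as Tr.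
      replace (coord i (phi s) - coord i (phi t) + coord i (phi t))
        with (coord i (phi s)) in Tr by ring. lra. }
  intros t Ht. split. auto. apply incr. lra. intros s Hs. apply all. lra.
Qed.

(** Differentiable along trajectories, unlike [dist1], in which the Lipschitz bounds are stated. *)
Definition sq_dist (P Q : R4) : R :=
  (c0 P - c0 Q) * (c0 P - c0 Q) + (c1 P - c1 Q) * (c1 P - c1 Q)
  + (c2 P - c2 Q) * (c2 P - c2 Q) + (c3 P - c3 Q) * (c3 P - c3 Q).

Lemma sq_dist_pos (P Q : R4) : 0 <= sq_dist P Q.
Proof.
  unfold sq_dist. repeat apply Rplus_le_le_0_compat; apply Rle_0_sqr.
Qed.

Lemma sq_dist_0 (P Q : R4) : sq_dist P Q = 0 -> P = Q.
Proof.
  unfold sq_dist. intros H.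
  pose proof (Rle_0_sqr (c0 P - c0 Q)). pose proof (Rle_0_sqr (c1 P - c1 Q)).
  pose proof (Rle_0_sqr (c2 P - c2 Q)). pose proof (Rle_0_sqr (c3 P - c3 Q)).
  unfold Rsqr in *.
  apply coord_ext. apply (coord_ind (fun c => c P = c Q)); apply Rminus_diag_uniq;
    apply Rsqr_0_uniq; unfold Rsqr; lra.
Qed.

Lemma dist1_sq (P Q : R4) : dist1 P Q * dist1 P Q <= 4 * sq_dist P Q.
Proof.
  unfold dist1, sq_dist. rewrite <- !(sq_abs (_ - _)).
  set (a := Rabs (c0 P - c0 Q)). set (b := Rabs (c1 P - c1 Q)).
  set (c := Rabs (c2 P - c2 Q)). set (d := Rabs (c3 P - c3 Q)).
  pose proof (Rle_0_sqr (a - b)). pose proof (Rle_0_sqr (a - c)). pose proof (Rle_0_sqr (a - d)).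
  pose proof (Rle_0_sqr (b - c)). pose proof (Rle_0_sqr (b - d)). pose proof (Rle_0_sqr (c - d)).
  unfold Rsqr in *. lra.
Qed.

Definition sq_dist_rate (sg : R) (H : F4) (P Q : R4) : R :=
  2 * sg * ((c0 P - c0 Q) * (c0 (xiH H P) - c0 (xiH H Q))
    + (c1 P - c1 Q) * (c1 (xiH H P) - c1 (xiH H Q))
    + (c2 P - c2 Q) * (c2 (xiH H P) - c2 (xiH H Q))
    + (c3 P - c3 Q) * (c3 (xiH H P) - c3 (xiH H Q))).

Lemma is_derive_sq_dist (sg : R) (H : F4) (f g : R -> R4) (t : R) :
  traj sg H f -> traj sg H g -> 0 <= t ->
  is_derive (fun u => sq_dist (f u) (g u)) t (sq_dist_rate sg H (f t) (g t)).
Proof.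
  intros Hf Hg Ht.
  assert (D : forall i, is_derive (fun u => (coord i (f u) - coord i (g u)) * (coord i (f u) - coord i (g u))) t
    (2 * sg * ((coord i (f t) - coord i (g t)) * (coord i (xiH H (f t)) - coord i (xiH H (g t)))))).
  { intros i.
    assert (E : is_derive (fun u => coord i (f u) - coord i (g u)) t
      (sg * coord i (xiH H (f t)) - sg * coord i (xiH H (g t)))).
    { apply (is_derive_minus (fun u => coord i (f u)) (fun u => coord i (g u))); auto. }
    evar_last. apply (is_derive_mult _ _ t _ _ E E); intros; apply Rmult_comm.
    unfold plus, mult; simpl. ring. }
  unfold sq_dist, sq_dist_rate. evar_last.
  apply (is_derive_plus (V := R_NormedModule)); [apply (is_derive_plus (V := R_NormedModule));
    [apply (is_derive_plus (V := R_NormedModule)); [apply (D 0%nat) | apply (D 1%nat)] | apply (D 2%nat)] | apply (D 3%nat)].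
  unfold plus; simpl. ring.
Qed.

(** The constant 8 is the 2 from differentiating a square times the 4 of [dist1_sq]. The lower bound
    on the rate is the one that serves uniqueness backwards in time. *)
Lemma sq_dist_rate_bound (sg : R) (H : F4) (P Q : R4) (K : R) :
  (sg = 1 \/ sg = -1) -> 0 <= K ->
  (forall i, Rabs (coord i (xiH H P) - coord i (xiH H Q)) <= K * dist1 P Q) ->
  0 <= sq_dist_rate sg H P Q + 8 * K * sq_dist P Q.
Proof.
  intros Hsg HK L. unfold sq_dist_rate.
  assert (B : forall i, Rabs ((coord i P - coord i Q) * (coord i (xiH H P) - coord i (xiH H Q)))
     <= Rabs (coord i P - coord i Q) * (K * dist1 P Q)).
  { intros i. rewrite Rabs_mult. apply Rmult_le_compat_l. apply Rabs_pos. auto. }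
  pose proof (B 0%nat) as B0. pose proof (B 1%nat) as B1.
  pose proof (B 2%nat) as B2. pose proof (B 3%nat) as B3. simpl in *.
  apply Rabs_le_between in B0. apply Rabs_le_between in B1.
  apply Rabs_le_between in B2. apply Rabs_le_between in B3.
  pose proof (Rmult_le_compat_l K _ _ HK (dist1_sq P Q)) as S.
  assert (E : Rabs (c0 P - c0 Q) * (K * dist1 P Q) + Rabs (c1 P - c1 Q) * (K * dist1 P Q)
    + Rabs (c2 P - c2 Q) * (K * dist1 P Q) + Rabs (c3 P - c3 Q) * (K * dist1 P Q)
    = K * (dist1 P Q * dist1 P Q)).
  { unfold dist1. ring. }
  destruct Hsg as [-> | ->]; lra.
Qed.

(** Carries a meeting of two trajectories back to their starting points. The induction runs over the
    time elapsed before [T]: continuity handles the limit times, a local Gronwall estimate the steps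
    beyond them. *)
Lemma traj_backward_unique (sg : R) (H : F4) (f g : R -> R4) (T : R) :
  (sg = 1 \/ sg = -1) -> smooth4 H -> traj sg H f -> traj sg H g ->
  0 <= T -> f T = g T -> f 0 = g 0.
Proof.
  intros Hsg Hs Hf Hg HT E.
  enough (A : forall t, 0 <= t <= T -> f (T - t) = g (T - t)).
  { specialize (A T). rewrite Rminus_diag in A. apply A. lra. }
  apply real_induction. intros t Ht Hb.
  assert (eqt : f (T - t) = g (T - t)).
  { destruct (Req_dec t 0) as [->|Hne]. now rewrite Rminus_0_r.
    apply sq_dist_0. apply NNPP. intros N.
    set (e := sq_dist (f (T - t)) (g (T - t))) in *.
    assert (He : 0 < e) by (pose proof (sq_dist_pos (f (T - t)) (g (T - t))); fold e in H0; lra).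
    assert (C : continuity_pt (fun u => sq_dist (f u) (g u)) (T - t)).
    { apply continuity_pt_filterlim.
      apply (ex_derive_continuous (fun u => sq_dist (f u) (g u)) (T - t)).
      eexists. apply (is_derive_sq_dist sg H); auto. lra. }
    apply continuity_pt_locally with (eps := mkposreal e He) in C.
    destruct C as [d Hd]. pose proof (cond_pos d) as Dd.
    set (h := Rmin (d / 2) t).
    assert (0 < h /\ h < d /\ h <= t) by (unfold h, Rmin; destruct Rle_dec; lra).
    specialize (Hd (T - (t - h))). lapply Hd.
    2:{ unfold ball; simpl; unfold AbsRing_ball, abs, minus, plus, opp; simpl. rewrite Rabs_pos_eq; lra. }
    intros Hd'. rewrite (Hb (t - h)) in Hd' by lra.
    fold e in Hd'. simpl in Hd'.
    replace (sq_dist (g (T - (t - h))) (g (T - (t - h)))) with 0 in Hd' by (unfold sq_dist; ring).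
    rewrite Rminus_0_l, Rabs_Ropp, Rabs_pos_eq in Hd'; lra. }
  split; auto.
  destruct (xiH_lipschitz H (f (T - t)) Hs) as [K [r [HK [Hr L]]]].
  destruct (Req_dec t T) as [->|HtT].
  { exists 1. split; [lra|]. intros; lra. }
  destruct (traj_continuous sg H f (T - t) r Hf) as [e1 [He1 C1]]; try lra.
  destruct (traj_continuous sg H g (T - t) r Hg) as [e2 [He2 C2]]; try lra.
  set (e := Rmin e1 e2).
  assert (He : 0 < e /\ e <= e1 /\ e <= e2) by (unfold e, Rmin; destruct Rle_dec; lra).
  exists e. split. lra. intros s Hs1 Hs2.
  (* Gronwall: [exp (8 K u) |f - g|^2] is nondecreasing in [u]. *)
  destruct (MVT_cor2 (fun u => exp (8 * K * u) * sq_dist (f u) (g u))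
    (fun u => exp (8 * K * u) * (sq_dist_rate sg H (f u) (g u) + 8 * K * sq_dist (f u) (g u)))
    (T - s) (T - t)) as [c [Ec Hc]].
  - lra.
  - intros c Hc. apply is_derive_Reals. evar_last.
    apply (is_derive_mult (fun u => exp (8 * K * u)) (fun u => sq_dist (f u) (g u)) c
      (8 * K * exp (8 * K * c)) (sq_dist_rate sg H (f c) (g c))).
    + auto_derive. auto. ring.
    + apply is_derive_sq_dist; auto. lra.
    + intros; apply Rmult_comm.
    + unfold plus, mult; simpl. ring.
  - rewrite eqt in Ec.
    replace (sq_dist (g (T - t)) (g (T - t))) with 0 in Ec by (unfold sq_dist; ring).
    assert (P : 0 <= sq_dist_rate sg H (f c) (g c) + 8 * K * sq_dist (f c) (g c)).
    { apply sq_dist_rate_bound; auto. intros i. apply L.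
      - intros j. apply C1. rewrite Rabs_left; lra.
      - intros j. rewrite eqt. apply C2. rewrite Rabs_left; lra. }
    apply sq_dist_0. apply Rle_antisym; [|apply sq_dist_pos].
    pose proof (exp_pos (8 * K * c)). pose proof (exp_pos (8 * K * (T - s))).
    assert (Q1 : 0 <= exp (8 * K * c) * (sq_dist_rate sg H (f c) (g c) + 8 * K * sq_dist (f c) (g c))).
    { apply Rmult_le_pos; lra. }
    apply Rmult_le_reg_l with (exp (8 * K * (T - s))). auto.
    assert (Q2 := Rmult_le_pos _ ((T - t) - (T - s)) Q1).
    lapply Q2; lra.
Qed.

(** * Eigenvectors and invariant planes *)

Definition lincomb (e1 e2 e3 e4 : R4) (k1 k2 k3 k4 : R) : R4 :=
  mk4 (k1 * c0 e1 + k2 * c0 e2 + k3 * c0 e3 + k4 * c0 e4)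
      (k1 * c1 e1 + k2 * c1 e2 + k3 * c1 e3 + k4 * c1 e4)
      (k1 * c2 e1 + k2 * c2 e2 + k3 * c2 e3 + k4 * c2 e4)
      (k1 * c3 e1 + k2 * c3 e2 + k3 * c3 e3 + k4 * c3 e4).

Lemma mk4_inj (x y p q x' y' p' q' : R) :
  mk4 x y p q = mk4 x' y' p' q' -> x = x' /\ y = y' /\ p = p' /\ q = q'.
Proof. intros E. now inversion E. Qed.

Lemma eigvec_coords (H : F4) (l : R) (e : R4) :
  eigvec H l e ->
  d0 (pd4 2 H) e = l * c0 e /\ d0 (pd4 3 H) e = l * c1 e /\
  - d0 (pd4 0 H) e = l * c2 e /\ - d0 (pd4 1 H) e = l * c3 e.
Proof. intros [_ E]. unfold linL, scale4 in E. now apply mk4_inj. Qed.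

Lemma linL_lincomb (H : F4) (l1 l2 l3 l4 : R) (e1 e2 e3 e4 : R4) (k1 k2 k3 k4 : R) :
  eigvec H l1 e1 -> eigvec H l2 e2 -> eigvec H l3 e3 -> eigvec H l4 e4 ->
  linL H (lincomb e1 e2 e3 e4 k1 k2 k3 k4)
  = lincomb e1 e2 e3 e4 (l1 * k1) (l2 * k2) (l3 * k3) (l4 * k4).
Proof.
  intros E1 E2 E3 E4.
  apply eigvec_coords in E1. apply eigvec_coords in E2.
  apply eigvec_coords in E3. apply eigvec_coords in E4.
  assert (lin : forall g, d0 g (lincomb e1 e2 e3 e4 k1 k2 k3 k4)
    = k1 * d0 g e1 + k2 * d0 g e2 + k3 * d0 g e3 + k4 * d0 g e4).
  { intros g. unfold d0, lincomb; simpl. ring. }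
  unfold linL. rewrite !lin. unfold lincomb.
  destruct E1 as [A1 [A2 [A3 A4]]], E2 as [B1 [B2 [B3 B4]]],
    E3 as [C1 [C2 [C3 C4]]], E4 as [D1 [D2 [D3 D4]]].
  f_equal.
  - rewrite A1, B1, C1, D1. ring.
  - rewrite A2, B2, C2, D2. ring.
  - replace (l1 * k1 * c2 e1) with (k1 * - d0 (pd4 0 H) e1) by (rewrite A3; ring).
    replace (l2 * k2 * c2 e2) with (k2 * - d0 (pd4 0 H) e2) by (rewrite B3; ring).
    replace (l3 * k3 * c2 e3) with (k3 * - d0 (pd4 0 H) e3) by (rewrite C3; ring).
    replace (l4 * k4 * c2 e4) with (k4 * - d0 (pd4 0 H) e4) by (rewrite D3; ring). ring.
  - replace (l1 * k1 * c3 e1) with (k1 * - d0 (pd4 1 H) e1) by (rewrite A4; ring).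
    replace (l2 * k2 * c3 e2) with (k2 * - d0 (pd4 1 H) e2) by (rewrite B4; ring).
    replace (l3 * k3 * c3 e3) with (k3 * - d0 (pd4 1 H) e3) by (rewrite C4; ring).
    replace (l4 * k4 * c3 e4) with (k4 * - d0 (pd4 1 H) e4) by (rewrite D4; ring). ring.
Qed.

Lemma linL_zero (H : F4) : linL H zero4 = zero4.
Proof. unfold linL, d0, zero4; simpl. f_equal; ring. Qed.

(** The even equations involve only [v1 + v3] and [v2 + v4], the odd ones only [v1 - v3] and
    [v2 - v4]; each pair has a determinant with the factor [a^2 - b^2]. *)
Lemma vandermonde_zero (a b v1 v2 v3 v4 : R) :
  0 < a -> 0 < b -> a <> b ->
  v1 + v2 + v3 + v4 = 0 ->
  a * v1 + b * v2 + - a * v3 + - b * v4 = 0 ->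
  a * (a * v1) + b * (b * v2) + - a * (- a * v3) + - b * (- b * v4) = 0 ->
  a * (a * (a * v1)) + b * (b * (b * v2)) + - a * (- a * (- a * v3)) + - b * (- b * (- b * v4)) = 0 ->
  v1 = 0 /\ v2 = 0 /\ v3 = 0 /\ v4 = 0.
Proof.
  intros Ha Hb Hab E0 E1 E2 E3.
  assert (N : (a - b) * (a + b) <> 0).
  { apply Rmult_integral_contrapositive; split; lra. }
  assert (S : v1 + v3 = 0).
  { apply Rmult_eq_reg_l with ((a - b) * (a + b)); auto.
    replace (v2) with (- v1 - v3 - v4) in E2 by lra. ring_simplify in E2. ring_simplify. lra. }
  assert (D : a * (v1 - v3) = 0).
  { apply Rmult_eq_reg_l with ((a - b) * (a + b)); auto.
    assert (E4 : b * b * (a * v1 + b * v2 + - a * v3 + - b * v4) = 0) by (rewrite E1; ring).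
    ring_simplify in E4. ring_simplify in E3. ring_simplify. lra. }
  apply Rmult_integral in D. destruct D as [D|D]; [lra|].
  assert (v1 = 0) by lra. assert (v3 = 0) by lra. subst.
  assert (D' : b * (v2 - v4) = 0) by lra.
  apply Rmult_integral in D'. destruct D'; lra.
Qed.

Lemma scaled_nonzero (k : R) (e : R4) :
  e <> zero4 -> k * c0 e = 0 -> k * c1 e = 0 -> k * c2 e = 0 -> k * c3 e = 0 -> k = 0.
Proof.
  intros N E0 E1 E2 E3. apply NNPP. intros Hk. apply N.
  apply Rmult_integral in E0. apply Rmult_integral in E1.
  apply Rmult_integral in E2. apply Rmult_integral in E3.
  destruct e as [x y p q]; unfold zero4; simpl in *. f_equal; tauto.
Qed.

Lemma solve2 (x1 y1 x2 y2 x y : R) :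
  x1 * y2 - x2 * y1 <> 0 -> exists u v, x = u * x1 + v * x2 /\ y = u * y1 + v * y2.
Proof.
  intros D. exists ((x * y2 - x2 * y) / (x1 * y2 - x2 * y1)), ((x1 * y - x * y1) / (x1 * y2 - x2 * y1)).
  split; field; exact D.
Qed.

(* With [s11], [s12], [s22] the second derivatives of [z] at the origin, the image is the
   tangent plane of the jet. *)
Definition tangent_lift (s11 s12 s22 x y : R) : R4 :=
  mk4 x y (s11 * x + s12 * y) (s12 * x + s22 * y).

Section EigenBasis.

Context (H : F4) (a b : R) (e1 e2 e3 e4 : R4).
Context (Ha : 0 < a) (Hb : 0 < b) (Hab : a <> b).
Context (E1 : eigvec H a e1) (E2 : eigvec H b e2)
  (E3 : eigvec H (- a) e3) (E4 : eigvec H (- b) e4).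

Let comb := lincomb e1 e2 e3 e4.

(** Applying [L] three times to the relation gives, in each coordinate of R^4, a Vandermonde system
    with nodes [a], [b], [- a], [- b]. *)
Lemma eigenbasis_free (k1 k2 k3 k4 : R) :
  comb k1 k2 k3 k4 = zero4 -> k1 = 0 /\ k2 = 0 /\ k3 = 0 /\ k4 = 0.
Proof.
  intros Z0.
  assert (next : forall k1 k2 k3 k4, comb k1 k2 k3 k4 = zero4 ->
    comb (a * k1) (b * k2) (- a * k3) (- b * k4) = zero4).
  { intros h1 h2 h3 h4 Z. unfold comb in *.
    rewrite <- (linL_lincomb H a b (- a) (- b)), Z by assumption. apply linL_zero. }
  pose proof (next _ _ _ _ Z0) as Z1. pose proof (next _ _ _ _ Z1) as Z2.
  pose proof (next _ _ _ _ Z2) as Z3.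
  assert (V : forall c : R4 -> R, c zero4 = 0 ->
    (forall h1 h2 h3 h4, c (comb h1 h2 h3 h4) = h1 * c e1 + h2 * c e2 + h3 * c e3 + h4 * c e4) ->
    k1 * c e1 = 0 /\ k2 * c e2 = 0 /\ k3 * c e3 = 0 /\ k4 * c e4 = 0).
  { intros c cz cl.
    apply (f_equal c) in Z0. apply (f_equal c) in Z1.
    apply (f_equal c) in Z2. apply (f_equal c) in Z3.
    rewrite cz, cl in Z0, Z1, Z2, Z3.
    apply (vandermonde_zero a b); auto; lra. }
  pose proof (V c0 eq_refl (fun _ _ _ _ => eq_refl)) as V0.
  pose proof (V c1 eq_refl (fun _ _ _ _ => eq_refl)) as V1.
  pose proof (V c2 eq_refl (fun _ _ _ _ => eq_refl)) as V2.
  pose proof (V c3 eq_refl (fun _ _ _ _ => eq_refl)) as V3.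
  destruct E1 as [N1 _], E2 as [N2 _], E3 as [N3 _], E4 as [N4 _].
  split; [apply (scaled_nonzero _ e1); tauto|].
  split; [apply (scaled_nonzero _ e2); tauto|].
  split; [apply (scaled_nonzero _ e3); tauto | apply (scaled_nonzero _ e4); tauto].
Qed.

(** Block elimination in place of a dimension count: [e1] and [e2] account for the first two
    coordinates, and what they leave of [e3] and [e4] in the last two has nonzero determinant
    because the four vectors are free. *)
Lemma eigenbasis_spans (P : R4) :
  pi_indep e1 e2 -> exists k1 k2 k3 k4, P = comb k1 k2 k3 k4.
Proof.
  intros Hpi.
  assert (D : c0 e1 * c1 e2 - c0 e2 * c1 e1 <> 0).
  { intros D.
    destruct (Hpi (c1 e2) (- c1 e1)) as [Y2 Y1]; try lra.
    destruct (Hpi (c0 e2) (- c0 e1)) as [X2 X1]; try lra.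
    destruct (Hpi 1 0); lra. }
  destruct (solve2 _ _ _ _ (c0 e3) (c1 e3) D) as [u3 [v3 [X3 Y3]]].
  destruct (solve2 _ _ _ _ (c0 e4) (c1 e4) D) as [u4 [v4 [X4 Y4]]].
  destruct (solve2 _ _ _ _ (c0 P) (c1 P) D) as [u [v [X Y]]].
  set (p3 := c2 e3 - u3 * c2 e1 - v3 * c2 e2). set (q3 := c3 e3 - u3 * c3 e1 - v3 * c3 e2).
  set (p4 := c2 e4 - u4 * c2 e1 - v4 * c2 e2). set (q4 := c3 e4 - u4 * c3 e1 - v4 * c3 e2).
  assert (comb34 : forall k3 k4, k3 * p3 + k4 * p4 = 0 -> k3 * q3 + k4 * q4 = 0 -> k3 = 0 /\ k4 = 0).
  { intros k3 k4 Ep Eq.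
    destruct (eigenbasis_free (- k3 * u3 - k4 * u4) (- k3 * v3 - k4 * v4) k3 k4) as [_ [_ Z]]; auto.
    unfold comb, lincomb, zero4. rewrite X3, X4, Y3, Y4. unfold p3, q3, p4, q4 in *.
    f_equal; lra. }
  assert (F : p3 * q4 - p4 * q3 <> 0).
  { intros F.
    destruct (comb34 q4 (- q3)) as [Q4 Q3]; try lra.
    destruct (comb34 p4 (- p3)) as [P4 P3]; try lra.
    destruct (comb34 1 0); lra. }
  destruct (solve2 _ _ _ _ (c2 P - u * c2 e1 - v * c2 e2) (c3 P - u * c3 e1 - v * c3 e2) F)
    as [k3 [k4 [K1 K2]]].
  exists (u - k3 * u3 - k4 * u4), (v - k3 * v3 - k4 * v4), k3, k4.
  unfold comb, lincomb, p3, q3, p4, q4 in *.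
  destruct P as [x y p q]; simpl in *.
  f_equal; [rewrite X, X3, X4 | rewrite Y, Y3, Y4 | |]; lra.
Qed.

(* The coordinate functionals of the eigenbasis restrict to left eigenvectors on an
   invariant plane; being jointly injective, two of them are independent there. *)
Lemma invariant_plane_functionals (s11 s12 s22 : R) :
  let tl := tangent_lift s11 s12 s22 in
  let A1 := fun x y => d0 (pd4 2 H) (tl x y) in
  let A2 := fun x y => d0 (pd4 3 H) (tl x y) in
  pi_indep e1 e2 ->
  (forall x y, linL H (tl x y) = tl (A1 x y) (A2 x y)) ->
  exists al be ga de l m, al * de - be * ga <> 0 /\
    (l = a \/ l = b \/ l = - a \/ l = - b) /\ (m = a \/ m = b \/ m = - a \/ m = - b) /\
    forall x y, al * A1 x y + be * A2 x y = l * (al * x + be * y) /\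
                ga * A1 x y + de * A2 x y = m * (ga * x + de * y).
Proof.
  intros tl A1 A2 Hpi Hinv.
  destruct (eigenbasis_spans (tl 1 0) Hpi) as [a1 [a2 [a3 [a4 T1]]]].
  destruct (eigenbasis_spans (tl 0 1) Hpi) as [b1 [b2 [b3 [b4 T2]]]].
  assert (T : forall x y, tl x y = comb (a1 * x + b1 * y) (a2 * x + b2 * y) (a3 * x + b3 * y) (a4 * x + b4 * y)).
  { intros x y. unfold comb, lincomb, tl, tangent_lift in *.
    apply mk4_inj in T1. destruct T1 as [G0 [G1 [G2 G3]]].
    apply mk4_inj in T2. destruct T2 as [K0 [K1 [K2 K3]]].
    f_equal.
    - replace x with (x * 1 + y * 0) at 1 by ring. rewrite G0 at 1. rewrite K0 at 1. ring.
    - replace y with (x * 0 + y * 1) at 1 by ring. rewrite G1 at 1. rewrite K1 at 1. ring.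
    - replace (s11 * x + s12 * y) with (x * (s11 * 1 + s12 * 0) + y * (s11 * 0 + s12 * 1)) by ring.
      rewrite G2, K2. ring.
    - replace (s12 * x + s22 * y) with (x * (s12 * 1 + s22 * 0) + y * (s12 * 0 + s22 * 1)) by ring.
      rewrite G3, K3. ring. }
  assert (F : forall x y,
     a1 * A1 x y + b1 * A2 x y = a * (a1 * x + b1 * y) /\
     a2 * A1 x y + b2 * A2 x y = b * (a2 * x + b2 * y) /\
     a3 * A1 x y + b3 * A2 x y = - a * (a3 * x + b3 * y) /\
     a4 * A1 x y + b4 * A2 x y = - b * (a4 * x + b4 * y)).
  { intros x y. pose proof (Hinv x y) as I. rewrite (T x y), (T (A1 x y) (A2 x y)) in I.
    unfold comb at 1 in I. rewrite (linL_lincomb H a b (- a) (- b)) in I by assumption.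
    unfold comb, lincomb in I. apply mk4_inj in I. destruct I as [I0 [I1 [I2 I3]]].
    destruct (eigenbasis_free
      (a1 * A1 x y + b1 * A2 x y - a * (a1 * x + b1 * y))
      (a2 * A1 x y + b2 * A2 x y - b * (a2 * x + b2 * y))
      (a3 * A1 x y + b3 * A2 x y - - a * (a3 * x + b3 * y))
      (a4 * A1 x y + b4 * A2 x y - - b * (a4 * x + b4 * y))) as [F1 [F2 [F3 F4]]].
    { unfold comb, lincomb, zero4. f_equal; lra. }
    repeat split; lra. }
  assert (inj : forall x y, a1 * x + b1 * y = 0 -> a2 * x + b2 * y = 0 ->
    a3 * x + b3 * y = 0 -> a4 * x + b4 * y = 0 -> x = 0 /\ y = 0).
  { intros x y Z1 Z2 Z3 Z4. pose proof (T x y) as I. rewrite Z1, Z2, Z3, Z4 in I.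
    unfold tl, tangent_lift, comb, lincomb in I. apply mk4_inj in I. split; lra. }
  destruct (Req_dec (a1 * b2 - b1 * a2) 0) as [D12|D].
  2:{ exists a1, b1, a2, b2, a, b. split; [exact D|]. split; [tauto|]. split; [tauto|].
      intros x y. split; apply F. }
  destruct (Req_dec (a1 * b3 - b1 * a3) 0) as [D13|D].
  2:{ exists a1, b1, a3, b3, a, (- a). split; [exact D|]. split; [tauto|]. split; [tauto|].
      intros x y. split; apply F. }
  destruct (Req_dec (a1 * b4 - b1 * a4) 0) as [D14|D].
  2:{ exists a1, b1, a4, b4, a, (- b). split; [exact D|]. split; [tauto|]. split; [tauto|].
      intros x y. split; apply F. }
  destruct (Req_dec (a2 * b3 - b2 * a3) 0) as [D23|D].
  2:{ exists a2, b2, a3, b3, b, (- a). split; [exact D|]. split; [tauto|]. split; [tauto|].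
      intros x y. split; apply F. }
  destruct (Req_dec (a2 * b4 - b2 * a4) 0) as [D24|D].
  2:{ exists a2, b2, a4, b4, b, (- b). split; [exact D|]. split; [tauto|]. split; [tauto|].
      intros x y. split; apply F. }
  destruct (Req_dec (a3 * b4 - b3 * a4) 0) as [D34|D].
  2:{ exists a3, b3, a4, b4, (- a), (- b). split; [exact D|]. split; [tauto|]. split; [tauto|].
      intros x y. split; apply F. }
  (* If all six minors vanish, each vector [(b_i, - a_i)] is annihilated by all four functionals and
     is therefore zero, which makes the functionals themselves zero. *)
  exfalso.
  destruct (inj b1 (- a1)) as [Y1 X1]; try lra.
  destruct (inj b2 (- a2)) as [Y2 X2]; try lra.
  destruct (inj b3 (- a3)) as [Y3 X3]; try lra.
  destruct (inj b4 (- a4)) as [Y4 X4]; try lra.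
  assert (a1 = 0) by lra. assert (a2 = 0) by lra. assert (a3 = 0) by lra. assert (a4 = 0) by lra.
  destruct (inj 1 0); subst; try lra.
Qed.

End EigenBasis.

(** * Linearization along the jet *)

Lemma is_derive_iff_little_o (f : R -> R) (x l : R) :
  is_derive f x l <->
  forall eps, 0 < eps -> exists d, 0 < d /\ forall h, Rabs h < d ->
    Rabs (f (x + h) - f x - l * h) <= eps * Rabs h.
Proof.
  rewrite is_derive_Reals. split.
  - intros D eps He. destruct (D eps He) as [d Hd]. exists d. split. apply cond_pos.
    intros h Hh. destruct (Req_dec h 0) as [->|Hne].
    + rewrite Rplus_0_r, Rabs_R0. replace (f x - f x - l * 0) with 0 by ring. rewrite Rabs_R0. lra.
    + specialize (Hd h Hne Hh).
      replace (f (x + h) - f x - l * h) with (((f (x + h) - f x) / h - l) * h) by (field; auto).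
      rewrite Rabs_mult. apply Rmult_le_compat_r. apply Rabs_pos. lra.
  - intros L eps He. destruct (L (eps / 2)) as [d [Hd Ld]]. lra.
    exists (mkposreal d Hd). intros h Hne Hh. specialize (Ld h Hh).
    replace ((f (x + h) - f x) / h - l) with ((f (x + h) - f x - l * h) / h) by (field; auto).
    unfold Rdiv at 1. rewrite Rabs_mult, Rabs_inv.
    assert (0 < Rabs h) by now apply Rabs_pos_lt.
    apply Rle_lt_trans with (eps / 2); [|lra].
    apply Rmult_le_reg_r with (Rabs h); auto. rewrite Rmult_assoc, Rinv_l; lra.
Qed.

(** The bound [e <= 1] lets later estimates replace first-order errors by plain growth bounds. *)
Lemma small_factor (C eps : R) : 0 <= C -> 0 < eps -> exists e, 0 < e /\ e <= 1 /\ e * C <= eps.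
Proof.
  intros HC He. exists (Rmin 1 (eps / (C + 1))).
  assert (P : 0 < eps / (C + 1)) by (apply Rdiv_lt_0_compat; lra).
  assert (M : 0 < Rmin 1 (eps / (C + 1)) /\ Rmin 1 (eps / (C + 1)) <= 1
    /\ Rmin 1 (eps / (C + 1)) <= eps / (C + 1)).
  { unfold Rmin; destruct Rle_dec; lra. }
  split; [tauto|]. split; [tauto|].
  apply Rle_trans with (eps / (C + 1) * C). apply Rmult_le_compat_r; tauto.
  replace eps with (eps / (C + 1) * (C + 1)) at 2 by (field; lra).
  apply Rmult_le_compat_l; lra.
Qed.

Lemma is_derive_comp4 (f : F4) (x y p q : R -> R) (t dx dy dp dq : R) :
  smooth4 f ->
  is_derive x t dx -> is_derive y t dy -> is_derive p t dp -> is_derive q t dq ->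
  is_derive (fun s => f (x s) (y s) (p s) (q s)) t
    (pd4 0 f (x t) (y t) (p t) (q t) * dx + pd4 1 f (x t) (y t) (p t) (q t) * dy
     + pd4 2 f (x t) (y t) (p t) (q t) * dp + pd4 3 f (x t) (y t) (p t) (q t) * dq).
Proof.
  intros Hs Dx Dy Dp Dq. apply is_derive_iff_little_o. intros eps He.
  set (g0 := pd4 0 f (x t) (y t) (p t) (q t)). set (g1 := pd4 1 f (x t) (y t) (p t) (q t)).
  set (g2 := pd4 2 f (x t) (y t) (p t) (q t)). set (g3 := pd4 3 f (x t) (y t) (p t) (q t)).
  (* [C] is the total coefficient of [e * |h|] in the error: the increments of the inner functions
     enter through [strict_diff4], the gradient of [f] through the inner expansions. *)
  set (C := (Rabs dx + 1) + (Rabs dy + 1) + (Rabs dp + 1) + (Rabs dq + 1)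
     + (Rabs g0 + Rabs g1 + Rabs g2 + Rabs g3)).
  pose proof (Rabs_pos dx). pose proof (Rabs_pos dy). pose proof (Rabs_pos dp). pose proof (Rabs_pos dq).
  pose proof (Rabs_pos g0). pose proof (Rabs_pos g1). pose proof (Rabs_pos g2). pose proof (Rabs_pos g3).
  destruct (small_factor C eps) as [e [He0 [He1 HeC]]]. unfold C; lra. auto.
  destruct (strict_diff4 f (x t) (y t) (p t) (q t) 1 Rlt_0_1) with (eps := e) as [r [Hr L]]; auto.
  { intros i x' y' p' q' _ _ _ _. apply (Hs nil). }
  { intros i. apply (Hs (i :: nil)). }
  fold g0 g1 g2 g3 in L.
  rewrite is_derive_iff_little_o in Dx, Dy, Dp, Dq.
  destruct (Dx e He0) as [r0 [R0 L0]]. destruct (Dy e He0) as [r1 [R1 L1]].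
  destruct (Dp e He0) as [r2 [R2 L2]]. destruct (Dq e He0) as [r3 [R3 L3]].
  set (d := Rmin (r / C) (Rmin (Rmin r0 r1) (Rmin r2 r3))).
  assert (CP : 4 <= C) by (unfold C; lra).
  assert (0 < r / C) by (apply Rdiv_lt_0_compat; lra).
  assert (Hd : 0 < d /\ d <= r / C /\ d <= r0 /\ d <= r1 /\ d <= r2 /\ d <= r3).
  { unfold d, Rmin. repeat destruct Rle_dec; lra. }
  exists d. split. lra. intros h Hh.
  specialize (L0 h). specialize (L1 h). specialize (L2 h). specialize (L3 h).
  lapply L0; [clear L0; intros L0|lra]. lapply L1; [clear L1; intros L1|lra].
  lapply L2; [clear L2; intros L2|lra]. lapply L3; [clear L3; intros L3|lra].
  pose proof (Rabs_pos h) as Hh0.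
  assert (eh : e * Rabs h <= Rabs h) by nra.
  assert (hC : Rabs h * C < r).
  { replace r with (r / C * C) by (field; lra). apply Rmult_lt_compat_r; lra. }
  assert (grow : forall D u, Rabs (u - D * h) <= e * Rabs h -> Rabs u <= (Rabs D + 1) * Rabs h).
  { intros D u Hu. pose proof (Rabs_triang (u - D * h) (D * h)) as T.
    replace (u - D * h + D * h) with u in T by ring. rewrite (Rabs_mult D h) in T. lra. }
  set (u0 := x (t + h) - x t) in *. set (u1 := y (t + h) - y t) in *.
  set (u2 := p (t + h) - p t) in *. set (u3 := q (t + h) - q t) in *.
  pose proof (grow _ _ L0) as G0. pose proof (grow _ _ L1) as G1.
  pose proof (grow _ _ L2) as G2. pose proof (grow _ _ L3) as G3.
  assert (bound : forall D u, Rabs D + 1 <= C -> Rabs u <= (Rabs D + 1) * Rabs h -> Rabs u < r).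
  { intros D u HD Hu. assert ((Rabs D + 1) * Rabs h <= C * Rabs h) by (apply Rmult_le_compat_r; lra). lra. }
  assert (Z : forall a, Rabs (a - a) < r) by (intros; rewrite Rminus_diag, Rabs_R0; auto).
  specialize (L (x t) (y t) (p t) (q t) (x (t + h)) (y (t + h)) (p (t + h)) (q (t + h))
    (Z _) (Z _) (Z _) (Z _)).
  fold u0 u1 u2 u3 in L.
  lapply L; [clear L; intros L | apply (bound dx); auto; unfold C; lra].
  lapply L; [clear L; intros L | apply (bound dy); auto; unfold C; lra].
  lapply L; [clear L; intros L | apply (bound dp); auto; unfold C; lra].
  lapply L; [clear L; intros L | apply (bound dq); auto; unfold C; lra].
  pose proof (Rabs_sum4 g0 g1 g2 g3 (u0 - dx * h) (u1 - dy * h) (u2 - dp * h) (u3 - dq * h)) as T.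
  assert (T' : Rabs g0 * Rabs (u0 - dx * h) + Rabs g1 * Rabs (u1 - dy * h)
     + Rabs g2 * Rabs (u2 - dp * h) + Rabs g3 * Rabs (u3 - dq * h)
     <= (Rabs g0 + Rabs g1 + Rabs g2 + Rabs g3) * (e * Rabs h)).
  { rewrite !Rmult_plus_distr_r. repeat apply Rplus_le_compat; apply Rmult_le_compat_l; auto. }
  assert (L' : e * (Rabs u0 + Rabs u1 + Rabs u2 + Rabs u3) <=
     e * (((Rabs dx + 1) + (Rabs dy + 1) + (Rabs dp + 1) + (Rabs dq + 1)) * Rabs h)).
  { apply Rmult_le_compat_l; lra. }
  assert (fin : e * C * Rabs h <= eps * Rabs h) by (apply Rmult_le_compat_r; auto).
  unfold C in fin.
  apply Rabs_le_between in L. apply Rabs_le_between in T. apply Rabs_le_between. lra.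
Qed.

(** The chain rule as a statement about numbers, so that [u2] and [u3] may be increments of the
    gradient between two points or intermediate values from the mean value theorem. *)
Lemma compose_expansions (g0 g1 g2 g3 s11 s12 s22 eps : R) :
  0 < eps -> exists e, 0 < e /\ forall u0 u1 u2 u3 D,
    Rabs (u2 - (s11 * u0 + s12 * u1)) <= e * (Rabs u0 + Rabs u1) ->
    Rabs (u3 - (s12 * u0 + s22 * u1)) <= e * (Rabs u0 + Rabs u1) ->
    Rabs (D - (g0 * u0 + g1 * u1 + g2 * u2 + g3 * u3))
      <= e * (Rabs u0 + Rabs u1 + Rabs u2 + Rabs u3) ->
    Rabs (D - (g0 * u0 + g1 * u1 + g2 * (s11 * u0 + s12 * u1) + g3 * (s12 * u0 + s22 * u1)))
      <= eps * (Rabs u0 + Rabs u1).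
Proof.
  intros He.
  set (S := Rabs s11 + Rabs s12 + Rabs s22 + 1).
  pose proof (Rabs_pos s11). pose proof (Rabs_pos s12). pose proof (Rabs_pos s22).
  pose proof (Rabs_pos g2). pose proof (Rabs_pos g3).
  (* Since [|u2|] and [|u3|] are at most [S * N], the outer error has weight [1 + 2 S]; the errors
     of [u2] and [u3] have weights [|g2|] and [|g3|]. *)
  destruct (small_factor (1 + 2 * S + Rabs g2 + Rabs g3) eps) as [e [He0 [He1 HeC]]].
  unfold S; lra. auto.
  exists e. split; auto. intros u0 u1 u2 u3 D K2 K3 HD.
  set (N := Rabs u0 + Rabs u1) in *.
  pose proof (Rabs_pos u0). pose proof (Rabs_pos u1).
  assert (HN : 0 <= N) by (unfold N; lra).
  assert (eN : e * N <= N) by nra.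
  assert (grow : forall s s' u, Rabs s <= S - 1 - Rabs s' -> Rabs (u - (s * u0 + s' * u1)) <= e * N -> Rabs u <= S * N).
  { intros s s' u Hss Hu.
    pose proof (Rabs_triang (u - (s * u0 + s' * u1)) (s * u0 + s' * u1)) as T.
    replace (u - (s * u0 + s' * u1) + (s * u0 + s' * u1)) with u in T by ring.
    pose proof (Rabs_triang (s * u0) (s' * u1)) as T2. rewrite !Rabs_mult in T2.
    pose proof (Rabs_pos s). pose proof (Rabs_pos s').
    assert (Rabs s * Rabs u0 + Rabs s' * Rabs u1 <= (Rabs s + Rabs s') * N).
    { unfold N. assert (0 <= Rabs s * Rabs u1) by (apply Rmult_le_pos; auto).
      assert (0 <= Rabs s' * Rabs u0) by (apply Rmult_le_pos; auto). lra. }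
    assert ((Rabs s + Rabs s') * N <= (S - 1) * N) by (apply Rmult_le_compat_r; lra). lra. }
  assert (B2 : Rabs u2 <= S * N) by (apply (grow s11 s12); auto; unfold S; lra).
  assert (B3 : Rabs u3 <= S * N) by (apply (grow s12 s22); auto; unfold S; lra).
  assert (BD : e * (N + Rabs u2 + Rabs u3) <= e * (N + S * N + S * N)) by (apply Rmult_le_compat_l; lra).
  pose proof (Rabs_triang (g2 * (u2 - (s11 * u0 + s12 * u1))) (g3 * (u3 - (s12 * u0 + s22 * u1)))) as T.
  rewrite !Rabs_mult in T.
  assert (W2 : Rabs g2 * Rabs (u2 - (s11 * u0 + s12 * u1)) <= Rabs g2 * (e * N)) by (apply Rmult_le_compat_l; auto).
  assert (W3 : Rabs g3 * Rabs (u3 - (s12 * u0 + s22 * u1)) <= Rabs g3 * (e * N)) by (apply Rmult_le_compat_l; auto).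
  assert (fin : e * (1 + 2 * S + Rabs g2 + Rabs g3) * N <= eps * N) by (apply Rmult_le_compat_r; auto).
  fold N in HD. apply Rabs_le_between in HD. 
  assert (T' := Rle_trans _ _ _ T (Rplus_le_compat _ _ _ _ W2 W3)).
  apply Rabs_le_between in T'. apply Rabs_le_between. lra.
Qed.

(** Strict differentiability at the origin with gradient [(s, t)]. Keeping both points free makes it
    applicable to the difference of two trajectories. *)
Definition strict2 (f : F2) (s t : R) : Prop :=
  forall eps, 0 < eps -> exists d, 0 < d /\ forall x y x' y',
    Rabs x < d -> Rabs y < d -> Rabs x' < d -> Rabs y' < d ->
    Rabs (f x' y' - f x y - (s * (x' - x) + t * (y' - y))) <= eps * (Rabs (x' - x) + Rabs (y' - y)).

Lemma C2_strict_gradient (f : F2) (r : R) (i : nat) :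
  0 < r -> C2_on r f -> strict2 (pd2 i f) (pd2 0 (pd2 i f) 0 0) (pd2 1 (pd2 i f) 0 0).
Proof.
  intros Hr HC eps He.
  destruct (strict_diff2 (pd2 i f) 0 0 r Hr) with (eps := eps) as [d [Hd L]]; auto.
  - intros j x y Hx Hy. rewrite Rminus_0_r in Hx, Hy.
    apply (HC x y (conj Hx Hy) (i :: nil)); simpl; lia.
  - intros j. apply (HC 0 0) with (l := j :: i :: nil); [|simpl; lia].
    unfold in_ball2. rewrite Rabs_R0. lra.
  - exists d. split; auto. intros x y x' y' Hx Hy Hx' Hy'.
    apply L; rewrite Rminus_0_r; auto.
Qed.

(** Lets a single [s12] serve both rows of [tangent_lift]. *)
Lemma C2_schwarz (f : F2) (r : R) :
  0 < r -> C2_on r f -> pd2 0 (pd2 1 f) 0 0 = pd2 1 (pd2 0 f) 0 0.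
Proof.
  intros Hr HC.
  assert (cont : forall g, cont2 g 0 0 -> continuity_2d_pt g 0 0).
  { intros g Hg eps. destruct (Hg eps (cond_pos eps)) as [d [Hd L]].
    exists (mkposreal d Hd). intros u v Hu Hv. apply L; auto. }
  assert (B0 : in_ball2 r 0 0) by (unfold in_ball2; rewrite Rabs_R0; lra).
  apply (Schwarz f 0 0).
  - exists (mkposreal r Hr). intros u v Hu Hv. rewrite Rminus_0_r in Hu, Hv.
    assert (B : in_ball2 r u v) by (split; auto).
    repeat split.
    + apply (proj2 (HC u v B nil ltac:(simpl; lia)) ltac:(simpl; lia) 0%nat).
    + apply (proj2 (HC u v B nil ltac:(simpl; lia)) ltac:(simpl; lia) 1%nat).
    + apply (proj2 (HC u v B (1%nat :: nil) ltac:(simpl; lia)) ltac:(simpl; lia) 0%nat).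
    + apply (proj2 (HC u v B (0%nat :: nil) ltac:(simpl; lia)) ltac:(simpl; lia) 1%nat).
  - apply cont. apply (HC 0 0 B0 (0%nat :: 1%nat :: nil)). simpl; lia.
  - apply cont. apply (HC 0 0 B0 (1%nat :: 0%nat :: nil)). simpl; lia.
Qed.

Lemma strict2_small (g : F2) (s t r : R) :
  0 < r -> g 0 0 = 0 -> strict2 g s t ->
  exists d, 0 < d /\ forall x y, Rabs x < d -> Rabs y < d -> Rabs (g x y) < r.
Proof.
  intros Hr g0 Sg. destruct (Sg 1 Rlt_0_1) as [d [Hd Lg]].
  pose proof (Rabs_pos s). pose proof (Rabs_pos t).
  assert (0 < r / (2 + Rabs s + Rabs t)) by (apply Rdiv_lt_0_compat; lra).
  set (d' := Rmin d (r / (2 + Rabs s + Rabs t))).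
  assert (Hd' : 0 < d' /\ d' <= d /\ d' <= r / (2 + Rabs s + Rabs t)).
  { unfold d', Rmin. destruct Rle_dec; lra. }
  exists d'. split. lra. intros x y Hx Hy.
  specialize (Lg 0 0 x y). rewrite Rabs_R0, g0, !Rminus_0_r in Lg.
  assert (Lg' : Rabs (g x y - (s * x + t * y)) <= 1 * (Rabs x + Rabs y)) by (apply Lg; lra).
  pose proof (Rabs_triang (g x y - (s * x + t * y)) (s * x + t * y)) as T.
  replace (g x y - (s * x + t * y) + (s * x + t * y)) with (g x y) in T by ring.
  pose proof (Rabs_triang (s * x) (t * y)) as T2. rewrite !Rabs_mult in T2.
  assert (Rabs s * Rabs x <= Rabs s * d') by (apply Rmult_le_compat_l; lra).
  assert (Rabs t * Rabs y <= Rabs t * d') by (apply Rmult_le_compat_l; lra).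
  assert (d' * (2 + Rabs s + Rabs t) <= r).
  { replace r with (r / (2 + Rabs s + Rabs t) * (2 + Rabs s + Rabs t)) by (field; lra).
    apply Rmult_le_compat_r; lra. }
  lra.
Qed.

(** For [k = 2, 3] these are the components of the field that [xiH] induces on the [(x, y)] plane
    through the jet; its linear part at the origin is [L] on the tangent plane, projected. *)
Lemma strict_composition (H : F4) (k : nat) (p q : F2) (s11 s12 s22 : R) :
  smooth4 H -> p 0 0 = 0 -> q 0 0 = 0 -> strict2 p s11 s12 -> strict2 q s12 s22 ->
  forall eps, 0 < eps -> exists d, 0 < d /\ forall x y x' y',
    Rabs x < d -> Rabs y < d -> Rabs x' < d -> Rabs y' < d ->
    Rabs (pd4 k H x' y' (p x' y') (q x' y') - pd4 k H x y (p x y) (q x y)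
          - d0 (pd4 k H) (tangent_lift s11 s12 s22 (x' - x) (y' - y)))
    <= eps * (Rabs (x' - x) + Rabs (y' - y)).
Proof.
  intros Hs p0 q0 Sp Sq eps He.
  destruct (compose_expansions (pd4 0 (pd4 k H) 0 0 0 0) (pd4 1 (pd4 k H) 0 0 0 0)
    (pd4 2 (pd4 k H) 0 0 0 0) (pd4 3 (pd4 k H) 0 0 0 0) s11 s12 s22 eps He) as [e [He0 E]].
  destruct (smooth_strict_diff H k 0 0 0 0 Hs e He0) as [r [Hr L]]. cbv zeta in L.
  destruct (Sp e He0) as [r1 [R1 L1]]. destruct (Sq e He0) as [r2 [R2 L2]].
  destruct (strict2_small p s11 s12 r Hr p0 Sp) as [r3 [R3 L3]].
  destruct (strict2_small q s12 s22 r Hr q0 Sq) as [r4 [R4' L4]].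
  set (d := Rmin r (Rmin (Rmin r1 r2) (Rmin r3 r4))).
  assert (Hd : 0 < d /\ d <= r /\ d <= r1 /\ d <= r2 /\ d <= r3 /\ d <= r4).
  { unfold d, Rmin. repeat destruct Rle_dec; lra. }
  exists d. split. lra. intros x y x' y' Hx Hy Hx' Hy'.
  unfold d0, tangent_lift; simpl c0; simpl c1; simpl c2; simpl c3.
  apply E with (u2 := p x' y' - p x y) (u3 := q x' y' - q x y).
  - apply L1; lra.
  - apply L2; lra.
  - assert (W : forall g, (forall x y, Rabs x < d -> Rabs y < d -> Rabs (g x y) < r) ->
      Rabs (g x y - 0) < r /\ Rabs (g x' y' - 0) < r).
    { intros g Hg. rewrite !Rminus_0_r. split; apply Hg; auto. }
    destruct (W p) as [P1 P2]. { intros; apply L3; lra. }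
    destruct (W q) as [Q1 Q2]. { intros; apply L4; lra. }
    destruct (W (fun x _ => x)) as [X1 X2]. { intros; lra. }
    destruct (W (fun _ y => y)) as [Y1 Y2]. { intros; lra. }
    apply L; auto.
Qed.

Lemma zero_of_small (Z C : R) : (forall e, 0 < e -> e <= 1 -> Rabs Z <= e * C) -> Z = 0.
Proof.
  intros HZ. apply NNPP. intros N. apply Rabs_pos_lt in N.
  assert (0 <= C). { specialize (HZ 1). pose proof (Rabs_pos Z). lra. }
  destruct (small_factor C (Rabs Z / 2)) as [e [He0 [He1 HeC]]]; try lra.
  specialize (HZ e He0 He1). lra.
Qed.

(** The factors [m1], [m2] will be second derivatives of [z], merely continuous, so the identity
    cannot be differentiated. But [H_p] and [H_q] vanish at the origin, hence only [m1 0 0] and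
    [m2 0 0] survive to first order along a ray. *)
Lemma linearized_identity (H : F4) (k : nat) (p q m1 m2 : F2) (s11 s12 s22 r : R) :
  smooth4 H -> (forall i, (i < 4)%nat -> pd4 i H 0 0 0 0 = 0) -> (k < 4)%nat ->
  p 0 0 = 0 -> q 0 0 = 0 -> strict2 p s11 s12 -> strict2 q s12 s22 ->
  cont2 m1 0 0 -> cont2 m2 0 0 -> 0 < r ->
  (forall x y, in_ball2 r x y -> pd4 k H x y (p x y) (q x y)
     + pd4 2 H x y (p x y) (q x y) * m1 x y + pd4 3 H x y (p x y) (q x y) * m2 x y = 0) ->
  forall x y, let v := tangent_lift s11 s12 s22 x y in
    d0 (pd4 k H) v + d0 (pd4 2 H) v * m1 0 0 + d0 (pd4 3 H) v * m2 0 0 = 0.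
Proof.
  intros Hs Hc Hk p0 q0 Sp Sq C1 C2 Hr Hid x y v.
  set (X := d0 (pd4 k H) v). set (Y := d0 (pd4 2 H) v). set (Z := d0 (pd4 3 H) v).
  set (N := Rabs x + Rabs y).
  pose proof (Rabs_pos x). pose proof (Rabs_pos y).
  (* The five summands bound, in this order, the five error terms of the decomposition below, after
     division by [s * e]. *)
  apply zero_of_small with (N + N * Rabs (m1 0 0) + N * Rabs (m2 0 0) + (Rabs Y + N) + (Rabs Z + N)).
  intros e He0 He1.
  assert (exp : forall j, (j < 4)%nat -> exists d, 0 < d /\ forall s, 0 < s -> s * (N + 1) < d ->
    Rabs (pd4 j H (s * x) (s * y) (p (s * x) (s * y)) (q (s * x) (s * y)) - s * d0 (pd4 j H) v) <= e * (s * N)).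
  { intros j Hj. destruct (strict_composition H j p q s11 s12 s22 Hs p0 q0 Sp Sq e He0) as [d [Hd L]].
    exists d. split; auto. intros s Hs0 Hsd.
    specialize (L 0 0 (s * x) (s * y)). rewrite Rabs_R0, p0, q0, (Hc j Hj), !Rminus_0_r in L.
    rewrite !Rabs_mult, (Rabs_pos_eq s) in L by lra.
    replace (s * N) with (s * Rabs x + s * Rabs y) by (unfold N; ring).
    replace (s * d0 (pd4 j H) v) with (d0 (pd4 j H) (tangent_lift s11 s12 s22 (s * x) (s * y))).
    2:{ unfold d0, v, tangent_lift; simpl. ring. }
    assert (0 <= s * Rabs x) by (apply Rmult_le_pos; lra).
    assert (0 <= s * Rabs y) by (apply Rmult_le_pos; lra).
    apply L; unfold N in Hsd; lra. }
  destruct (exp k Hk) as [r1 [R1 L1]]. destruct (exp 2%nat) as [r2 [R2 L2]]. lia.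
  destruct (exp 3%nat) as [r3 [R3 L3]]. lia.
  destruct (C1 e He0) as [r4 [R4' L4]]. destruct (C2 e He0) as [r5 [R5 L5]].
  set (d := Rmin r (Rmin r1 (Rmin (Rmin r2 r3) (Rmin r4 r5)))).
  assert (Hd : 0 < d /\ d <= r /\ d <= r1 /\ d <= r2 /\ d <= r3 /\ d <= r4 /\ d <= r5).
  { unfold d, Rmin. repeat destruct Rle_dec; lra. }
  assert (HN : 0 <= N) by (unfold N; lra).
  set (s := d / (2 * (N + 1))).
  assert (Hs0 : 0 < s) by (apply Rdiv_lt_0_compat; lra).
  assert (Hsd : s * (N + 1) = d / 2) by (unfold s; field; lra).
  assert (0 <= s * Rabs x) by (apply Rmult_le_pos; lra).
  assert (0 <= s * Rabs y) by (apply Rmult_le_pos; lra).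
  assert (Bx : Rabs (s * x) < d /\ Rabs (s * y) < d).
  { rewrite !Rabs_mult, (Rabs_pos_eq s) by lra. unfold N in Hsd. lra. }
  specialize (L1 s Hs0). specialize (L2 s Hs0). specialize (L3 s Hs0).
  specialize (L4 (s * x) (s * y)). specialize (L5 (s * x) (s * y)). rewrite !Rminus_0_r in L4, L5.
  assert (M1 := L1 ltac:(lra)). assert (M2 := L2 ltac:(lra)). assert (M3 := L3 ltac:(lra)).
  assert (M4 := L4 ltac:(lra) ltac:(lra)). assert (M5 := L5 ltac:(lra) ltac:(lra)).
  specialize (Hid (s * x) (s * y)). lapply Hid; [clear Hid; intros Hid | split; lra].
  clear L1 L2 L3 L4 L5.
  fold X in M1. fold Y in M2. fold Z in M3.
  set (gx := pd4 k H (s * x) (s * y) (p (s * x) (s * y)) (q (s * x) (s * y))) in *.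
  set (gp := pd4 2 H (s * x) (s * y) (p (s * x) (s * y)) (q (s * x) (s * y))) in *.
  set (gq := pd4 3 H (s * x) (s * y) (p (s * x) (s * y)) (q (s * x) (s * y))) in *.
  set (n1 := m1 (s * x) (s * y)) in *. set (n2 := m2 (s * x) (s * y)) in *.
  assert (sN : 0 <= s * N) by (apply Rmult_le_pos; lra).
  assert (growth : forall g W, Rabs (g - s * W) <= e * (s * N) -> Rabs g <= s * (Rabs W + N)).
  { intros g W HgW. pose proof (Rabs_triang (g - s * W) (s * W)) as T.
    replace (g - s * W + s * W) with g in T by ring.
    rewrite (Rabs_mult s W), (Rabs_pos_eq s) in T by lra.
    assert (e * (s * N) <= 1 * (s * N)) by (apply Rmult_le_compat_r; auto). lra. }
  pose proof (growth _ _ M2) as G2. pose proof (growth _ _ M3) as G3.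
  apply Rmult_le_reg_l with s; auto.
  rewrite <- (Rabs_pos_eq s) at 1 by lra. rewrite <- Rabs_mult.
  (* Subtract the identity [Hid] at the point [s (x, y)] and split each product into the error of
     its first factor and the variation of its second. *)
  replace (s * (X + Y * m1 0 0 + Z * m2 0 0)) with
    (- ((gx - s * X) + (gp - s * Y) * m1 0 0 + (gq - s * Z) * m2 0 0
        + gp * (n1 - m1 0 0) + gq * (n2 - m2 0 0))) by (ring_simplify; lra).
  rewrite Rabs_Ropp.
  assert (P1 : Rabs ((gp - s * Y) * m1 0 0) <= e * (s * N) * Rabs (m1 0 0)).
  { rewrite Rabs_mult. apply Rmult_le_compat_r; auto. apply Rabs_pos. }
  assert (P2 : Rabs ((gq - s * Z) * m2 0 0) <= e * (s * N) * Rabs (m2 0 0)).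
  { rewrite Rabs_mult. apply Rmult_le_compat_r; auto. apply Rabs_pos. }
  assert (P3 : Rabs (gp * (n1 - m1 0 0)) <= s * (Rabs Y + N) * e).
  { rewrite Rabs_mult. apply Rmult_le_compat; try apply Rabs_pos; lra. }
  assert (P4 : Rabs (gq * (n2 - m2 0 0)) <= s * (Rabs Z + N) * e).
  { rewrite Rabs_mult. apply Rmult_le_compat; try apply Rabs_pos; lra. }
  apply Rabs_le_between in M1. apply Rabs_le_between in P1. apply Rabs_le_between in P2.
  apply Rabs_le_between in P3. apply Rabs_le_between in P4. apply Rabs_le_between. lra.
Qed.

(* Differentiate [H (x, y, z_x, z_y) = 0] in [x] and in [y], and linearize at the origin. *)
Lemma jet_plane_invariant (H : F4) (z : F2) (r : R) :
  smooth4 H -> (forall i, (i < 4)%nat -> pd4 i H 0 0 0 0 = 0) ->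
  0 < r -> C2_on r z -> solves_on H r z -> zx z 0 0 = 0 -> zy z 0 0 = 0 ->
  let tl := tangent_lift (pd2 0 (zx z) 0 0) (pd2 1 (zx z) 0 0) (pd2 1 (zy z) 0 0) in
  forall x y, linL H (tl x y) = tl (d0 (pd4 2 H) (tl x y)) (d0 (pd4 3 H) (tl x y)).
Proof.
  intros Hs Hc Hr HC Hsol z10 z01 tl x y.
  pose proof (C2_schwarz z r Hr HC) as Sch.
  pose proof (C2_strict_gradient z r 0 Hr HC) as Sp.
  pose proof (C2_strict_gradient z r 1 Hr HC) as Sq. rewrite Sch in Sq.
  assert (B0 : in_ball2 r 0 0) by (unfold in_ball2; rewrite Rabs_R0; lra).
  assert (cont : forall i j, cont2 (pd2 i (pd2 j z)) 0 0).
  { intros i j. apply (HC 0 0 B0 (i :: j :: nil)). simpl; lia. }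
  assert (nearby : forall u c, Rabs c < r -> Rabs u < r - Rabs c -> Rabs (c + u) < r).
  { intros u c Hc' Hu. pose proof (Rabs_triang c u). lra. }
  assert (D0 : forall i j x y, in_ball2 r x y -> ex_pd2 i (pd2 j z) x y).
  { intros i j x' y' B. apply (HC x' y' B (j :: nil)); simpl; lia. }
  assert (locally_zero : forall (f : R -> R) t, Rabs t < r -> (forall s, Rabs s < r -> f s = 0) ->
    is_derive f t 0).
  { intros f t Ht Hf. apply (is_derive_ext_loc (fun _ => 0)).
    - exists (mkposreal (r - Rabs t) ltac:(simpl; lra)). intros u Hu.
      symmetry. apply Hf. replace u with (t + (u - t)) by ring. apply nearby; auto.
    - apply (is_derive_const 0 t). }
  assert (Ix : forall x y, in_ball2 r x y -> pd4 0 H x y (zx z x y) (zy z x y)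
     + pd4 2 H x y (zx z x y) (zy z x y) * pd2 0 (zx z) x y
     + pd4 3 H x y (zx z x y) (zy z x y) * pd2 0 (zy z) x y = 0).
  { intros x' y' [Bx By].
    assert (Z : is_derive (fun t => H t y' (zx z t y') (zy z t y')) x' 0).
    { apply locally_zero; auto. intros t Ht. apply Hsol. split; auto. }
    pose proof (is_derive_comp4 H (fun t => t) (fun _ => y') (fun t => zx z t y') (fun t => zy z t y')
      x' 1 0 (pd2 0 (zx z) x' y') (pd2 0 (zy z) x' y') Hs (is_derive_id x') (is_derive_const y' x')
      (Derive_correct _ _ (D0 0%nat 0%nat x' y' (conj Bx By)))
      (Derive_correct _ _ (D0 0%nat 1%nat x' y' (conj Bx By)))) as W.
    apply is_derive_unique in Z. apply is_derive_unique in W.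
    rewrite Z in W. lra. }
  assert (Iy : forall x y, in_ball2 r x y -> pd4 1 H x y (zx z x y) (zy z x y)
     + pd4 2 H x y (zx z x y) (zy z x y) * pd2 1 (zx z) x y
     + pd4 3 H x y (zx z x y) (zy z x y) * pd2 1 (zy z) x y = 0).
  { intros x' y' [Bx By].
    assert (Z : is_derive (fun t => H x' t (zx z x' t) (zy z x' t)) y' 0).
    { apply locally_zero; auto. intros t Ht. apply Hsol. split; auto. }
    pose proof (is_derive_comp4 H (fun _ => x') (fun t => t) (fun t => zx z x' t) (fun t => zy z x' t)
      y' 0 1 (pd2 1 (zx z) x' y') (pd2 1 (zy z) x' y') Hs (is_derive_const x' y') (is_derive_id y')
      (Derive_correct _ _ (D0 1%nat 0%nat x' y' (conj Bx By)))
      (Derive_correct _ _ (D0 1%nat 1%nat x' y' (conj Bx By)))) as W.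
    apply is_derive_unique in Z. apply is_derive_unique in W.
    rewrite Z in W. lra. }
  (* The first two components of the claim hold by definition of the lift; [Jx] and [Jy] supply the
     two momentum components. *)
  pose proof (linearized_identity H 0 (zx z) (zy z) (pd2 0 (zx z)) (pd2 0 (zy z)) _ _ _ r Hs Hc
    ltac:(lia) z10 z01 Sp Sq (cont _ _) (cont _ _) Hr Ix x y) as Jx.
  pose proof (linearized_identity H 1 (zx z) (zy z) (pd2 1 (zx z)) (pd2 1 (zy z)) _ _ _ r Hs Hc
    ltac:(lia) z10 z01 Sp Sq (cont _ _) (cont _ _) Hr Iy x y) as Jy.
  cbv zeta in Jx, Jy. change (pd2 0 (zy z) 0 0) with (pd2 0 (pd2 1 z) 0 0) in Jx.
  rewrite Sch in Jx.
  change (pd2 0 (pd2 0 z) 0 0) with (pd2 0 (zx z) 0 0) in Jx, Jy.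
  change (pd2 1 (pd2 0 z) 0 0) with (pd2 1 (zx z) 0 0) in Jx, Jy.
  change (pd2 1 (pd2 1 z) 0 0) with (pd2 1 (zy z) 0 0) in Jx, Jy.
  fold tl in Jx, Jy. unfold linL. unfold tl at 5. unfold tangent_lift. f_equal; lra.
Qed.

(** * Eigenvalues of the same sign *)

Lemma coordinates_bound (al be ga de : R) :
  al * de - be * ga <> 0 -> exists C, 0 < C /\ forall x y,
    Rabs x + Rabs y <= C * (Rabs (al * x + be * y) + Rabs (ga * x + de * y)).
Proof.
  intros HD. set (D := al * de - be * ga) in *.
  set (G := Rabs al + Rabs be + Rabs ga + Rabs de).
  pose proof (Rabs_pos al). pose proof (Rabs_pos be). pose proof (Rabs_pos ga). pose proof (Rabs_pos de).
  assert (PD : 0 < Rabs D) by now apply Rabs_pos_lt.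
  exists ((2 * G + 1) / Rabs D). split. apply Rdiv_lt_0_compat; unfold G; lra.
  intros x y. set (xi := al * x + be * y). set (eta := ga * x + de * y).
  apply Rmult_le_reg_l with (Rabs D); auto.
  replace (Rabs D * ((2 * G + 1) / Rabs D * (Rabs xi + Rabs eta)))
    with ((2 * G + 1) * (Rabs xi + Rabs eta)) by (field; lra).
  rewrite Rmult_plus_distr_l, <- !Rabs_mult.
  replace (D * x) with (de * xi + - be * eta) by (unfold D, xi, eta; ring).
  replace (D * y) with (- ga * xi + al * eta) by (unfold D, xi, eta; ring).
  pose proof (Rabs_triang (de * xi) (- be * eta)) as T1.
  pose proof (Rabs_triang (- ga * xi) (al * eta)) as T2.
  rewrite !Rabs_mult, !Rabs_Ropp in T1, T2.
  pose proof (Rabs_pos xi). pose proof (Rabs_pos eta).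
  assert (M : forall c, c <= G -> c * Rabs xi <= G * Rabs xi /\ c * Rabs eta <= G * Rabs eta).
  { intros c Hc. split; apply Rmult_le_compat_r; auto. }
  destruct (M (Rabs al)) as [_ ?]. unfold G; lra.
  destruct (M (Rabs be)) as [_ ?]. unfold G; lra.
  destruct (M (Rabs ga)) as [? _]. unfold G; lra.
  destruct (M (Rabs de)) as [? _]. unfold G; lra.
  assert (0 <= G * Rabs xi) by (apply Rmult_le_pos; unfold G; lra).
  assert (0 <= G * Rabs eta) by (apply Rmult_le_pos; unfold G; lra).
  lra.
Qed.

(** Converts an error measured by [n = |x| + |y|] into the diagonalizing coordinates; shared by the
    node and the saddle. [C] comes from [coordinates_bound] and [G] bounds the coefficients of the
    functionals. *)
Lemma functional_error (G C eps k sg s t u v xi eta n : R) :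
  Rabs sg = 1 -> 0 <= eps -> 0 <= n -> Rabs s + Rabs t <= G -> eps * (G * C) <= k ->
  n <= C * (Rabs xi + Rabs eta) -> Rabs u <= eps * n -> Rabs v <= eps * n ->
  Rabs (sg * (s * u + t * v)) <= k * (Rabs xi + Rabs eta).
Proof.
  intros Hsg He Hn Hst Hk N Hu Hv.
  rewrite Rabs_mult, Hsg, Rmult_1_l.
  pose proof (Rabs_triang (s * u) (t * v)) as T. rewrite !Rabs_mult in T.
  pose proof (Rabs_pos s). pose proof (Rabs_pos t).
  pose proof (Rabs_pos xi). pose proof (Rabs_pos eta).
  assert (Rabs s * Rabs u <= Rabs s * (eps * n)) by (apply Rmult_le_compat_l; auto).
  assert (Rabs t * Rabs v <= Rabs t * (eps * n)) by (apply Rmult_le_compat_l; auto).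
  assert ((Rabs s + Rabs t) * (eps * n) <= G * (eps * n)).
  { apply Rmult_le_compat_r; auto. apply Rmult_le_pos; lra. }
  assert (G * eps * n <= G * eps * (C * (Rabs xi + Rabs eta))).
  { apply Rmult_le_compat_l; auto. apply Rmult_le_pos; lra. }
  assert (eps * (G * C) * (Rabs xi + Rabs eta) <= k * (Rabs xi + Rabs eta)).
  { apply Rmult_le_compat_r; lra. }
  lra.
Qed.

Lemma C2_differentiable (f : F2) (r x y : R) :
  C2_on r f -> in_ball2 r x y -> differentiable_pt_lim f x y (zx f x y) (zy f x y).
Proof.
  intros HC [Bx By] eps.
  pose proof (cond_pos eps) as He.
  assert (near : forall c u, Rabs c < r -> Rabs (u - c) < r - Rabs c -> Rabs u < r).
  { intros c u Hc' Hu. pose proof (Rabs_triang (u - c) c) as T.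
    replace (u - c + c) with u in T by ring. lra. }
  destruct (strict_diff2 f x y (Rmin (r - Rabs x) (r - Rabs y))) with (eps := eps / 2)
    as [d [Hd L]]; try lra.
  - apply Rmin_glb_lt; lra.
  - intros i x' y' Hx Hy.
    pose proof (Rmin_l (r - Rabs x) (r - Rabs y)). pose proof (Rmin_r (r - Rabs x) (r - Rabs y)).
    assert (B : in_ball2 r x' y') by (split; [apply (near x) | apply (near y)]; lra).
    apply (HC x' y' B nil); simpl; lia.
  - intros i. apply (HC x y (conj Bx By) (i :: nil)). simpl; lia.
  - exists (mkposreal d Hd). intros u v Hu Hv. simpl in Hu, Hv.
    assert (Z : forall c, Rabs (c - c) < d) by (intros; rewrite Rminus_diag, Rabs_R0; auto).
    eapply Rle_trans. apply (L x y u v); auto.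
    pose proof (Rmax_l (Rabs (u - x)) (Rabs (v - y))). pose proof (Rmax_r (Rabs (u - x)) (Rabs (v - y))).
    assert (eps / 2 * (Rabs (u - x) + Rabs (v - y)) <= eps / 2 * (2 * Rmax (Rabs (u - x)) (Rabs (v - y)))).
    { apply Rmult_le_compat_l; lra. }
    lra.
Qed.

Lemma differentiable_pt_lim_diff (f g : F2) (x y f1 f2 g1 g2 : R) :
  differentiable_pt_lim f x y f1 f2 -> differentiable_pt_lim g x y g1 g2 ->
  differentiable_pt_lim (fun u v => f u v - g u v) x y (f1 - g1) (f2 - g2).
Proof.
  intros Df Dg eps.
  assert (He : 0 < eps / 2) by (pose proof (cond_pos eps); lra).
  destruct (Df (mkposreal _ He)) as [d1 L1]. destruct (Dg (mkposreal _ He)) as [d2 L2].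
  exists (mkposreal (Rmin d1 d2) (Rmin_stable_in_posreal d1 d2)). intros u v Hu Hv. simpl in *.
  pose proof (Rmin_l d1 d2). pose proof (Rmin_r d1 d2).
  assert (A1 := L1 u v ltac:(lra) ltac:(lra)). assert (A2 := L2 u v ltac:(lra) ltac:(lra)).
  apply Rabs_le_between in A1. apply Rabs_le_between in A2. apply Rabs_le_between. lra.
Qed.

Lemma differentiable_pt_lim_linear (s t x y : R) :
  differentiable_pt_lim (fun u v => s * u + t * v) x y s t.
Proof.
  intros eps. exists (mkposreal 1 Rlt_0_1). intros u v _ _.
  replace (s * u + t * v - (s * x + t * y) - (s * (u - x) + t * (v - y))) with 0 by ring.
  rewrite Rabs_R0. apply Rmult_le_pos. left; apply cond_pos.
  eapply Rle_trans. apply Rabs_pos. apply Rmax_l.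
Qed.

Lemma differentiable_pt_lim_partials (f : F2) (x y f1 f2 : R) :
  differentiable_pt_lim f x y f1 f2 ->
  continuity_2d_pt f x y /\ is_derive (fun t => f t y) x f1 /\ is_derive (fun t => f x t) y f2.
Proof.
  intros D. split; [|split].
  - apply differentiable_continuity_pt. now exists f1, f2.
  - apply is_derive_Reals. replace f1 with (f1 * 1 + f2 * 0) by ring.
    apply (derivable_pt_lim_comp_2d f (fun t => t) (fun _ => y)); auto.
    apply derivable_pt_lim_id. apply derivable_pt_lim_const.
  - apply is_derive_Reals. replace f2 with (f1 * 0 + f2 * 1) by ring.
    apply (derivable_pt_lim_comp_2d f (fun _ => x) (fun t => t)); auto.
    apply derivable_pt_lim_const. apply derivable_pt_lim_id.
Qed.

Lemma between_close (c e a b t : R) :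
  Rabs (a - c) <= e -> Rabs (b - c) <= e -> Rmin a b <= t <= Rmax a b -> Rabs (t - c) <= e.
Proof.
  intros Ha Hb Ht. apply Rabs_le_between in Ha. apply Rabs_le_between in Hb. apply Rabs_le_between.
  unfold Rmin, Rmax in Ht. destruct (Rle_dec a b); lra.
Qed.

(* By the mean value theorem in [p] and [q], the difference of two solutions solves a
   linear homogeneous first-order equation. *)
Lemma difference_pde (H : F4) (z zt : F2) (s11 s12 s22 r : R) :
  smooth4 H -> (forall i, (i < 4)%nat -> pd4 i H 0 0 0 0 = 0) -> 0 < r ->
  solves_on H r z -> solves_on H r zt ->
  zx z 0 0 = 0 -> zy z 0 0 = 0 -> zx zt 0 0 = 0 -> zy zt 0 0 = 0 ->
  strict2 (zx z) s11 s12 -> strict2 (zy z) s12 s22 ->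
  strict2 (zx zt) s11 s12 -> strict2 (zy zt) s12 s22 ->
  forall eps, 0 < eps -> exists d, 0 < d /\ forall x y, in_ball2 d x y -> exists Bx By,
    Bx * (zx zt x y - zx z x y) + By * (zy zt x y - zy z x y) = 0 /\
    Rabs (Bx - d0 (pd4 2 H) (tangent_lift s11 s12 s22 x y)) <= eps * (Rabs x + Rabs y) /\
    Rabs (By - d0 (pd4 3 H) (tangent_lift s11 s12 s22 x y)) <= eps * (Rabs x + Rabs y).
Proof.
  intros Hs Hc Hr Sz St z10 z01 t10 t01 Sp Sq Tp Tq eps He.
  (* Here the tangency of the jets enters: both gradients have the same linear part, so every value
     between them has it too, and the mean value points do not affect the linear part of [B]. *)
  assert (point : forall k, (k < 4)%nat -> exists d, 0 < d /\ forall x y p q, in_ball2 d x y ->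
    Rmin (zx z x y) (zx zt x y) <= p <= Rmax (zx z x y) (zx zt x y) ->
    Rmin (zy z x y) (zy zt x y) <= q <= Rmax (zy z x y) (zy zt x y) ->
    Rabs (pd4 k H x y p q - d0 (pd4 k H) (tangent_lift s11 s12 s22 x y)) <= eps * (Rabs x + Rabs y)).
  { intros k Hk.
    destruct (compose_expansions (pd4 0 (pd4 k H) 0 0 0 0) (pd4 1 (pd4 k H) 0 0 0 0)
      (pd4 2 (pd4 k H) 0 0 0 0) (pd4 3 (pd4 k H) 0 0 0 0) s11 s12 s22 eps He) as [e [He0 E]].
    destruct (smooth_strict_diff H k 0 0 0 0 Hs e He0) as [r0 [R0 L]]. cbv zeta in L.
    assert (good : forall g s t, g 0 0 = 0 -> strict2 g s t -> exists d, 0 < d /\ forall x y,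
      Rabs x < d -> Rabs y < d -> Rabs (g x y) < r0 /\
      Rabs (g x y - (s * x + t * y)) <= e * (Rabs x + Rabs y)).
    { intros g s t g0 Sg.
      destruct (strict2_small g s t r0 R0 g0 Sg) as [d1 [D1 L1]]. destruct (Sg e He0) as [d2 [D2 L2]].
      exists (Rmin d1 d2). split. now apply Rmin_glb_lt. intros x y Hx Hy.
      pose proof (Rmin_l d1 d2). pose proof (Rmin_r d1 d2).
      specialize (L2 0 0 x y). rewrite Rabs_R0, g0, !Rminus_0_r in L2.
      split. apply L1; lra. apply L2; lra. }
    destruct (good _ _ _ z10 Sp) as [d1 [D1 L1]]. destruct (good _ _ _ z01 Sq) as [d2 [D2 L2]].
    destruct (good _ _ _ t10 Tp) as [d3 [D3 L3]]. destruct (good _ _ _ t01 Tq) as [d4 [D4 L4]].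
    set (d := Rmin r0 (Rmin (Rmin d1 d2) (Rmin d3 d4))).
    assert (Hd : 0 < d /\ d <= r0 /\ d <= d1 /\ d <= d2 /\ d <= d3 /\ d <= d4).
    { unfold d, Rmin. repeat destruct Rle_dec; lra. }
    exists d. split. lra. intros x y p q [Hx Hy] Hp Hq.
    destruct (L1 x y) as [P1 P1']; try lra. destruct (L2 x y) as [Q1 Q1']; try lra.
    destruct (L3 x y) as [P2 P2']; try lra. destruct (L4 x y) as [Q2 Q2']; try lra.
    unfold d0, tangent_lift; simpl c0; simpl c1; simpl c2; simpl c3.
    apply E with (u2 := p) (u3 := q).
    - apply (between_close _ _ (zx z x y) (zx zt x y)); auto.
    - apply (between_close _ _ (zy z x y) (zy zt x y)); auto.
    - specialize (L 0 0 0 0 x y p q). rewrite (Hc k Hk), !Rminus_0_r, Rabs_R0 in L.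
      apply L; try lra.
      + rewrite <- (Rminus_0_r p). apply (between_near _ _ (zx z x y) (zx zt x y)); auto; rewrite Rminus_0_r; lra.
      + rewrite <- (Rminus_0_r q). apply (between_near _ _ (zy z x y) (zy zt x y)); auto; rewrite Rminus_0_r; lra. }
  destruct (point 2%nat) as [d2 [D2 L2]]. lia. destruct (point 3%nat) as [d3 [D3 L3]]. lia.
  set (d := Rmin r (Rmin d2 d3)).
  assert (Hd : 0 < d /\ d <= r /\ d <= d2 /\ d <= d3).
  { unfold d, Rmin. repeat destruct Rle_dec; lra. }
  exists d. split. lra. intros x y [Hx Hy].
  assert (cd : forall (f : R -> R) t, (forall t, ex_derive f t) -> continuity_pt f t).
  { intros f t Hf. apply continuity_pt_filterlim. now apply (ex_derive_continuous f t). }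
  (* The path between the two gradients changes one component at a time, through the corner
     [(zx z, zy zt)]. *)
  destruct (MVT_gen (fun t => H x y t (zy zt x y)) (zx z x y) (zx zt x y) (fun t => pd4 2 H x y t (zy zt x y)))
    as [p [Hp Ep]].
  { intros t _. apply Derive_correct. apply (Hs nil) with (i := 2%nat). }
  { intros t _. apply (cd (fun t => H x y t (zy zt x y))).
    intros t'. apply (proj2 (Hs nil) 2%nat x y t' (zy zt x y)). }
  destruct (MVT_gen (fun t => H x y (zx z x y) t) (zy z x y) (zy zt x y) (fun t => pd4 3 H x y (zx z x y) t))
    as [q [Hq Eq]].
  { intros t _. apply Derive_correct. apply (Hs nil) with (i := 3%nat). }
  { intros t _. apply (cd (fun t => H x y (zx z x y) t)).
    intros t'. apply (proj2 (Hs nil) 3%nat x y (zx z x y) t'). }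
  exists (pd4 2 H x y p (zy zt x y)), (pd4 3 H x y (zx z x y) q).
  split; [|split].
  - rewrite <- Ep, <- Eq. rewrite (Sz x y), (St x y) by (split; lra). ring.
  - apply L2; auto. split; lra. split; [apply Rmin_r | apply Rmax_r].
  - apply L3; auto. split; lra. split; [apply Rmin_l | apply Rmax_l].
Qed.

(** The sign [- sg] turns the field inward in the diagonalizing coordinates, as the maximum
    principle requires. The hypotheses are symmetric in the two solutions, so one inequality
    suffices. *)
Lemma node_comparison (H : F4) (z zt : F2) (s11 s12 s22 r al be ga de l m sg : R) :
  let A k x y := d0 (pd4 k H) (tangent_lift s11 s12 s22 x y) in
  smooth4 H -> (forall i, (i < 4)%nat -> pd4 i H 0 0 0 0 = 0) -> 0 < r ->
  C2_on r z -> C2_on r zt -> solves_on H r z -> solves_on H r zt ->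
  z 0 0 = 0 -> zx z 0 0 = 0 -> zy z 0 0 = 0 -> zt 0 0 = 0 -> zx zt 0 0 = 0 -> zy zt 0 0 = 0 ->
  strict2 (zx z) s11 s12 -> strict2 (zy z) s12 s22 ->
  strict2 (zx zt) s11 s12 -> strict2 (zy zt) s12 s22 ->
  al * de - be * ga <> 0 ->
  (forall x y, al * A 2%nat x y + be * A 3%nat x y = l * (al * x + be * y) /\
               ga * A 2%nat x y + de * A 3%nat x y = m * (ga * x + de * y)) ->
  0 < sg * l -> 0 < sg * m -> (sg = 1 \/ sg = -1) ->
  exists delta, 0 < delta /\ forall x y, in_ball2 delta x y -> zt x y <= z x y.
Proof.
  intros A Hs Hc Hr Cz Ct Sz St z00 z10 z01 t00 t10 t01 Sp Sq Tp Tq HD HA Hl Hm Hsg.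
  set (D := al * de - be * ga) in *.
  destruct (coordinates_bound al be ga de HD) as [C [HC Cb]].
  set (G := Rabs al + Rabs be + Rabs ga + Rabs de).
  assert (PG : 0 <= G).
  { unfold G. pose proof (Rabs_pos al). pose proof (Rabs_pos be).
    pose proof (Rabs_pos ga). pose proof (Rabs_pos de). lra. }
  set (k := Rmin (sg * l) (sg * m) / 4).
  assert (Hk : 0 < k /\ 2 * k < sg * l /\ 2 * k < sg * m).
  { unfold k, Rmin. destruct Rle_dec; lra. }
  destruct (small_factor (G * C) k) as [eps [He0 [_ HeC]]]. { apply Rmult_le_pos; lra. } lra.
  destruct (difference_pde H z zt s11 s12 s22 r Hs Hc Hr Sz St z10 z01 t10 t01 Sp Sq Tp Tq eps He0)
    as [d [Hd PDE]].
  assert (Asg : Rabs (- sg) = 1).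
  { rewrite Rabs_Ropp. destruct Hsg as [-> | ->]; [apply Rabs_R1 | rewrite Rabs_left; lra]. }
  (* By [Cb] the box of half-width [rho] then maps into the ball of radius [Rmin d r / 2]. *)
  set (rho := Rmin d r / (4 * C)).
  assert (Hdr : 0 < Rmin d r) by now apply Rmin_glb_lt.
  assert (Hrho : 0 < rho) by (apply Rdiv_lt_0_compat; lra).
  set (X := fun xi eta => de / D * xi + - be / D * eta).
  set (Y := fun xi eta => - ga / D * xi + al / D * eta).
  assert (XY1 : forall xi eta, al * X xi eta + be * Y xi eta = xi).
  { intros. unfold X, Y, D. field. exact HD. }
  assert (XY2 : forall xi eta, ga * X xi eta + de * Y xi eta = eta).
  { intros. unfold X, Y, D. field. exact HD. }
  assert (box : forall xi eta, -rho <= xi <= rho -> -rho <= eta <= rho ->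
    in_ball2 (Rmin d r) (X xi eta) (Y xi eta)).
  { intros xi eta H1 H2. pose proof (Cb (X xi eta) (Y xi eta)) as N. rewrite XY1, XY2 in N.
    apply Rabs_le in H1. apply Rabs_le in H2.
    assert (C * (Rabs xi + Rabs eta) <= C * (2 * rho)) by (apply Rmult_le_compat_l; lra).
    assert (C * (2 * rho) = Rmin d r / 2) by (unfold rho; field; lra).
    pose proof (Rabs_pos (X xi eta)). pose proof (Rabs_pos (Y xi eta)). split; lra. }
  assert (main : forall xi eta, -rho <= xi <= rho -> -rho <= eta <= rho ->
    zt (X xi eta) (Y xi eta) - z (X xi eta) (Y xi eta) <= 0).
  { apply (inward_field_max_principle (fun xi eta => zt (X xi eta) (Y xi eta) - z (X xi eta) (Y xi eta))
      rho (sg * l) (sg * m) k); try lra.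
    { unfold X, Y. rewrite !Rmult_0_r, Rplus_0_r, z00, t00. ring. }
    intros xi eta H1 H2. pose proof (box xi eta H1 H2) as [Bx By].
    pose proof (Rmin_l d r). pose proof (Rmin_r d r).
    pose proof (Cb (X xi eta) (Y xi eta)) as N. rewrite XY1, XY2 in N.
    pose proof (XY1 xi eta) as E1. pose proof (XY2 xi eta) as E2.
    set (x := X xi eta) in *. set (y := Y xi eta) in *.
    assert (Br : in_ball2 r x y) by (split; lra).
    set (ux := zx zt x y - zx z x y). set (uy := zy zt x y - zy z x y).
    pose proof (differentiable_pt_lim_diff zt z x y _ _ _ _
      (C2_differentiable zt r x y Ct Br) (C2_differentiable z r x y Cz Br)) as Du.
    fold ux uy in Du.
    pose proof (differentiable_pt_lim_comp _ X Y xi eta _ _ _ _ _ _ Du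
      (differentiable_pt_lim_linear _ _ _ _) (differentiable_pt_lim_linear _ _ _ _)) as DU.
    cbv beta in DU. apply differentiable_pt_lim_partials in DU. destruct DU as [CU [D1 D2]].
    split; [exact CU|].
    destruct (PDE x y) as [b1 [b2 [P0 [P1 P2]]]]. split; lra. fold ux uy in P0.
    eexists _, _, (- sg * (al * b1 + be * b2)), (- sg * (ga * b1 + de * b2)).
    split; [exact D1|]. split; [exact D2|]. split; [|split].
    - transitivity (- sg * (b1 * ux + b2 * uy)). unfold D. field. exact HD. rewrite P0. ring.
    - fold (A 2%nat x y) in P1. fold (A 3%nat x y) in P2.
      destruct (HA x y) as [E _]. rewrite E1 in E.
      replace (- sg * (al * b1 + be * b2) + sg * l * xi)
        with (- sg * (al * (b1 - A 2%nat x y) + be * (b2 - A 3%nat x y)))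
        by (rewrite Rmult_assoc, <- E; ring).
      pose proof (Rabs_pos x). pose proof (Rabs_pos y).
      apply (functional_error G C eps) with (n := Rabs x + Rabs y); auto; try lra. unfold G. pose proof (Rabs_pos ga). pose proof (Rabs_pos de). lra.
    - fold (A 2%nat x y) in P1. fold (A 3%nat x y) in P2.
      destruct (HA x y) as [_ E]. rewrite E2 in E.
      replace (- sg * (ga * b1 + de * b2) + sg * m * eta)
        with (- sg * (ga * (b1 - A 2%nat x y) + de * (b2 - A 3%nat x y)))
        by (rewrite Rmult_assoc, <- E; ring).
      pose proof (Rabs_pos x). pose proof (Rabs_pos y).
      apply (functional_error G C eps) with (n := Rabs x + Rabs y); auto; try lra. unfold G. pose proof (Rabs_pos al). pose proof (Rabs_pos be). lra. }
  set (G' := G + 1).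
  exists (rho / G'). split. { apply Rdiv_lt_0_compat; unfold G'; lra. }
  intros x y [Hx Hy].
  assert (small : forall s t, Rabs s + Rabs t <= G -> -rho <= s * x + t * y <= rho).
  { intros s t Hst. apply Rabs_le_between.
    pose proof (Rabs_triang (s * x) (t * y)) as T. rewrite !Rabs_mult in T.
    pose proof (Rabs_pos s). pose proof (Rabs_pos t).
    assert (Rabs s * Rabs x <= Rabs s * (rho / G')) by (apply Rmult_le_compat_l; lra).
    assert (Rabs t * Rabs y <= Rabs t * (rho / G')) by (apply Rmult_le_compat_l; lra).
    assert (0 < rho / G') by (apply Rdiv_lt_0_compat; unfold G'; lra).
    assert ((Rabs s + Rabs t) * (rho / G') <= G' * (rho / G')).
    { apply Rmult_le_compat_r. lra. unfold G'. lra. }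
    assert (G' * (rho / G') = rho). { field. unfold G'. lra. } lra. }
  assert (M := main (al * x + be * y) (ga * x + de * y)).
  replace (X (al * x + be * y) (ga * x + de * y)) with x in M by (unfold X, D; field; exact HD).
  replace (Y (al * x + be * y) (ga * x + de * y)) with y in M by (unfold Y, D; field; exact HD).
  pose proof (Rabs_pos al). pose proof (Rabs_pos be). pose proof (Rabs_pos ga). pose proof (Rabs_pos de).
  lapply M; [clear M; intros M | apply small; unfold G; lra].
  lapply M; [clear M; intros M | apply small; unfold G; lra].
  lra.
Qed.

(** * Eigenvalues of opposite signs *)

Lemma intermediate_value (f : R -> R) (a b v : R) :
  a <= b -> (forall t, a <= t <= b -> continuity_pt f t) ->
  f a <= v <= f b \/ f b <= v <= f a -> exists c, a <= c <= b /\ f c = v.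
Proof.
  intros Hab Hc Hv.
  destruct (Req_dec (f a) v) as [E|Na]. exists a; split; auto; lra.
  destruct (Req_dec (f b) v) as [E|Nb]. exists b; split; auto; lra.
  assert (a < b). { destruct (Req_dec a b) as [->|]; lra. }
  assert (cv : forall s t, a <= t <= b -> continuity_pt (fun t => s * (f t - v)) t).
  { intros s t Ht. apply (continuity_pt_mult (fun _ => s) (fun t => f t - v)).
    apply continuity_pt_const; intros ? ?; reflexivity.
    apply (continuity_pt_minus f (fun _ => v)); auto.
    apply continuity_pt_const; intros ? ?; reflexivity. }
  destruct Hv as [Hv|Hv].
  - destruct (Ranalysis5.IVT_interv (fun t => 1 * (f t - v)) a b (cv 1)) as [c [H1 H2]]; try lra.
    exists c. split; auto; lra.
  - destruct (Ranalysis5.IVT_interv (fun t => -1 * (f t - v)) a b (cv (-1))) as [c [H1 H2]]; try lra.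
    exists c. split; auto; lra.
Qed.

Definition tends_to_0 (sg : R) (H : F4) (phi : R -> R4) : Prop :=
  traj sg H phi /\ forall i, is_lim (fun t => coord i (phi t)) p_infty 0.

Lemma tends_to_0_shift (sg : R) (H : F4) (phi : R -> R4) (d : R) :
  tends_to_0 sg H phi -> 0 <= d -> tends_to_0 sg H (fun t => phi (t + d)).
Proof.
  intros [Ht Hl] Hd. split. now apply traj_shift.
  intros i. apply is_lim_0_p_infty. intros eps He.
  destruct (proj1 (is_lim_0_p_infty _) (Hl i) eps He) as [M HM].
  exists M. intros t Hlt. apply HM. lra.
Qed.

Lemma tends_to_0_eventually (sg : R) (H : F4) (phi : R -> R4) (d : R) :
  tends_to_0 sg H phi -> 0 < d -> exists T, 0 <= T /\ forall t, T <= t -> in_ball4 d (phi t).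
Proof.
  intros [_ Hl] Hd.
  assert (ev : forall i, exists M, forall t, M < t -> Rabs (coord i (phi t)) < d).
  { intros i. apply (proj1 (is_lim_0_p_infty _) (Hl i) d Hd). }
  destruct (ev 0%nat) as [M0 L0]. destruct (ev 1%nat) as [M1 L1].
  destruct (ev 2%nat) as [M2 L2]. destruct (ev 3%nat) as [M3 L3].
  set (M := Rmax 0 (Rmax (Rmax M0 M1) (Rmax M2 M3))).
  assert (HM : 0 <= M /\ M0 <= M /\ M1 <= M /\ M2 <= M /\ M3 <= M).
  { unfold M, Rmax. repeat destruct Rle_dec; lra. }
  exists (M + 1). split. lra. intros t Ht.
  repeat split; [apply L0 | apply L1 | apply L2 | apply L3]; lra.
Qed.

Section Saddle.

Context (H : F4) (z : F2) (s11 s12 s22 r rho sg al be ga de l m : R).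
Context (Hs : smooth4 H) (Hc : forall i, (i < 4)%nat -> pd4 i H 0 0 0 0 = 0).
Context (z10 : zx z 0 0 = 0) (z01 : zy z 0 0 = 0).
Context (Sp : strict2 (zx z) s11 s12) (Sq : strict2 (zy z) s12 s22).
Context (Hr : 0 < r) (Hrho : 0 < rho) (Hsg : sg = 1 \/ sg = -1).
Context (Hjet : forall P, in_ball4 rho P ->
  (jet z r P <-> exists phi, phi 0 = P /\ tends_to_0 sg H phi)).
Context (HD : al * de - be * ga <> 0).
Context (HA : forall x y, let v := tangent_lift s11 s12 s22 x y in
  al * d0 (pd4 2 H) v + be * d0 (pd4 3 H) v = l * (al * x + be * y) /\
  ga * d0 (pd4 2 H) v + de * d0 (pd4 3 H) v = m * (ga * x + de * y)).
Context (Hl : 0 < sg * l) (Hm : sg * m < 0).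

(** In the time direction [sg], [xi] is the expanding and [eta] the contracting coordinate; the
    primed functions are their rates along a trajectory. *)
Let xi (P : R4) : R := al * c0 P + be * c1 P.
Let eta (P : R4) : R := ga * c0 P + de * c1 P.
Let xi' (P : R4) : R := sg * (al * c0 (xiH H P) + be * c1 (xiH H P)).
Let eta' (P : R4) : R := sg * (ga * c0 (xiH H P) + de * c1 (xiH H P)).

Lemma abs_sign : Rabs sg = 1.
Proof. destruct Hsg as [-> | ->]; [apply Rabs_R1 | rewrite Rabs_left; lra]. Qed.

Lemma xi_eta_derive (phi : R -> R4) (t : R) :
  traj sg H phi -> 0 <= t ->
  is_derive (fun u => xi (phi u)) t (xi' (phi t)) /\
  is_derive (fun u => eta (phi u)) t (eta' (phi t)).
Proof.
  intros Ht H0. pose proof (Ht t H0 0%nat) as D0. pose proof (Ht t H0 1%nat) as D1. simpl in D0, D1.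
  assert (D : forall s s', is_derive (fun u => s * c0 (phi u) + s' * c1 (phi u)) t
    (sg * (s * c0 (xiH H (phi t)) + s' * c1 (xiH H (phi t))))).
  { intros s s'.
    replace (sg * (s * c0 (xiH H (phi t)) + s' * c1 (xiH H (phi t))))
      with (s * (sg * c0 (xiH H (phi t))) + s' * (sg * c1 (xiH H (phi t)))) by ring.
    apply (is_derive_plus (fun u => s * c0 (phi u)) (fun u => s' * c1 (phi u))).
    - apply (is_derive_scal (fun u => c0 (phi u)) t s); assumption.
    - apply (is_derive_scal (fun u => c1 (phi u)) t s'); assumption. }
  split; apply D.
Qed.

Lemma eta_continuous (phi : R -> R4) (t : R) :
  traj sg H phi -> 0 <= t -> continuity_pt (fun u => eta (phi u)) t.
Proof.
  intros Ht H0. apply continuity_pt_filterlim.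
  apply (ex_derive_continuous (fun u => eta (phi u)) t).
  eexists. now apply xi_eta_derive.
Qed.

Lemma functional_limit (phi : R -> R4) (s s' : R) :
  tends_to_0 sg H phi -> is_lim (fun t => s * c0 (phi t) + s' * c1 (phi t)) p_infty 0.
Proof.
  intros [_ L]. replace (Finite 0) with (Finite (s * 0 + s' * 0)) by (f_equal; ring).
  apply (is_lim_plus' (fun t => s * c0 (phi t)) (fun t => s' * c1 (phi t))).
  - apply (is_lim_scal_l (fun t => c0 (phi t)) s p_infty 0). apply (L 0%nat).
  - apply (is_lim_scal_l (fun t => c1 (phi t)) s' p_infty 0). apply (L 1%nat).
Qed.

(** [strict_composition] applied to two points of the jet: the difference of two trajectories on it
    satisfies the hypotheses of [saddle_decay]. *)
Lemma pair_estimate :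
  exists d k, 0 < d /\ 0 < k /\ 2 * k < sg * l /\ 2 * k < - (sg * m) /\
  forall P Q, in_ball4 d P -> in_ball4 d Q -> jet z r P -> jet z r Q ->
    Rabs ((xi' P - xi' Q) - sg * l * (xi P - xi Q))
      <= k * (Rabs (xi P - xi Q) + Rabs (eta P - eta Q)) /\
    Rabs ((eta' P - eta' Q) + - (sg * m) * (eta P - eta Q))
      <= k * (Rabs (xi P - xi Q) + Rabs (eta P - eta Q)).
Proof.
  destruct (coordinates_bound al be ga de HD) as [C [HC Cb]].
  set (G := Rabs al + Rabs be + Rabs ga + Rabs de).
  pose proof (Rabs_pos al). pose proof (Rabs_pos be). pose proof (Rabs_pos ga). pose proof (Rabs_pos de).
  set (k := Rmin (sg * l) (- (sg * m)) / 4).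
  assert (Hk : 0 < k /\ 2 * k < sg * l /\ 2 * k < - (sg * m)).
  { unfold k, Rmin. destruct Rle_dec; lra. }
  destruct (small_factor (G * C) k) as [eps [He0 [_ HeC]]].
  { apply Rmult_le_pos; unfold G; lra. } lra.
  destruct (strict_composition H 2 (zx z) (zy z) s11 s12 s22 Hs z10 z01 Sp Sq eps He0) as [d2 [D2 L2]].
  destruct (strict_composition H 3 (zx z) (zy z) s11 s12 s22 Hs z10 z01 Sp Sq eps He0) as [d3 [D3 L3]].
  exists (Rmin d2 d3), k. split. now apply Rmin_glb_lt. split. tauto. split. tauto. split. tauto.
  intros P Q [P0 [P1 _]] [Q0 [Q1 _]] [x [y [_ ->]]] [x' [y' [_ ->]]]. simpl in P0, P1, Q0, Q1.
  pose proof (Rmin_l d2 d3). pose proof (Rmin_r d2 d3).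
  assert (E2 := L2 x' y' x y ltac:(lra) ltac:(lra) ltac:(lra) ltac:(lra)).
  assert (E3 := L3 x' y' x y ltac:(lra) ltac:(lra) ltac:(lra) ltac:(lra)).
  destruct (HA (x - x') (y - y')) as [A1 A2].
  pose proof (Cb (x - x') (y - y')) as N.
  unfold xi, eta, xi', eta', xiH, app4; simpl.
  replace (al * x + be * y - (al * x' + be * y')) with (al * (x - x') + be * (y - y')) by ring.
  replace (ga * x + de * y - (ga * x' + de * y')) with (ga * (x - x') + de * (y - y')) by ring.
  pose proof (Rabs_pos (x - x')). pose proof (Rabs_pos (y - y')).
  split.
  - rewrite Rmult_assoc, <- A1.
    match goal with |- Rabs ?e <= _ => replace e with (sg * (al *
      (pd4 2 H x y (zx z x y) (zy z x y) - pd4 2 H x' y' (zx z x' y') (zy z x' y')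
       - d0 (pd4 2 H) (tangent_lift s11 s12 s22 (x - x') (y - y'))) + be *
      (pd4 3 H x y (zx z x y) (zy z x y) - pd4 3 H x' y' (zx z x' y') (zy z x' y')
       - d0 (pd4 3 H) (tangent_lift s11 s12 s22 (x - x') (y - y'))))) by (simpl; ring) end.
    apply (functional_error G C eps) with (n := Rabs (x - x') + Rabs (y - y')); auto; try lra.
    apply abs_sign. unfold G; lra.
  - replace (- (sg * m) * (ga * (x - x') + de * (y - y')))
      with (- sg * (m * (ga * (x - x') + de * (y - y')))) by ring. rewrite <- A2.
    match goal with |- Rabs ?e <= _ => replace e with (sg * (ga *
      (pd4 2 H x y (zx z x y) (zy z x y) - pd4 2 H x' y' (zx z x' y') (zy z x' y')
       - d0 (pd4 2 H) (tangent_lift s11 s12 s22 (x - x') (y - y'))) + de *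
      (pd4 3 H x y (zx z x y) (zy z x y) - pd4 3 H x' y' (zx z x' y') (zy z x' y')
       - d0 (pd4 3 H) (tangent_lift s11 s12 s22 (x - x') (y - y'))))) by (simpl; ring) end.
    apply (functional_error G C eps) with (n := Rabs (x - x') + Rabs (y - y')); auto; try lra.
    apply abs_sign. unfold G; lra.
Qed.

(** A time shift exhibits each later point as the start of a trajectory tending to the origin, so
    [Hjet] applies to it. *)
Lemma tends_to_0_jet (phi : R -> R4) (t : R) :
  tends_to_0 sg H phi -> 0 <= t -> in_ball4 rho (phi t) -> jet z r (phi t).
Proof.
  intros Hp Ht HB. apply Hjet; auto. exists (fun s => phi (s + t)). split.
  now rewrite Rplus_0_l. now apply tends_to_0_shift.
Qed.

Lemma jet_determined (P Q : R4) :
  jet z r P -> jet z r Q -> xi P = xi Q -> eta P = eta Q -> P = Q.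
Proof.
  intros [x [y [_ ->]]] [x' [y' [_ ->]]]. unfold xi, eta; simpl. intros E1 E2.
  assert (x = x').
  { apply Rmult_eq_reg_l with (al * de - be * ga); auto.
    replace ((al * de - be * ga) * x) with (de * (al * x + be * y) - be * (ga * x + de * y)) by ring.
    rewrite E1, E2. ring. }
  assert (y = y').
  { apply Rmult_eq_reg_l with (al * de - be * ga); auto.
    replace ((al * de - be * ga) * y) with (al * (ga * x + de * y) - ga * (al * x + be * y)) by ring.
    rewrite E1, E2. ring. }
  now subst.
Qed.

Definition orbits_merge (f g : R -> R4) : Prop :=
  exists t1 t2, 0 <= t1 /\ 0 <= t2 /\ forall u, 0 <= u -> f (t1 + u) = g (t2 + u).

Section LocalEstimate.

Context (d k : R) (Hd : 0 < d) (Hdrho : d <= rho) (Hk : 0 < k)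
  (Hkl : 2 * k < sg * l) (Hkm : 2 * k < - (sg * m)).
Context (Hest : forall P Q, in_ball4 d P -> in_ball4 d Q -> jet z r P -> jet z r Q ->
    Rabs ((xi' P - xi' Q) - sg * l * (xi P - xi Q))
      <= k * (Rabs (xi P - xi Q) + Rabs (eta P - eta Q)) /\
    Rabs ((eta' P - eta' Q) + - (sg * m) * (eta P - eta Q))
      <= k * (Rabs (xi P - xi Q) + Rabs (eta P - eta Q))).

Lemma ball_weaken (P : R4) : in_ball4 d P -> in_ball4 rho P.
Proof. intros [A0 [A1 [A2 A3]]]. repeat split; lra. Qed.

(** This plays the role of the stable curve being a graph over [eta]. The difference in [eta] starts
    at zero and cannot grow, and it dominates the difference in [xi]. *)
Lemma equal_eta_merge (f g : R -> R4) (t1 t2 : R) :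
  tends_to_0 sg H f -> tends_to_0 sg H g -> 0 <= t1 -> 0 <= t2 ->
  (forall t, t1 <= t -> in_ball4 d (f t)) -> (forall t, t2 <= t -> in_ball4 d (g t)) ->
  eta (f t1) = eta (g t2) -> forall u, 0 <= u -> f (t1 + u) = g (t2 + u).
Proof.
  intros Hf Hg H1 H2 Bf Bg E.
  pose proof (tends_to_0_shift sg H f t1 Hf H1) as Sf.
  pose proof (tends_to_0_shift sg H g t2 Hg H2) as Sg.
  set (F := fun t => f (t + t1)) in *. set (K := fun t => g (t + t2)) in *.
  destruct (saddle_decay (fun t => xi (F t) - xi (K t)) (fun t => eta (F t) - eta (K t))
    (fun t => xi' (F t) - xi' (K t)) (fun t => eta' (F t) - eta' (K t)) 0 (sg * l) (- (sg * m)) k)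
    as [cone decay]; try lra.
  - intros t Ht.
    destruct (xi_eta_derive F t (proj1 Sf) Ht) as [DF1 DF2].
    destruct (xi_eta_derive K t (proj1 Sg) Ht) as [DK1 DK2].
    split. now apply (is_derive_minus (fun u => xi (F u)) (fun u => xi (K u))).
    split. now apply (is_derive_minus (fun u => eta (F u)) (fun u => eta (K u))).
    assert (B1 : in_ball4 d (F t)) by (apply Bf; lra).
    assert (B2 : in_ball4 d (K t)) by (apply Bg; lra).
    apply Hest; auto.
    apply tends_to_0_jet; auto using ball_weaken.
    apply tends_to_0_jet; auto using ball_weaken.
  - replace (Finite 0) with (Finite (0 - 0)) by (f_equal; ring).
    apply (is_lim_minus' (fun t => xi (F t)) (fun t => xi (K t))); now apply functional_limit.
  - replace (Finite 0) with (Finite (0 - 0)) by (f_equal; ring).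
    apply (is_lim_minus' (fun t => eta (F t)) (fun t => eta (K t))); now apply functional_limit.
  - intros u Hu.
    assert (E0 : Rabs (eta (F 0) - eta (K 0)) = 0).
    { unfold F, K. rewrite !Rplus_0_l, E, Rminus_diag. apply Rabs_R0. }
    pose proof (decay 0 u (conj (Rle_refl 0) Hu)) as Y. rewrite E0 in Y.
    pose proof (cone u Hu) as X.
    rewrite (Rplus_comm t1), (Rplus_comm t2). fold (F u) (K u).
    assert (Zabs : forall v, Rabs v <= 0 -> v = 0).
    { intros v Hv. apply Rabs_le_between in Hv. lra. }
    apply jet_determined.
    + apply tends_to_0_jet; auto. apply ball_weaken, Bf. lra.
    + apply tends_to_0_jet; auto. apply ball_weaken, Bg. lra.
    + apply Rminus_diag_uniq. apply Zabs. lra.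
    + apply Rminus_diag_uniq. apply Zabs. lra.
Qed.

Lemma zero_trajectory : tends_to_0 sg H (fun _ => zero4).
Proof.
  split.
  - intros t _. apply (coord_ind (fun c => is_derive (fun _ : R => c zero4) t (sg * c (xiH H zero4))));
      unfold xiH, app4; cbn [c0 c1 c2 c3 zero4].
    + rewrite (Hc 2) by lia. rewrite Rmult_0_r. apply (is_derive_const 0 t).
    + rewrite (Hc 3) by lia. rewrite Rmult_0_r. apply (is_derive_const 0 t).
    + rewrite (Hc 0) by lia. rewrite Ropp_0, Rmult_0_r. apply (is_derive_const 0 t).
    + rewrite (Hc 1) by lia. rewrite Ropp_0, Rmult_0_r. apply (is_derive_const 0 t).
  - apply (coord_ind (fun c => is_lim (fun _ : R => c zero4) p_infty 0)); apply (is_lim_const 0).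
Qed.

Lemma zero_in_ball (e : R) : 0 < e -> in_ball4 e zero4.
Proof. intros He. unfold in_ball4; simpl. rewrite Rabs_R0. auto. Qed.

(** Where [eta] vanishes the trajectory would agree with the constant one at the origin, hence would
    have started there. *)
Lemma eta_nonzero (f : R -> R4) (T : R) :
  tends_to_0 sg H f -> f 0 <> zero4 -> 0 <= T -> (forall t, T <= t -> in_ball4 d (f t)) ->
  forall t, T <= t -> eta (f t) <> 0.
Proof.
  intros Hf N HT Bf t Ht E. apply N.
  apply (traj_backward_unique sg H f (fun _ => zero4) t Hsg Hs (proj1 Hf) (proj1 zero_trajectory)).
  lra.
  pose proof (equal_eta_merge f (fun _ => zero4) t 0 Hf zero_trajectory) as M.
  replace t with (t + 0) by ring. apply M; try lra.
  - intros s Hst. apply Bf. lra.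
  - intros. now apply zero_in_ball.
  - rewrite E. unfold eta, zero4; simpl. ring.
Qed.

Lemma eta_eventual_sign (f : R -> R4) :
  tends_to_0 sg H f -> f 0 <> zero4 ->
  exists T, 0 <= T /\ (forall t, T <= t -> in_ball4 d (f t)) /\
    ((forall t, T <= t -> 0 < 1 * eta (f t)) \/ (forall t, T <= t -> 0 < -1 * eta (f t))).
Proof.
  intros Hf N. destruct (tends_to_0_eventually sg H f d Hf Hd) as [T [HT Bf]].
  exists T. split; auto. split; auto.
  pose proof (eta_nonzero f T Hf N HT Bf) as NZ.
  assert (same : forall t, T <= t -> 0 < eta (f T) * eta (f t)).
  { intros t Ht. apply Rnot_le_lt. intros L.
    destruct (intermediate_value (fun u => eta (f u)) T t 0) as [c [Hc1 Hc2]]; auto.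
    - intros u Hu. apply eta_continuous. apply Hf. lra.
    - destruct (Rle_lt_dec 0 (eta (f T))) as [P|P].
      + right. split; auto. pose proof (NZ T (Rle_refl T)).
        apply Rnot_lt_le. intros Q. assert (0 < eta (f T) * eta (f t)) by (apply Rmult_lt_0_compat; lra). lra.
      + left. split; [lra|]. apply Rnot_lt_le. intros Q.
        assert (0 < - eta (f T) * - eta (f t)) by (apply Rmult_lt_0_compat; lra). lra.
    - apply (NZ c); auto; lra. }
  destruct (Rlt_le_dec 0 (eta (f T))) as [P|P].
  - left. intros t Ht. specialize (same t Ht). apply Rmult_lt_reg_l with (eta (f T)); lra.
  - right. intros t Ht. specialize (same t Ht). pose proof (NZ T (Rle_refl T)).
    apply Rmult_lt_reg_l with (- eta (f T)); lra.
Qed.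

(** On its way to zero [eta] along [f] takes the smaller value [eta (g T2)]; from that time on
    [equal_eta_merge] applies. *)
Lemma same_sign_merge (f g : R -> R4) (tau T1 T2 : R) :
  tends_to_0 sg H f -> tends_to_0 sg H g -> 0 <= T1 -> 0 <= T2 -> (tau = 1 \/ tau = -1) ->
  (forall t, T1 <= t -> in_ball4 d (f t)) -> (forall t, T2 <= t -> in_ball4 d (g t)) ->
  0 < tau * eta (g T2) <= tau * eta (f T1) -> orbits_merge f g.
Proof.
  intros Hf Hg H1 H2 Htau Bf Bg [V1 V2].
  pose proof (functional_limit f ga de Hf) as L.
  destruct (proj1 (is_lim_0_p_infty _) L _ V1) as [M HM].
  set (t := Rmax T1 (M + 1)).
  assert (Ht : T1 <= t /\ M < t) by (unfold t, Rmax; destruct Rle_dec; lra).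
  specialize (HM t (proj2 Ht)). fold (eta (f t)) in HM. apply Rabs_def2 in HM.
  destruct (intermediate_value (fun u => eta (f u)) T1 t (eta (g T2))) as [c [Hc1 Hc2]].
  - lra.
  - intros u Hu. apply eta_continuous. apply Hf. lra.
  - destruct Htau as [-> | ->]; [right | left]; lra.
  - exists c, T2. split. lra. split. lra. apply equal_eta_merge; auto; try lra.
    intros s Hsc. apply Bf. lra.
Qed.

(** Each branch of the stable curve is a single orbit, so any trajectory on it can represent it. An
    empty branch makes the claim vacuous, and the constant trajectory is a placeholder. *)
Lemma reference_orbit (tau : R) :
  (tau = 1 \/ tau = -1) ->
  exists psi, forall f T, tends_to_0 sg H f -> 0 <= T ->
    (forall t, T <= t -> in_ball4 d (f t)) -> (forall t, T <= t -> 0 < tau * eta (f t)) ->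
    orbits_merge f psi.
Proof.
  intros Htau.
  destruct (classic (exists g T, tends_to_0 sg H g /\ 0 <= T /\
    (forall t, T <= t -> in_ball4 d (g t)) /\ (forall t, T <= t -> 0 < tau * eta (g t))))
    as [[g [T [Hg [HT [Bg Sg]]]]] | N].
  - exists g. intros f T' Hf HT' Bf Sf.
    pose proof (Sg T (Rle_refl T)). pose proof (Sf T' (Rle_refl T')).
    destruct (Rle_lt_dec (tau * eta (g T)) (tau * eta (f T'))).
    + apply (same_sign_merge f g tau T' T); auto.
    + destruct (same_sign_merge g f tau T T') as [t1 [t2 [A1 [A2 A3]]]]; auto. lra.
      exists t2, t1. split; auto. split; auto. intros u Hu. symmetry. auto.
  - exists (fun _ => zero4). intros f T Hf HT Bf Sf. exfalso. apply N. exists f, T. auto.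
Qed.

(* Close to the origin [xi] increases wherever [|eta| <= xi], and the speed is bounded. *)
Lemma transversal_segment :
  exists c' c tau (P : R -> R4), 0 < c /\ 0 < tau /\
    (forall s, 0 <= s <= c -> xi (P s) = c' /\ eta (P s) = s /\
       exists f, f 0 = P s /\ tends_to_0 sg H f) /\
    (forall s f t, 0 <= s <= c -> f 0 = P s -> tends_to_0 sg H f -> 0 < t < tau -> c' < xi (f t)).
Proof.
  destruct (xiH_bounded H Hs) as [M [r1 [HM [R1 HB]]]].
  set (q := Rmin d r1).
  assert (Hq : 0 < q /\ q <= d /\ q <= r1) by (unfold q, Rmin; destruct Rle_dec; lra).
  assert (HB' : forall P, in_ball4 q P -> forall i, Rabs (coord i (xiH H P)) <= M).
  { intros P [B0 [B1 [B2 B3]]]. apply HB. repeat split; lra. }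
  destruct (coordinates_bound al be ga de HD) as [C [HC Cb]].
  destruct (strict2_small (zx z) s11 s12 (q / 2)) as [d1 [D1 L1]]; auto. lra.
  destruct (strict2_small (zy z) s12 s22 (q / 2)) as [d2 [D2 L2]]; auto. lra.
  set (e := Rmin (Rmin r (q / 2)) (Rmin d1 d2)).
  assert (He : 0 < e /\ e <= r /\ e <= q / 2 /\ e <= d1 /\ e <= d2).
  { unfold e, Rmin. repeat destruct Rle_dec; lra. }
  (* With [s <= c'] this gives [|X s| + |Y s| <= 2 C c' = 2 e / 3], inside the domain of the
     estimates. *)
  set (c' := e / (3 * C)).
  assert (Hc' : 0 < c') by (apply Rdiv_lt_0_compat; lra).
  (* After a drift of at most [c' / 4] one still has [|eta| <= c / 2 + c' / 2 = 3 c' / 4 <= xi]. *)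
  set (c := c' / 2).
  set (D := al * de - be * ga) in *.
  set (X := fun s => (de * c' - be * s) / D). set (Y := fun s => (al * s - ga * c') / D).
  assert (EX : forall s, al * X s + be * Y s = c') by (intros; unfold X, Y, D; field; exact HD).
  assert (EY : forall s, ga * X s + de * Y s = s) by (intros; unfold X, Y, D; field; exact HD).
  set (P := fun s => mk4 (X s) (Y s) (zx z (X s) (Y s)) (zy z (X s) (Y s))).
  assert (small : forall s, 0 <= s <= c -> Rabs (X s) < e /\ Rabs (Y s) < e).
  { intros s Hsc. pose proof (Cb (X s) (Y s)) as N. rewrite EX, EY in N.
    rewrite (Rabs_pos_eq c'), (Rabs_pos_eq s) in N by (unfold c in Hsc; lra).
    assert (C * (c' + s) <= C * (2 * c')) by (apply Rmult_le_compat_l; unfold c in Hsc; lra).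
    assert (3 * (C * c') = e) by (unfold c'; field; lra).
    assert (0 < C * c') by (apply Rmult_lt_0_compat; lra).
    pose proof (Rabs_pos (X s)). pose proof (Rabs_pos (Y s)). split; lra. }
  assert (PB : forall s, 0 <= s <= c -> in_ball4 (q / 2) (P s)).
  { intros s Hsc. destruct (small s Hsc) as [S1 S2]. repeat split; simpl; try lra.
    apply L1; lra. apply L2; lra. }
  set (G := Rabs al + Rabs be + Rabs ga + Rabs de + 1).
  pose proof (Rabs_pos al). pose proof (Rabs_pos be). pose proof (Rabs_pos ga). pose proof (Rabs_pos de).
  (* The first bound keeps the trajectory in the ball of radius [q], the second limits the drift of
     [xi] and [eta] to [c' / 4]. *)
  set (tau := Rmin (q / (4 * M)) (c' / (4 * G * M))).
  assert (GM : 0 < 4 * G * M) by (apply Rmult_lt_0_compat; unfold G; lra).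
  assert (Htau : 0 < tau /\ tau <= q / (4 * M) /\ tau <= c' / (4 * G * M)).
  { assert (0 < q / (4 * M)) by (apply Rdiv_lt_0_compat; lra).
    assert (0 < c' / (4 * G * M)) by (apply Rdiv_lt_0_compat; lra).
    unfold tau, Rmin. destruct Rle_dec; lra. }
  assert (T1 : M * tau < q / 2).
  { assert (M * tau <= M * (q / (4 * M))) by (apply Rmult_le_compat_l; lra).
    assert (M * (q / (4 * M)) = q / 4) by (field; lra). lra. }
  assert (T2 : G * (M * tau) <= c' / 4).
  { assert (G * M * tau <= G * M * (c' / (4 * G * M))) by (apply Rmult_le_compat_l; lra).
    assert (G * M * (c' / (4 * G * M)) = c' / 4) by (field; unfold G; split; lra). lra. }
  assert (from : forall s f t, 0 <= s <= c -> f 0 = P s -> tends_to_0 sg H f -> 0 < t < tau -> c' < xi (f t)).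
  { intros s f t Hsc f0 Hf Ht.
    assert (B0 : in_ball4 (q / 2) (f 0)) by (rewrite f0; auto).
    pose proof (traj_stays sg H f M q tau Hsg (proj1 Hf) (proj1 Hq) HM HB' B0 T1) as St.
    assert (drift : forall h h' u, Rabs h + Rabs h' <= G -> 0 <= u <= tau ->
      Rabs (h * c0 (f u) + h' * c1 (f u) - (h * c0 (f 0) + h' * c1 (f 0))) <= c' / 4).
    { intros h h' u Hh Hu. destruct (St u Hu) as [_ Dr].
      pose proof (Dr 0%nat) as Dr0. pose proof (Dr 1%nat) as Dr1. simpl in Dr0, Dr1.
      replace (h * c0 (f u) + h' * c1 (f u) - (h * c0 (f 0) + h' * c1 (f 0)))
        with (h * (c0 (f u) - c0 (f 0)) + h' * (c1 (f u) - c1 (f 0))) by ring.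
      eapply Rle_trans. apply Rabs_triang. rewrite !Rabs_mult.
      assert (M * u <= M * tau) by (apply Rmult_le_compat_l; lra).
      pose proof (Rabs_pos h). pose proof (Rabs_pos h').
      assert (Rabs h * Rabs (c0 (f u) - c0 (f 0)) <= Rabs h * (M * tau)) by (apply Rmult_le_compat_l; lra).
      assert (Rabs h' * Rabs (c1 (f u) - c1 (f 0)) <= Rabs h' * (M * tau)) by (apply Rmult_le_compat_l; lra).
      assert (0 <= M * tau) by (apply Rmult_le_pos; lra).
      assert ((Rabs h + Rabs h') * (M * tau) <= G * (M * tau)) by (apply Rmult_le_compat_r; auto).
      lra. }
    assert (xi0 : xi (f 0) = c') by (rewrite f0; apply EX).
    assert (eta0 : eta (f 0) = s) by (rewrite f0; apply EY).
    destruct (MVT_cor2 (fun u => xi (f u)) (fun u => xi' (f u)) 0 t) as [u [Eu Hu]]. lra.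
    { intros u Hu. apply is_derive_Reals. apply xi_eta_derive. apply Hf. lra. }
    assert (Hu' : 0 <= u <= tau) by lra.
    pose proof (drift al be u ltac:(unfold G; lra) Hu') as Dx. fold (xi (f u)) (xi (f 0)) in Dx.
    pose proof (drift ga de u ltac:(unfold G; lra) Hu') as Dy. fold (eta (f u)) (eta (f 0)) in Dy.
    destruct (St u Hu') as [[B1 [B2 [B3 B4]]] _].
    assert (Bd : in_ball4 d (f u)) by (repeat split; lra).
    (* The origin lies on the jet and is at rest; taking it as second point makes the pair estimate
       one for a single point. *)
    assert (J0 : jet z r zero4).
    { exists 0, 0. split. unfold in_ball2. rewrite Rabs_R0. auto. now rewrite z10, z01. }
    assert (J : jet z r (f u)) by (apply tends_to_0_jet; auto; [lra | now apply ball_weaken]).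
    destruct (Hest (f u) zero4 Bd (zero_in_ball d Hd) J J0) as [Ex _].
    assert (xz : xi zero4 = 0) by (unfold xi; simpl; ring).
    assert (ez : eta zero4 = 0) by (unfold eta; simpl; ring).
    assert (xz' : xi' zero4 = 0).
    { unfold xi', xiH, app4; cbn [c0 c1 c2 c3 zero4]. rewrite (Hc 2), (Hc 3) by lia. ring. }
    rewrite xz, ez, xz', !Rminus_0_r in Ex.
    rewrite xi0 in Dx. rewrite eta0 in Dy.
    apply Rabs_le_between in Dx. apply Rabs_le_between in Dy.
    assert (Xu : 3 * c' / 4 <= xi (f u)) by lra.
    assert (Yu : Rabs (eta (f u)) <= xi (f u)) by (apply Rabs_le; unfold c in Hsc; lra).
    rewrite (Rabs_pos_eq (xi (f u))) in Ex by lra.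
    assert (k * (xi (f u) + Rabs (eta (f u))) <= k * (2 * xi (f u))) by (apply Rmult_le_compat_l; lra).
    apply Rabs_le_between in Ex.
    assert (0 < (sg * l - 2 * k) * xi (f u)) by (apply Rmult_lt_0_compat; lra).
    assert (0 < xi' (f u) * (t - 0)) by (apply Rmult_lt_0_compat; lra).
    lra. }
  exists c', c, tau, P. split. unfold c; lra. split. tauto. split; [|exact from].
  intros s Hsc. split. apply EX. split. apply EY.
  apply Hjet.
  - apply ball_weaken. destruct (PB s Hsc) as [B0 [B1 [B2 B3]]]. repeat split; lra.
  - exists (X s), (Y s). split; [|reflexivity]. destruct (small s Hsc). split; lra.
Qed.

Lemma floor_exists (x : R) : exists n : Z, IZR n <= x < IZR n + 1.
Proof.
  exists (up x - 1)%Z. rewrite minus_IZR. destruct (archimed x). lra.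
Qed.

(* All trajectories that start on the segment lie on two orbits, and the passage times of
   one orbit through the segment are separated by [tau], so there are only countably many
   of them. *)
Lemma local_saddle_contradiction : False.
Proof.
  destruct transversal_segment as [c' [c [tau [P [Pc [Ptau [Pex Pcross]]]]]]].
  destruct (reference_orbit 1 (or_introl eq_refl)) as [psi1 Hpsi1].
  destruct (reference_orbit (-1) (or_intror eq_refl)) as [psi2 Hpsi2].
  set (psi := fun b : bool => if b then psi1 else psi2).
  (* [P s] lies at time [t2 - t1] on the reference orbit, possibly before its start; [n] numbers the
     slot of length [tau] that contains the shift [t1 - t2]. *)
  set (hits := fun s (b : bool) (n : Z) => exists f t1 t2, f 0 = P s /\ tends_to_0 sg H f /\
    0 <= t1 /\ 0 <= t2 /\ (forall u, 0 <= u -> f (t1 + u) = psi b (t2 + u)) /\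
    IZR n <= (t1 - t2) / tau < IZR n + 1).
  assert (hits_le : forall s s' b f f' t1 t2 t1' t2', 0 <= s <= c -> 0 <= s' <= c ->
    f 0 = P s -> f' 0 = P s' -> tends_to_0 sg H f -> tends_to_0 sg H f' ->
    0 <= t1 -> 0 <= t2 -> 0 <= t1' -> 0 <= t2' ->
    (forall u, 0 <= u -> f (t1 + u) = psi b (t2 + u)) ->
    (forall u, 0 <= u -> f' (t1' + u) = psi b (t2' + u)) ->
    0 <= (t1 - t2) - (t1' - t2') < tau -> s = s').
  { intros s s' b f f' t1 t2 t1' t2' Hsc Hsc' f0 f0' Hf Hf' A1 A2 A1' A2' M M' Hdiff.
    set (dd := (t1 - t2) - (t1' - t2')) in *.
    set (mx := Rmax t2 t2').
    assert (Hmx : t2 <= mx /\ t2' <= mx) by (split; [apply Rmax_l | apply Rmax_r]).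
    assert (E : f (t1' + mx - t2' + dd) = f' (t1' + mx - t2')).
    { replace (t1' + mx - t2' + dd) with (t1 + (mx - t2)) by (unfold dd; ring).
      replace (t1' + mx - t2') with (t1' + (mx - t2')) by ring.
      rewrite M, M' by lra. f_equal. ring. }
    (* Back to time zero this reads [f dd = P s']: the trajectory from [P s] would return to the
       segment after a delay below [tau], which [Pcross] excludes unless the delay is zero. *)
    pose proof (traj_backward_unique sg H (fun t => f (t + dd)) f' (t1' + mx - t2') Hsg Hs
      (traj_shift sg H f dd (proj1 Hf) (proj1 Hdiff)) (proj1 Hf') ltac:(lra) E) as E0.
    cbv beta in E0. rewrite Rplus_0_l, f0' in E0.
    destruct (Pex s Hsc) as [_ [Es _]]. destruct (Pex s' Hsc') as [Xs' [Es' _]].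
    destruct (Req_dec dd 0) as [Z|N].
    - rewrite Z, f0 in E0. rewrite <- Es, <- Es', E0. reflexivity.
    - pose proof (Pcross s f dd Hsc f0 Hf ltac:(lra)) as Cr. rewrite E0, Xs' in Cr. lra. }
  assert (hits_unique : forall s s' b n, 0 <= s <= c -> 0 <= s' <= c ->
    hits s b n -> hits s' b n -> s = s').
  { intros s s' b n Hsc Hsc' [f [t1 [t2 [f0 [Hf [A1 [A2 [M N]]]]]]]]
      [f' [t1' [t2' [f0' [Hf' [A1' [A2' [M' N']]]]]]]].
    assert (D : - tau < (t1 - t2) - (t1' - t2') < tau).
    { replace (t1 - t2) with ((t1 - t2) / tau * tau) by (field; lra).
      replace (t1' - t2') with ((t1' - t2') / tau * tau) by (field; lra). nra. }
    destruct (Rle_lt_dec 0 ((t1 - t2) - (t1' - t2'))).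
    - apply (hits_le s s' b f f' t1 t2 t1' t2'); auto. lra.
    - symmetry. apply (hits_le s' s b f' f t1' t2' t1 t2); auto. lra. }
  apply (interval_not_countable
    (* The parity of [n] encodes the branch. *)
    (fun s n => exists b k, hits s b k /\ n = (2 * k + if b then 1 else 0)%Z) 0 c Pc).
  - intros s Hsc. destruct (Pex s Hsc) as [Xs [_ [f [f0 Hf]]]].
    (* If [P s] were the origin, the constant trajectory would start on the segment without leaving
       it, against [Pcross]. *)
    assert (N : f 0 <> zero4).
    { rewrite f0. intros Z. destruct (Pex s Hsc) as [Xs0 [Es0 _]].
      pose proof (Pcross s (fun _ => zero4) (tau / 2) Hsc (eq_sym Z) zero_trajectory ltac:(lra)) as Cr.
      rewrite Z in Xs0. lra. }
    assert (merge : exists b, orbits_merge f (psi b)).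
    { destruct (eta_eventual_sign f Hf N) as [T [HT [Bf [S|S]]]].
      - exists true. apply (Hpsi1 f T); auto.
      - exists false. apply (Hpsi2 f T); auto. }
    destruct merge as [b [t1 [t2 [A1 [A2 M]]]]].
    destruct (floor_exists ((t1 - t2) / tau)) as [k' Hk'].
    exists (2 * k' + if b then 1 else 0)%Z, b, k'. split; auto.
    exists f, t1, t2. tauto.
  - intros s s' n Hsc Hsc' [b [k1 [H1 E1]]] [b' [k2 [H2 E2]]].
    assert (b = b' /\ k1 = k2) as [-> ->].
    { destruct b, b'; split; auto; lia. }
    now apply (hits_unique s s' b' k2).
Qed.

End LocalEstimate.

Lemma saddle_contradiction : False.
Proof.
  destruct pair_estimate as [d [k [Hd [Hk [Hkl [Hkm Hest]]]]]].
  pose proof (Rmin_l d rho). pose proof (Rmin_r d rho).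
  apply (local_saddle_contradiction (Rmin d rho) k); auto.
  - now apply Rmin_glb_lt.
  - intros P Q [P0 [P1 [P2 P3]]] [Q0 [Q1 [Q2 Q3]]]. apply Hest; repeat split; lra.
Qed.

End Saddle.

(** * Conclusion *)

Lemma flows_fwd_tends_to_0 (H : F4) (P : R4) :
  flows_to_0_fwd H P <-> exists phi, phi 0 = P /\ tends_to_0 1 H phi.
Proof.
  split.
  - intros [phi [P0 [T [L0 [L1 [L2 L3]]]]]]. exists phi. split; auto. split.
    + intros t Ht i. rewrite Rmult_1_l. destruct (T t Ht) as [D0 [D1 [D2 D3]]].
      now apply (coord_ind (fun c => is_derive (fun u => c (phi u)) t (c (xiH H (phi t))))).
    + now apply (coord_ind (fun c => is_lim (fun t => c (phi t)) p_infty 0)).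
  - intros [phi [P0 [T L]]]. exists phi. split; auto. split.
    + intros t Ht. pose proof (T t Ht) as D. setoid_rewrite Rmult_1_l in D.
      exact (conj (D 0%nat) (conj (D 1%nat) (conj (D 2%nat) (D 3%nat)))).
    + exact (conj (L 0%nat) (conj (L 1%nat) (conj (L 2%nat) (L 3%nat)))).
Qed.

Lemma is_lim_0_reverse (f : R -> R) :
  is_lim f m_infty 0 <-> is_lim (fun t => f (- t)) p_infty 0.
Proof.
  rewrite is_lim_0_p_infty, <- is_lim_spec. split.
  - intros L eps He. destruct (L (mkposreal eps He)) as [M HM]. exists (- M). intros t Ht.
    specialize (HM (- t)). rewrite Rminus_0_r in HM. apply HM. lra.
  - intros L eps. destruct (L eps (cond_pos eps)) as [M HM]. exists (- M). intros t Ht.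
    rewrite Rminus_0_r. specialize (HM (- t)). rewrite Ropp_involutive in HM. apply HM. lra.
Qed.

Lemma is_derive_reverse (f : R -> R) (t l : R) :
  is_derive f (- t) l -> is_derive (fun u => f (- u)) t (-1 * l).
Proof.
  intros D. apply (is_derive_comp f (fun u => - u) t l (-1)); auto.
  apply (is_derive_opp (fun u => u) t 1). apply (is_derive_id t).
Qed.

Lemma flows_bwd_tends_to_0 (H : F4) (P : R4) :
  flows_to_0_bwd H P <-> exists phi, phi 0 = P /\ tends_to_0 (-1) H phi.
Proof.
  split.
  - intros [phi [P0 [T [L0 [L1 [L2 L3]]]]]]. exists (fun t => phi (- t)).
    split. now rewrite Ropp_0. split.
    + intros t Ht. destruct (T (- t) ltac:(lra)) as [D0 [D1 [D2 D3]]].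
      apply (coord_ind (fun c => is_derive (fun u => c (phi (- u))) t (-1 * c (xiH H (phi (- t))))));
        [apply (is_derive_reverse (fun u => c0 (phi u))) | apply (is_derive_reverse (fun u => c1 (phi u)))
        | apply (is_derive_reverse (fun u => c2 (phi u))) | apply (is_derive_reverse (fun u => c3 (phi u)))];
        assumption.
    + apply (coord_ind (fun c => is_lim (fun t => c (phi (- t))) p_infty 0)).
      * now apply (is_lim_0_reverse (fun t => c0 (phi t))).
      * now apply (is_lim_0_reverse (fun t => c1 (phi t))).
      * now apply (is_lim_0_reverse (fun t => c2 (phi t))).
      * now apply (is_lim_0_reverse (fun t => c3 (phi t))).
  - intros [phi [P0 [T L]]]. exists (fun t => phi (- t)).
    split. now rewrite Ropp_0. split.
    + intros t Ht.
      assert (D : forall i, is_derive (fun u => coord i (phi (- u))) t (coord i (xiH H (phi (- t))))).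
      { intros i. replace (coord i (xiH H (phi (- t)))) with (-1 * (-1 * coord i (xiH H (phi (- t))))) by ring.
        apply (is_derive_reverse (fun u => coord i (phi u))). apply T. lra. }
      exact (conj (D 0%nat) (conj (D 1%nat) (conj (D 2%nat) (D 3%nat)))).
    + assert (L' : forall i, is_lim (fun t => coord i (phi (- t))) m_infty 0).
      { intros i. apply is_lim_0_reverse. apply (is_lim_ext (fun t => coord i (phi t))); auto.
        intros t. now rewrite Ropp_involutive. }
      exact (conj (L' 0%nat) (conj (L' 1%nat) (conj (L' 2%nat) (L' 3%nat)))).
Qed.

Lemma C2_on_weaken (r r' : R) (f : F2) : r' <= r -> C2_on r f -> C2_on r' f.
Proof. intros Hr HC x y [Bx By]. apply HC. split; lra. Qed.

Lemma solves_on_weaken (H : F4) (r r' : R) (f : F2) : r' <= r -> solves_on H r f -> solves_on H r' f.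
Proof. intros Hr HS x y [Bx By]. apply HS. split; lra. Qed.

Theorem theorem3p4 (H : F4) (a b : R) (e1 e2 e3 e4 : R4) (z zt : F2) :
  smooth4 H ->
  H 0 0 0 0 = 0 ->
  (forall i, (i < 4)%nat -> pd4 i H 0 0 0 0 = 0) ->
  nondegenerate0 H ->
  0 < a -> 0 < b ->
  eigvec H a e1 -> eigvec H b e2 -> eigvec H (- a) e3 -> eigvec H (- b) e4 ->
  Q_indep a b ->
  pi_indep e1 e2 -> pi_indep e3 e4 -> pi_indep e1 e4 -> pi_indep e2 e3 ->
  (* z: a C^2 solution near the origin, vanishing to first order at 0 *)
  (exists r0, 0 < r0 /\ C2_on r0 z /\ solves_on H r0 z /\
     (* its jet near the origin is the stable or the unstable submanifold *)
     exists r rho, 0 < r /\ r <= r0 /\ 0 < rho /\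
       ((forall P, in_ball4 rho P -> (jet z r P <-> flows_to_0_fwd H P)) \/
        (forall P, in_ball4 rho P -> (jet z r P <-> flows_to_0_bwd H P)))) ->
  z 0 0 = 0 -> zx z 0 0 = 0 -> zy z 0 0 = 0 ->
  (* zt: any C^2 solution near the origin, vanishing to first order at 0 *)
  (exists r1, 0 < r1 /\ C2_on r1 zt /\ solves_on H r1 zt) ->
  zt 0 0 = 0 -> zx zt 0 0 = 0 -> zy zt 0 0 = 0 ->
  (* jets tangent at the origin: same second derivatives *)
  pd2 0 (pd2 0 zt) 0 0 = pd2 0 (pd2 0 z) 0 0 ->
  pd2 1 (pd2 0 zt) 0 0 = pd2 1 (pd2 0 z) 0 0 ->
  pd2 1 (pd2 1 zt) 0 0 = pd2 1 (pd2 1 z) 0 0 ->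
  exists delta, 0 < delta /\
    forall x y, in_ball2 delta x y -> zt x y = z x y.
Proof.
  intros Hs _ Hc _ Ha Hb E1 E2 E3 E4 HQ Hpi _ _ _
    [r0 [Hr0 [Cz [Sz [r [rho [Hr [_ [Hrho Hjet]]]]]]]]] z00 z10 z01
    [r1 [Hr1 [Ct St]]] t00 t10 t01 Exx Exy Eyy.
  (* Equal eigenvalues would satisfy the rational relation with coefficients [1] and [-1]. *)
  assert (Hab : a <> b).
  { intros <-. destruct (HQ 1%Q (-1)%Q) as [Q _].
    - unfold Q2R; simpl. field.
    - unfold Q2R in Q; simpl in Q. lra. }
  pose proof (jet_plane_invariant H z r0 Hs Hc Hr0 Cz Sz z10 z01) as Hinv.
  pose proof (C2_strict_gradient z r0 0 Hr0 Cz) as Sp.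
  pose proof (C2_strict_gradient z r0 1 Hr0 Cz) as Sq.
  pose proof (C2_strict_gradient zt r1 0 Hr1 Ct) as Tp.
  pose proof (C2_strict_gradient zt r1 1 Hr1 Ct) as Tq.
  rewrite (C2_schwarz z r0 Hr0 Cz) in Sq. rewrite (C2_schwarz zt r1 Hr1 Ct) in Tq.
  rewrite Exx, Exy in Tp. rewrite Exy, Eyy in Tq.
  unfold zx at 1 2 in Hinv. unfold zy at 1 in Hinv.
  set (s11 := pd2 0 (pd2 0 z) 0 0) in *. set (s12 := pd2 1 (pd2 0 z) 0 0) in *.
  set (s22 := pd2 1 (pd2 1 z) 0 0) in *.
  destruct (invariant_plane_functionals H a b e1 e2 e3 e4 Ha Hb Hab E1 E2 E3 E4 s11 s12 s22 Hpi Hinv)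
    as [al [be [ga [de [l [m [HD [Hl [Hm HA]]]]]]]]].
  (* The two functionals come in no prescribed order; the exchanged data serve when the second one
     is the expanding direction. *)
  assert (HD' : ga * be - de * al <> 0) by lra.
  assert (HA' : forall x y, let v := tangent_lift s11 s12 s22 x y in
    ga * d0 (pd4 2 H) v + de * d0 (pd4 3 H) v = m * (ga * x + de * y) /\
    al * d0 (pd4 2 H) v + be * d0 (pd4 3 H) v = l * (al * x + be * y)).
  { intros x y. destruct (HA x y). split; assumption. }
  assert (no_saddle : l * m < 0 -> False).
  { intros Hlm.
    assert (saddle : forall sg, sg = 1 \/ sg = -1 ->
      (forall P, in_ball4 rho P ->
        (jet z r P <-> exists phi, phi 0 = P /\ tends_to_0 sg H phi)) -> False).
    { intros sg Hsg J.
      assert (signs : (0 < sg * l /\ sg * m < 0) \/ (0 < sg * m /\ sg * l < 0)).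
      { assert (lm : (0 < l /\ m < 0) \/ (0 < m /\ l < 0)).
        { destruct (Rlt_le_dec 0 l); [left | right]; split; nra. }
        destruct Hsg as [-> | ->]; lra. }
      destruct signs as [[S1 S2]|[S1 S2]].
      - exact (saddle_contradiction H z s11 s12 s22 r rho sg al be ga de l m Hs Hc z10 z01 Sp Sq
          Hr Hrho Hsg J HD HA S1 S2).
      - exact (saddle_contradiction H z s11 s12 s22 r rho sg ga de al be m l Hs Hc z10 z01 Sp Sq
          Hr Hrho Hsg J HD' HA' S1 S2). }
    destruct Hjet as [J|J].
    - apply (saddle 1); auto. intros P HP. rewrite <- flows_fwd_tends_to_0. now apply J.
    - apply (saddle (-1)); auto. intros P HP. rewrite <- flows_bwd_tends_to_0. now apply J. }
  (* Here [sg] is the common sign of the two eigenvalues; it is unrelated to whether the jet is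
     stable or unstable in [Hjet]. *)
  assert (node : exists sg, (sg = 1 \/ sg = -1) /\ 0 < sg * l /\ 0 < sg * m).
  { assert (Hl0 : l <> 0) by (destruct Hl as [->|[->|[->| ->]]]; lra).
    assert (Hm0 : m <> 0) by (destruct Hm as [->|[->|[->| ->]]]; lra).
    destruct (Rlt_le_dec 0 l), (Rlt_le_dec 0 m).
    - exists 1. lra.
    - exfalso. apply no_saddle. nra.
    - exfalso. apply no_saddle. nra.
    - exists (-1). lra. }
  destruct node as [sg [Hsg [Sl Sm]]].
  pose proof (Rmin_l r0 r1) as M0. pose proof (Rmin_r r0 r1) as M1.
  assert (HM : 0 < Rmin r0 r1) by now apply Rmin_glb_lt.
  pose proof (C2_on_weaken _ _ _ M0 Cz) as Cz'. pose proof (C2_on_weaken _ _ _ M1 Ct) as Ct'.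
  pose proof (solves_on_weaken _ _ _ _ M0 Sz) as Sz'. pose proof (solves_on_weaken _ _ _ _ M1 St) as St'.
  destruct (node_comparison H z zt s11 s12 s22 (Rmin r0 r1) al be ga de l m sg) as [d1 [D1 L1]]; auto.
  destruct (node_comparison H zt z s11 s12 s22 (Rmin r0 r1) al be ga de l m sg) as [d2 [D2 L2]]; auto.
  exists (Rmin d1 d2). split. now apply Rmin_glb_lt.
  pose proof (Rmin_l d1 d2). pose proof (Rmin_r d1 d2).
  intros x y [Bx By]. apply Rle_antisym; [apply L1 | apply L2]; split; lra.
Qed.
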